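(* Let $\alpha\in\mathbb{R}\setminus\mathbb{Q}$, $E\in\mathbb{R}$, and let $v(x)=\sum_{k=-d}^d\hat v_ke^{2\pi ikx}$, $w(x)=\sum_{k=-l}^l\hat w_ke^{2\pi ikx}$ be real-valued trigonometric polynomials with $\hat v_d\ne0$, $\hat w_l\ne0$. If there exist $H\in C^\omega(\mathbb{R}/\mathbb{Z},Sp_{2l\times2}(\mathbb{R}))$ and $\psi\in C^\omega(\mathbb{R}/\mathbb{Z},\mathbb{R})$ with $\int_0^1\psi(x)dx=0$ such that $L^v_{E,w}(x)H(x)=H(x+\alpha)R_{\psi(x)}$ for all $x$, then the cocycle $(\alpha,L^w_{E,v})$ is not $PH2$.
   Context: $R_\theta=\begin{pmatrix}\cos2\pi\theta&-\sin2\pi\theta\\ \sin2\pi\theta&\cos2\pi\theta\end{pmatrix}$. For trigonometric polynomials $p(x)=\sum_{k=-m}^m\hat p_ke^{2\pi ikx}$ ($\hat p_m\ne0$) and $q$, $(L^q_{p,\alpha,x}u)_n=\sum_{k=-m}^m\hat p_ku_{n+k}+q(x+n\alpha)u_n$, and $L^q_{E,p}(x)$ is the $2m\times2m$ transfer matrix of $L^q_{p,\alpha,x}u=Eu$: first row $\frac1{\hat p_m}(-\hat p_{m-1},\dots,-\hat p_1,E-q(x)-\hat p_0,-\hat p_{-1},\dots,-\hat p_{-m})$ and $(j+1)$-th row $e_j^T$ ($j=1,\dots,2m-1$). Let $C_w$ be the $l\times l$ upper triangular matrix with $(C_w)_{ij}=\hat w_{l-j+i}$ for $j\ge i$, $S_w=\begin{pmatrix}0&-C_w^*\\C_w&0\end{pmatrix}$,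 $J=\begin{pmatrix}0&1\\-1&0\end{pmatrix}$, $Sp_{2l\times2}(\mathbb{R})=\{F\in M_{2l\times2}(\mathbb{R}):F^*S_wF=J\}$. A cocycle $(\alpha,A)$ on $\mathbb{C}^m$ is $k$-dominated if there is a continuous invariant splitting $\mathbb{C}^m=E^+(x)\oplus E^-(x)$, $\dim E^+=k$, and $N\ge1$ with $\|A_N(x)u\|>\|A_N(x)u'\|$ for all $x$ and unit $u\in E^+(x)$, $u'\in E^-(x)$, where $A_N(x)=A(x+(N-1)\alpha)\cdots A(x)$. A $2d$-dimensional cocycle is $PH2$ if it is $(d-1)$- and $(d+1)$-dominated. *)

(* Defs.v *)
From HB Require Import structures.
From mathcomp Require Import all_boot all_order all_algebra.
From mathcomp Require Import all_classical all_reals all_analysis.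
From mathcomp Require Import Rstruct Rstruct_topology.
From mathcomp Require Import complex.
Unset Printing Implicit Defensive.
Import Order.TTheory GRing.Theory Num.Theory.
Import numFieldNormedType.Exports.
Local Open Scope ring_scope.
Local Open Scope complex_scope.
Local Open Scope classical_set_scope.

Notation RR := Rdefinitions.R.

Definition RtoC (x : RR) : RR[i] := x%:C.

Definition expi (t : RR) : RR[i] := (cos t) +i* (sin t).

Definition trig_poly (c : int -> RR[i]) (m : nat) (x : RR) : RR[i] :=
  \sum_(k < (m + m).+1)
     c (k%:Z - m%:Z) * expi (2 * pi * (k%:Z - m%:Z)%:~R * x).

Definition real_valued (c : int -> RR[i]) (m : nat) : Prop :=
  forall x, complex.Im (trig_poly c m x) = 0.

(* the 2m x 2m transfer matrix L^q_{E,p}(x) of L^q_{p,alpha,x} u = E u,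
   with p of degree m given by its Fourier coefficients *)
Definition transfer_mx (p : int -> RR[i]) (m : nat) (q : RR -> RR[i])
    (E : RR) (x : RR) : 'M[RR[i]]_(m + m) :=
  \matrix_(i, j)
    if (i : nat) == 0%N then
      ((if (j : nat) == m.-1 then RtoC E - q x - p 0 else - p ((m.-1)%:Z - (j : nat)%:Z))
        / p (m%:Z))
    else ((j : nat).+1 == i)%:R.

Definition rotmx (t : RR) : 'M[RR]_2 :=
  \matrix_(i < 2, j < 2)
    if i == j then cos (2 * pi * t)
    else if (i : nat) == 0%N then - sin (2 * pi * t) else sin (2 * pi * t).

Definition Jmx : 'M[RR]_2 :=
  \matrix_(i < 2, j < 2) if i == j then 0 else if (i : nat) == 0%N then 1 else -1.

Definition C_mx (w : int -> RR[i]) (l : nat) : 'M[RR[i]]_l :=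
  \matrix_(i, j) if (i <= j)%N then w (l%:Z - (j : nat)%:Z + (i : nat)%:Z) else 0.

Definition adjmx {m n} (A : 'M[RR[i]]_(m, n)) : 'M[RR[i]]_(n, m) := (map_mx conjc A)^T.

Definition S_mx (w : int -> RR[i]) (l : nat) : 'M[RR[i]]_(l + l) :=
  block_mx 0 (- adjmx (C_mx w l)) (C_mx w l) 0.

Definition in_Sp (w : int -> RR[i]) (l : nat) (F : 'M[RR]_(l + l, 2)) : Prop :=
  adjmx (map_mx RtoC F) *m S_mx w l *m map_mx RtoC F = map_mx RtoC Jmx.

Definition real_analytic (f : RR -> RR) : Prop :=
  forall x0 : RR, exists r : RR, 0 < r /\
    exists a : nat -> RR, forall x : RR, `|x - x0| < r ->
      (fun N : nat => \sum_(n < N) a n * (x - x0) ^+ n) @ \oo --> f x.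

Definition periodic1 {T : Type} (f : RR -> T) : Prop := forall x, f (x + 1) = f x.


Definition vnorm {n} (u : 'cV[RR[i]]_n) : RR :=
  Num.sqrt (\sum_i ((complex.Re (u i 0)) ^+ 2 + (complex.Im (u i 0)) ^+ 2)).

Definition cont_cmx {m n} (P : RR -> 'M[RR[i]]_(m, n)) : Prop :=
  forall i j, continuous (fun x => complex.Re (P x i j)) /\ continuous (fun x => complex.Im (P x i j)).

Fixpoint cociter {n} (alpha : RR) (A : RR -> 'M[RR[i]]_n) (N : nat) (x : RR)
    : 'M[RR[i]]_n :=
  match N with
  | 0 => 1%:M
  | N'.+1 => A (x + N'%:R * alpha) *m cociter alpha A N' x
  end.

(* a subspace of C^n is represented by its orthogonal projection P;
   u lies in the subspace iff P u = u *)
Definition orth_proj {n} (P : 'M[RR[i]]_n) : Prop := P *m P = P /\ adjmx P = P.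
Definition in_sub {n} (P : 'M[RR[i]]_n) (u : 'cV[RR[i]]_n) : Prop := P *m u = u.

Definition invariant {n} (alpha : RR) (A : RR -> 'M[RR[i]]_n) (P : RR -> 'M[RR[i]]_n) : Prop :=
  forall x, (forall u, in_sub (P x) u -> in_sub (P (x + alpha)) (A x *m u)) /\
            (forall v, in_sub (P (x + alpha)) v -> exists u, in_sub (P x) u /\ A x *m u = v).

Definition dominated {n} (alpha : RR) (A : RR -> 'M[RR[i]]_n) (k : nat) : Prop :=
  exists Pp Pm : RR -> 'M[RR[i]]_n,
    cont_cmx Pp /\ cont_cmx Pm /\ periodic1 Pp /\ periodic1 Pm /\
    (forall x, orth_proj (Pp x) /\ orth_proj (Pm x)) /\
    (forall x, \rank (Pp x) = k /\ \rank (Pm x) = (n - k)%N) /\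
    (forall x u, in_sub (Pp x) u -> in_sub (Pm x) u -> u = 0) /\
    invariant alpha A Pp /\ invariant alpha A Pm /\
    exists N : nat, (1 <= N)%N /\
      forall x u u', in_sub (Pp x) u -> in_sub (Pm x) u' ->
        vnorm u = 1 -> vnorm u' = 1 ->
        vnorm (cociter alpha A N x *m u') < vnorm (cociter alpha A N x *m u).

Definition PH2 (d : nat) (alpha : RR) (A : RR -> 'M[RR[i]]_(d + d)) : Prop :=
  dominated alpha A d.-1 /\ dominated alpha A d.+1.

(* Main.v *)
(* Write f = H (1, -i)^T and its conjugate: these are sections of the bundle on which the cocycle
   acts through the scalars exp(2 i pi psi) and exp(-2 i pi psi). Multiplying f by exp(i phi), where
   phi(x + alpha) - phi(x) = 2 pi psi(x) up to a small error, makes these scalars trivial, and by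
   Aubry duality the Fourier coefficients of the products approximately solve the dual equation
   L^w_(E,v). They span a plane of approximate solutions which decays in both directions.

   The cohomological equation need not be solvable, as alpha may be Liouville. It is solved for the
   truncation of psi at a best denominator K of alpha, where the small divisors enlarge the norms by
   exp(o(K)) only, whereas the error is exponentially small in K. Followed over a window of length
   M = K / P with P large, the approximate solutions are close to true ones.

   The dual cocycle preserves the nondegenerate form S_v, so it does not contract the subspaces of
   dimension > d. If it were (d + 1)-dominated, the subdominant bundle, of dimension d - 1, would
   therefore be uniformly contracted in the future, and the plane, which decays in the past, would
   be transverse to it; their sum, of dimension d + 1, would be contracted: a contradiction. *)

Require Import Defs.
From HB Require Import structures.
From mathcomp Require Import all_boot all_order all_algebra.
From mathcomp Require Import all_classical all_reals all_analysis.
From mathcomp Require Import Rstruct Rstruct_topology.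
From mathcomp Require Import complex.
From mathcomp Require Import ring lra zify.
Import Order.TTheory GRing.Theory Num.Theory.
Import numFieldNormedType.Exports.
Local Open Scope ring_scope.
Local Open Scope complex_scope.
Local Open Scope classical_set_scope.
Set Implicit Arguments.
Unset Strict Implicit.

(** The order in which the constants are chosen shapes the argument. The dual transfer matrices are
    bounded by some [L] that may dwarf every decay rate available, so an approximate solution can be
    followed over n steps only if its error beats [L ^+ n], and n must be long enough for the decay
    [rho ^+ n] to beat the size of the Fourier norms, of order [b ^+ M]. Hence [b] and [rho] come
    first, then the ratio n / M, then [P], and finally the scale [M]: the error has to be
    [rho ^+ (P * M)] with [P] arbitrary, while the norms stay of order [b ^+ M] with [b] independent
    of [P]. A small-divisor loss exp(c K) with a fixed c would be useless; best denominators give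
    exp(s K) for every s > 0, and s of order ln b / P is what is spent. The non-contraction of
    subspaces of dimension above d is used twice: for the cocycle itself, on the sum with the plane,
    and for its inverse, on the dominant bundle, where it bounds the expansion and thereby, through
    domination, forces the contraction of the other bundle. *)

Local Notation cabs := (@Normc.normc RR).

(** * Modulus of complex numbers *)

Lemma cabs_ge0 (z : RR[i]) : 0 <= cabs z.
Proof. by case: z => a b; exact: sqrtr_ge0. Qed.

Lemma sqr_cabs (z : RR[i]) : cabs z ^+ 2 = complex.Re z ^+ 2 + complex.Im z ^+ 2.
Proof. by case: z => a b /=; rewrite sqr_sqrtr// addr_ge0 ?sqr_ge0. Qed.

Lemma cabsM (x y : RR[i]) : cabs (x * y) = cabs x * cabs y.
Proof. exact: Normc.normcM. Qed.

Lemma cabsD (x y : RR[i]) : cabs (x + y) <= cabs x + cabs y.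
Proof. exact: le_normcD. Qed.

Lemma cabsN (x : RR[i]) : cabs (- x) = cabs x.
Proof. exact: normcN. Qed.

Lemma cabsB (x y : RR[i]) : cabs (x - y) <= cabs x + cabs y.
Proof. by rewrite -(cabsN y); exact: cabsD. Qed.

Lemma cabs_distrC (x y : RR[i]) : cabs (x - y) = cabs (y - x).
Proof. by rewrite -cabsN opprB. Qed.

Lemma cabs_triangle (y x z : RR[i]) : cabs (x - z) <= cabs (x - y) + cabs (y - z).
Proof. by rewrite -[x - z](subrKA y); exact: cabsD. Qed.

Lemma cabs0 : cabs 0 = 0. Proof. exact: Normc.normc0. Qed.
Lemma cabs1 : cabs 1 = 1. Proof. exact: Normc.normc1. Qed.

Lemma cabs_gt0 (z : RR[i]) : (0 < cabs z) = (z != 0).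
Proof.
rewrite lt_neqAle cabs_ge0 andbT eq_sym; congr (~~ _); apply/eqP/eqP => [|->].
  exact: Normc.eq0_normc.
exact: cabs0.
Qed.

Lemma cabsV (z : RR[i]) : cabs z^-1 = (cabs z)^-1.
Proof. exact: Normc.normcV. Qed.

Lemma cabsX (z : RR[i]) n : cabs (z ^+ n) = cabs z ^+ n.
Proof. by elim: n => [|n IH]; rewrite ?expr0 ?cabs1// !exprS cabsM IH. Qed.

Lemma cabs_RtoC (x : RR) : cabs (RtoC x) = `|x|.
Proof. by rewrite /= expr0n addr0 sqrtr_sqr. Qed.

Lemma cabs_conj (z : RR[i]) : cabs z^*%C = cabs z.
Proof. by case: z => a b /=; rewrite sqrrN. Qed.

Lemma cabs_sum (I : Type) (r : seq I) (P : pred I) (F : I -> RR[i]) :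
  cabs (\sum_(i <- r | P i) F i) <= \sum_(i <- r | P i) cabs (F i).
Proof.
elim/big_ind2: _ => [|x a y b xa yb|i _]; rewrite ?cabs0//.
exact: le_trans (cabsD _ _) (lerD xa yb).
Qed.

Lemma Re_le_cabs (z : RR[i]) : `|complex.Re z| <= cabs z.
Proof.
rewrite -(@ler_pXn2r _ 2)// ?nnegrE ?cabs_ge0// sqr_cabs real_normK ?num_real//.
by rewrite lerDl sqr_ge0.
Qed.

Lemma Im_le_cabs (z : RR[i]) : `|complex.Im z| <= cabs z.
Proof.
rewrite -(@ler_pXn2r _ 2)// ?nnegrE ?cabs_ge0// sqr_cabs real_normK ?num_real//.
by rewrite lerDr sqr_ge0.
Qed.

Lemma cabs_le_ReIm (z : RR[i]) : cabs z <= `|complex.Re z| + `|complex.Im z|.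
Proof.
rewrite -(@ler_pXn2r _ 2)// ?nnegrE ?cabs_ge0 ?addr_ge0// sqr_cabs.
rewrite sqrrD !real_normK ?num_real// -addrA lerD2l.
by rewrite addrC lerDl mulrn_wge0// mulr_ge0.
Qed.

(** * Elementary bounds for trigonometric functions and characters *)

Lemma sin_mvt (R : realType) (t : R) : exists2 s : R, `|s| <= `|t| & sin t = cos s * t.
Proof.
have H (u : R) : 0 < u -> exists2 s : R, `|s| <= `|u| & sin u = cos s * u.
  move=> u0.
  have [|c] := @MVT _ sin cos 0 u u0 (fun x _ => is_derive_sin x).
    by apply: continuous_subspaceT => x; exact: continuous_sin.
  rewrite in_itv/= => /andP[c0 cu]; rewrite sin0 !subr0 => ->.
  by exists c => //; rewrite !gtr0_norm// ltW.
have [t0|t0|->] := ltgtP t 0.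
- have [|s st E] := H (- t); first by rewrite oppr_gt0.
  exists s; first by rewrite normrN in st.
  by move: E; rewrite sinN mulrN => /oppr_inj.
- exact: H.
- by exists 0; rewrite ?sin0 ?mulr0.
Qed.

Lemma norm_sin_le (R : realType) (t : R) : `|sin t| <= `|t|.
Proof.
have [s _ ->] := sin_mvt t.
by rewrite normrM ler_piMl// cos_max.
Qed.

Lemma cos_half (R : realType) (t : R) : cos t = 1 - 2 * sin (t / 2) ^+ 2.
Proof.
rewrite {1}[t]splitr -mulr2n cos_mulr2n cos2sin2.
ring.
Qed.

Lemma chord_sqr (R : realType) (t : R) :
  (cos t - 1) ^+ 2 + sin t ^+ 2 = (2 * sin (t / 2)) ^+ 2.
Proof.
rewrite sin2cos2 cos_half; ring.
Qed.

Lemma norm_cos_sub1_sqr (R : realType) (t : R) : `|cos t - 1| <= t ^+ 2.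
Proof.
rewrite cos_half.
have -> : 1 - 2 * sin (t / 2) ^+ 2 - 1 = - (2 * sin (t / 2) ^+ 2) by ring.
rewrite normrN (ger0_norm (mulr_ge0 (ler0n _ 2) (sqr_ge0 _))).
have H : `|sin (t / 2)| ^+ 2 <= `|t / 2| ^+ 2.
  by rewrite ler_pXn2r ?nnegrE// norm_sin_le.
rewrite !real_normK ?num_real// in H.
have : (t / 2) ^+ 2 = t ^+ 2 / 4 by field.
have := sqr_ge0 t; lra.
Qed.

Lemma norm_cos_sub1 (R : realType) (t : R) : `|cos t - 1| <= `|t|.
Proof.
rewrite -(@ler_pXn2r _ 2)// ?nnegrE//.
have H : `|sin (t / 2)| ^+ 2 <= `|t / 2| ^+ 2.
  by rewrite ler_pXn2r ?nnegrE// norm_sin_le.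
rewrite !real_normK ?num_real// in H *.
have := chord_sqr t; rewrite exprMn; have := sqr_ge0 (sin t).
have : (t / 2) ^+ 2 = t ^+ 2 / 4 by field.
lra.
Qed.

(** By the mean value theorem sin (2 u) = 2 u cos u cos s with |s| <= |u| <= pi / 4, and the squares
    of both cosines are at least 1 / 2. *)
Lemma sin_lower (R : realType) (u : R) : `|u| <= pi / 4 -> `|u| <= `|sin (u *+ 2)|.
Proof.
move=> uq.
have H (s : R) : `|s| <= pi / 4 -> 1 / 2 <= cos s ^+ 2 /\ 0 <= cos s.
  have pi0 := pi_gt0 R.
  move=> sq; split; last first.
    by apply: cos_ge0_pihalf; move: sq; rewrite ler_norml => /andP[? ?]; lra.
  have : 0 <= cos (s *+ 2).
    by apply: cos_ge0_pihalf; move: sq; rewrite ler_norml => /andP[? ?]; lra.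
  by rewrite cos_mulr2n; lra.
have [s su E] := sin_mvt u.
have [c1 c2] := H _ uq.
have [d1 d2] := H s (le_trans su uq).
rewrite sin_mulr2n E normrMn !normrM (ger0_norm c2) (ger0_norm d2).
have cd : 1 / 2 <= cos u * cos s.
  have h2 : 0 <= 1 / 2 :> R by lra.
  rewrite -(@ler_pXn2r _ 2) ?nnegrE ?mulr_ge0//.
  by rewrite [X in X <= _]expr2 exprMn; apply: ler_pM.
rewrite mulr2n mulrA.
by have := ler_wpM2r (normr_ge0 u) cd; lra.
Qed.

Lemma expiD (s t : RR) : expi (s + t) = expi s * expi t.
Proof.
rewrite /expi trigo.cosD trigo.sinD; simpc; congr (_ +i* _).
by rewrite addrC mulrC [X in _ + X]mulrC.
Qed.

Lemma expi0 : expi 0 = 1. Proof. by rewrite /expi cos0 sin0. Qed.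

Lemma conj_expi (t : RR) : (expi t)^*%C = expi (- t).
Proof. by rewrite /expi /= cosN sinN. Qed.

Lemma cabs_expi (t : RR) : cabs (expi t) = 1.
Proof. by rewrite /= cos2Dsin2 sqrtr1. Qed.

Lemma cabs_expi_sub1 (t : RR) : cabs (expi t - 1) = 2 * `|sin (t / 2)|.
Proof.
have -> : 2 * `|sin (t / 2)| = `|2 * sin (t / 2)| :> RR by rewrite normrM (ger0_norm (ler0n _ 2)).
apply: (@pexpIrn _ 2); rewrite ?nnegrE ?cabs_ge0 ?normr_ge0//.
by rewrite sqr_cabs real_normK ?num_real// -chord_sqr /= subr0.
Qed.

Lemma cabs_expi_sub1_le (t : RR) : cabs (expi t - 1) <= `|t|.
Proof.
rewrite cabs_expi_sub1; have := norm_sin_le (t / 2).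
have -> : `|t / 2| = `|t| / 2 by rewrite normrM normfV (ger0_norm (ler0n _ 2)).
lra.
Qed.

Lemma expi_lipschitz (s t : RR) : cabs (expi s - expi t) <= `|s - t|.
Proof.
have -> : expi s - expi t = expi t * (expi (s - t) - 1).
  by rewrite mulrBr mulr1 -expiD [t + _]addrC subrK.
by rewrite cabsM cabs_expi mul1r cabs_expi_sub1_le.
Qed.

(** A second-order error survives the passage to J-th powers: it multiplies the error by about J,
    while t is divided by J. *)
Lemma cabs_expi_sub1_lin (t : RR) :
  cabs (expi t - (1 + RtoC t * 'i%C)) <= 2 * t ^+ 2.
Proof.
apply: le_trans (cabs_le_ReIm _) _.
have -> : complex.Re (expi t - (1 + RtoC t * 'i%C)) = cos t - 1.
  by rewrite /RtoC /expi; simpc => /=; rewrite ?addr0.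
have -> : complex.Im (expi t - (1 + RtoC t * 'i%C)) = sin t - t.
  by rewrite /RtoC /expi; simpc => /=; rewrite ?add0r.
have -> : 2 * t ^+ 2 = t ^+ 2 + t ^+ 2 by ring.
have [s st E] := sin_mvt t.
have K : `|sin t - t| <= t ^+ 2.
  have -> : sin t - t = (cos s - 1) * t by rewrite E; ring.
  rewrite normrM -real_normK ?num_real// expr2 ler_wpM2r//.
  exact: le_trans (norm_cos_sub1 s) st.
by apply: lerD => //; exact: norm_cos_sub1_sqr.
Qed.

Definition ee (t : RR) : RR[i] := expi (2 * pi * t).

Lemma eeD (s t : RR) : ee (s + t) = ee s * ee t.
Proof. by rewrite /ee mulrDr expiD. Qed.

Lemma ee0 : ee 0 = 1.
Proof. by rewrite /ee mulr0 expi0. Qed.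

Lemma cabs_ee (t : RR) : cabs (ee t) = 1.
Proof. exact: cabs_expi. Qed.

Lemma conj_ee (t : RR) : (ee t)^*%C = ee (- t).
Proof. by rewrite /ee conj_expi mulrN. Qed.

Lemma ee_natM (n : nat) (t : RR) : ee (n%:R * t) = ee t ^+ n.
Proof.
by elim: n => [|n IH]; rewrite ?mul0r ?ee0 ?expr0// -[n.+1]addn1 natrD mulrDl mul1r eeD IH exprD expr1.
Qed.

Lemma ee1 : ee 1 = 1.
Proof.
rewrite /ee /expi mulr1; have -> : 2 * pi = pi *+ 2 :> RR by rewrite mulrC mulr_natr.
by rewrite cos2pi sin2pi.
Qed.

Lemma ee_int (n : int) : ee n%:~R = 1.
Proof.
case: n => n; first by rewrite -[LHS]/(ee n%:R) -[n%:R]mulr1 ee_natM ee1 expr1n.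
by rewrite NegzE rmorphN /= -conj_ee -[n.+1%:~R]/(n.+1%:R) -[n.+1%:R]mulr1 ee_natM ee1 expr1n conjc1.
Qed.

Lemma ee_periodic (t : RR) (n : int) : ee (t + n%:~R) = ee t.
Proof. by rewrite eeD ee_int mulr1. Qed.

Lemma ee_lipschitz (s t : RR) : cabs (ee s - ee t) <= 8 * `|s - t|.
Proof.
apply: le_trans (expi_lipschitz _ _) _.
rewrite -mulrBr normrM ler_wpM2r// ger0_norm; last by rewrite mulr_ge0 ?pi_ge0.
have := @pihalf_lt2 RR; lra.
Qed.

Lemma ee_sub1_ge (t : RR) : `|t| <= 1 / 2 -> 2 * `|t| <= cabs (ee t - 1).
Proof.
move=> t2; rewrite /ee cabs_expi_sub1.
have pi4 := pi_gt0 RR; have p2 := @pi_ge2 RR.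
have -> : 2 * pi * t / 2 = (pi / 2 * t) *+ 2 by rewrite mulr2n; field.
have E : `|pi / 2 * t| = pi / 2 * `|t|.
  by rewrite normrM ger0_norm// divr_ge0 ?ler0n// ltW.
apply: (@le_trans _ _ (2 * `|pi / 2 * t|)).
  by rewrite E; have := ler_wpM2r (normr_ge0 t) p2; lra.
rewrite ler_pM2l; last lra.
apply: sin_lower; rewrite E.
by have := ler_wpM2l (ltW pi4) t2; lra.
Qed.

(** * Finite differences of real analytic functions *)

(** Differences replace derivatives: they pass to pointwise limits of partial sums, and on sampled
    Fourier coefficients they act as exact multipliers. *)
Definition fdiff (R : realType) (h : R) (g : R -> R) : R -> R :=
  fun x => g (x + h) - g x.

Notation fdiffn n h g := (iter n (fdiff h) g).

Lemma fdiffnS (R : realType) n (h : R) g x :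
  fdiffn n.+1 h g x = fdiffn n h g (x + h) - fdiffn n h g x.
Proof. by []. Qed.

Lemma fdiffn_const (R : realType) n (h a x : R) : fdiffn n.+1 h (fun=> a) x = 0.
Proof.
elim: n x => [|n IH] x; first by rewrite fdiffnS subrr.
by rewrite fdiffnS !IH subrr.
Qed.

Lemma fdiffn_leibniz (R : realType) n (h c : R) f x :
  fdiffn n.+1 h (fun t => (t - c) * f t) x =
  (x - c) * fdiffn n.+1 h f x + n.+1%:R * h * fdiffn n h f (x + h).
Proof.
elim: n x => [|n IH] x; first by rewrite !fdiffnS /=; ring.
rewrite fdiffnS !IH [in RHS]fdiffnS.
rewrite [fdiffn n.+1 h f (x + h)]fdiffnS [fdiffn n.+1 h f x]fdiffnS.
rewrite -[n.+2]addn1 natrD; ring.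
Qed.

(** This mimics the bound n! C(m, n) T^(m - n) on the n-th derivative of (t - c)^m. Multiplication
    by t - c obeys a Leibniz rule with a single correction term, so the induction on m closes by
    Pascal's rule. The factor [T ^+ n] on the left avoids the exponent m - n when m < n. *)
Lemma fdiffn_monomial (R : realType) (m n : nat) (h c T x : R) : 0 <= h ->
  c - T <= x -> x + n%:R * h <= c + T ->
  `|fdiffn n h (fun t => (t - c) ^+ m) x| * T ^+ n
     <= n`!%:R * h ^+ n * 'C(m, n)%:R * T ^+ m.
Proof.
move=> h0.
elim: m n x => [|m IH] n x xl xr.
  case: n xr => [|n] xr; last by rewrite fdiffn_const normr0 mul0r bin0n mulr0 mul0r.
  by rewrite /= !expr0 bin0 normr1 !mulr1 fact0.
have nh : 0 <= n%:R * h by rewrite mulr_ge0.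
have xT : `|x - c| <= T by rewrite ler_norml; apply/andP; split; lra.
have T0 : 0 <= T := le_trans (normr_ge0 _) xT.
case: n xr nh => [|n] xr nh.
  by rewrite /= !expr0 bin0 fact0 !mul1r mulr1 normrX ler_pXn2r ?nnegrE.
have -> : (fun t : R => (t - c) ^+ m.+1) = (fun t => (t - c) * (t - c) ^+ m).
  by apply: funext => t; rewrite exprS.
rewrite fdiffn_leibniz binS factS.
have A := IH n.+1 x xl xr.
have [xl' xr'] : c - T <= x + h /\ x + h + n%:R * h <= c + T.
  by move: xr; rewrite -natr1 mulrDl mul1r => ?; split; lra.
have B := IH n _ xl' xr'.
set D1 := fdiffn n.+1 h _ x in A *; set D2 := fdiffn n h _ _ in B *.
apply: (@le_trans _ _ ((T * `|D1| + n.+1%:R * h * `|D2|) * T ^+ n.+1)).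
  rewrite ler_wpM2r ?exprn_ge0//; apply: le_trans (ler_normD _ _) _.
  rewrite !normrM (ger0_norm h0) normr_nat lerD2r.
  by rewrite ler_wpM2r.
rewrite mulrDl.
have A' := ler_wpM2l T0 A.
have B' := ler_wpM2l (mulr_ge0 (mulr_ge0 (ler0n _ n.+1) h0) T0) B.
have FE : (n.+1)`!%:R = n.+1%:R * n`!%:R :> R by rewrite factS natrM.
rewrite -factS [('C(m, n.+1) + 'C(m, n))%:R]natrD !exprS.
move: A' B'; rewrite !exprS FE.
set F := n`!%:R; set H := h ^+ n; set c1 := 'C(m, n.+1)%:R; set c2 := 'C(m, n)%:R.
set Tn := T ^+ n; set Tm := T ^+ m; set N := n.+1%:R; lra.
Qed.

Lemma fdiffn_sum (R : realType) n (h x : R) N (a : nat -> R) (F : nat -> R -> R) :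
  fdiffn n h (fun t => \sum_(i < N) a i * F i t) x =
  \sum_(i < N) a i * fdiffn n h (F i) x.
Proof.
elim: n x => [//|n IH] x; rewrite fdiffnS !IH -sumrB.
by apply: eq_bigr => i _; rewrite fdiffnS mulrBr.
Qed.

Lemma cvg_fdiffn (R : realType) n (h x : R) (F : nat -> R -> R) (g : R -> R) :
  (forall j, (j <= n)%N -> (F N (x + j%:R * h)) @[N --> \oo] --> g (x + j%:R * h)) ->
  fdiffn n h (F N) x @[N --> \oo] --> fdiffn n h g x.
Proof.
elim: n x => [|n IH] x H.
  by have := H 0%N (leqnn _); rewrite mul0r addr0.
under eq_fun do rewrite fdiffnS; rewrite fdiffnS.
apply: cvgB; apply: IH => j jn; last by apply: H; exact: leqW.
have -> : x + h + j%:R * h = x + j.+1%:R * h by rewrite -natr1; ring.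
exact: H.
Qed.

Lemma bin_le_expn2 m n : ('C(m, n) <= 2 ^ m)%N.
Proof.
elim: m n => [|m IH] [|n]; rewrite ?bin0 ?expn_gt0// ?bin0n//.
by rewrite binS expnS mul2n -addnn leq_add.
Qed.

Lemma geometric_sum_le (R : realType) (q : R) N : 0 <= q -> q < 1 ->
  \sum_(i < N) q ^+ i <= (1 - q)^-1.
Proof.
move=> q0 q1; have q1' : 0 < 1 - q by rewrite subr_gt0.
rewrite -(ler_pM2r q1') mulVf ?gt_eqF//.
have := subrX1 q N; have := exprn_ge0 N q0; set s := \sum_(i < N) _; lra.
Qed.

Lemma power_series_terms_bounded (R : realType) (a : nat -> R) (t l : R) :
  (fun N : nat => \sum_(n < N) a n * t ^+ n) @ \oo --> l ->
  exists2 M : R, 0 <= M & forall n, `|a n * t ^+ n| <= M.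
Proof.
move=> H.
have : bounded_fun (fun N : nat => \sum_(n < N) a n * t ^+ n).
  by apply: cvg_seq_bounded; apply/cvg_ex; exists l.
move=> [M0 [_ HM]]; set M := M0 + 1.
have HM' n : `|\sum_(i < n) a i * t ^+ i| <= M.
  by apply: (HM M _ n I); rewrite ltrDl.
exists (M + M).
  by rewrite addr_ge0// (le_trans (normr_ge0 _) (HM' 0%N)).
move=> n; have -> : a n * t ^+ n = \sum_(i < n.+1) a i * t ^+ i - \sum_(i < n) a i * t ^+ i.
  by rewrite big_ord_recr /= [X in _ = X]addrC addKr.
by apply: le_trans (ler_normB _ _) _; exact: lerD.
Qed.

(** The terms of the series are bounded at distance r / 2 from the centre. On the interval of radius
    T = r / 8 the inequality C(i, n) <= 2^i turns T^i into (r / 4)^i, so the sum over i is dominated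
    by a geometric series of ratio 1 / 2. *)
Lemma fdiffn_analytic (R : realType) (g : R -> R) (a : nat -> R) (x0 r : R) : 0 < r ->
  (forall x, `|x - x0| < r ->
    (fun N : nat => \sum_(n < N) a n * (x - x0) ^+ n) @ \oo --> g x) ->
  exists2 M : R, 0 <= M & forall n (h x : R), 0 <= h -> x0 - r / 8 <= x -> x + n%:R * h <= x0 + r / 8 ->
    `|fdiffn n h g x| * (r / 8) ^+ n <= M * n`!%:R * h ^+ n.
Proof.
move=> r0 H.
have [|M M0 HM] := @power_series_terms_bounded R a (r / 2) (g (x0 + r / 2)).
  have := H (x0 + r / 2); rewrite [x0 + _]addrC addrK; apply.
  by rewrite gtr0_norm; lra.
exists (M * 2); first by rewrite mulr_ge0.
move=> n h x h0 xl xr.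
set T := r / 8 in xl xr *; have T0 : 0 < T by rewrite divr_gt0.
have cv : fdiffn n h (fun t => \sum_(i < N) a i * (t - x0) ^+ i) x @[N --> \oo]
     --> fdiffn n h g x.
  apply: (@cvg_fdiffn R n h x (fun N t => \sum_(i < N) a i * (t - x0) ^+ i)) => j jn.
  apply: H; have : j%:R * h <= n%:R * h by rewrite ler_wpM2r// ler_nat.
  have : 0 <= j%:R * h by rewrite mulr_ge0.
  move=> ? ?; rewrite ltr_norml; apply/andP; split; rewrite /T in xl xr; lra.
have K : 0 <= n`!%:R * h ^+ n by rewrite mulr_ge0 ?exprn_ge0.
rewrite -ler_pdivlMr ?exprn_gt0//.
apply: (closed_cvg (fun y => `|y| <= M * 2 * n`!%:R * h ^+ n / T ^+ n) _ _ _ cv) => //.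
  by apply: closed_comp (@closed_le _ _) => y _; exact: norm_continuous.
apply: nearW => N /=; rewrite ler_pdivlMr ?exprn_gt0//.
rewrite (@fdiffn_sum R n h x N a (fun i t => (t - x0) ^+ i)).
apply: le_trans (ler_wpM2r (exprn_ge0 _ (ltW T0)) (ler_norm_sum _ _ _)) _.
rewrite mulr_suml.
apply: (@le_trans _ _ (\sum_(i < N) (n`!%:R * h ^+ n) * (M * (1 / 2) ^+ i))); last first.
  rewrite -!mulr_sumr [X in X <= _]mulrC -!mulrA ler_wpM2l//.
  rewrite [X in X <= _]mulrC [X in _ <= X]mulrC.
  rewrite ler_wpM2l//.
  have := @geometric_sum_le R (1 / 2) N.
  have -> : (1 - 1 / 2)^-1 = 2 :> R by field.
  by apply; lra.
apply: ler_sum => i _; rewrite normrM -mulrA.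
apply: (@le_trans _ _ (`|a i| * (n`!%:R * h ^+ n * 'C(i, n)%:R * T ^+ i))).
  by rewrite ler_wpM2l//; exact: fdiffn_monomial.
have -> : `|a i| * (n`!%:R * h ^+ n * 'C(i, n)%:R * T ^+ i) =
    n`!%:R * h ^+ n * (`|a i| * ('C(i, n)%:R * T ^+ i)) by ring.
rewrite ler_wpM2l//.
apply: (@le_trans _ _ (`|a i| * (2 ^+ i * T ^+ i))).
  apply: ler_wpM2l => //; apply: ler_wpM2r; first by rewrite exprn_ge0 ?ltW.
  by rewrite -natrX ler_nat; exact: bin_le_expn2.
rewrite -exprMn.
have -> : 2 * T = r / 2 * (1 / 2) by rewrite /T; field.
rewrite exprMn mulrA ler_wpM2r ?exprn_ge0 ?divr_ge0//.
have := HM i; rewrite normrM normrX [`|r / 2|]gtr0_norm//; lra.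
Qed.

(** A single natural number plays the role of all constants, so finitely many local bounds merge by
    taking the largest. *)
Lemma compact_uniform_bound (R : realType) (P : nat -> R -> Prop) :
  (forall B B' x, (B <= B')%N -> P B x -> P B' x) ->
  (forall x0, exists B, exists2 e : R, 0 < e & forall x : R, `|x - x0| < e -> P B x) ->
  exists B, forall x : R, 0 <= x <= 1 -> P B x.
Proof.
move=> mono loc.
have /compact_near_coveringP/(_ nat \oo P) := @segment_compact R 0 1.
case=> [x0 _|B _ HB].
  have [B [e e0 H]] := loc x0.
  exists (ball x0 e, [set n | (B <= n)%N]) => /=.
    by split; [exact: nbhsx_ballx|exists B].
  move=> [x n] /= [xe Bn]; apply: mono Bn _; apply: H.
  by rewrite distrC.
by exists B => x x01; apply: (HB B) => //=; rewrite in_itv/=.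
Qed.

Lemma periodic1_int (T : Type) (f : RR -> T) (n : int) x :
  periodic1 f -> f (x + n%:~R) = f x.
Proof.
move=> pf.
have H (m : nat) y : f (y + m%:R) = f y.
  by elim: m y => [|m IH] y; rewrite ?addr0// -[m.+1]addn1 natrD addrA pf IH.
case: n => m; first exact: H.
rewrite NegzE rmorphN /=; rewrite -[in RHS](subrK m.+1%:R x) H.
by [].
Qed.

Lemma fdiffn_periodic n (h : RR) g : periodic1 g -> periodic1 (fdiffn n h g).
Proof.
move=> pg; elim: n => [//|n IH] x; rewrite !fdiffnS.
by rewrite addrAC !IH.
Qed.

Lemma floor_decomp (x : RR) : exists n : int, exists2 y : RR, 0 <= y < 1 & x = y + n%:~R.
Proof.
exists (Num.floor x), (x - (Num.floor x)%:~R); last by rewrite subrK.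
have := floor_itv x; rewrite intrD => /andP[? ?].
by apply/andP; split; [rewrite subr_ge0|rewrite ltrBlDr addrC].
Qed.

(** The integer [B.+1] serves at once as amplitude, as inverse radius and as inverse bound on the
    reach [n%:R * h], which is the monotone form required by the compactness argument. *)
Lemma fdiffn_local_bound (R : realType) (g : R -> R) (a : nat -> R) (x0 r : R) : 0 < r ->
  (forall x, `|x - x0| < r ->
    (fun N : nat => \sum_(n < N) a n * (x - x0) ^+ n) @ \oo --> g x) ->
  exists B : nat, exists2 e : R, 0 < e & forall x, `|x - x0| < e ->
    forall n (h : R), 0 <= h -> n%:R * h <= B.+1%:R^-1 ->
    `|fdiffn n h g x| <= B.+1%:R * n`!%:R * (B.+1%:R * h) ^+ n.
Proof.
move=> r0 Ha.
have [M M0 HM] := fdiffn_analytic r0 Ha.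
set T := r / 8 in HM; have T0 : 0 < T by rewrite divr_gt0// ltr0n.
(* The term [2 / T] keeps the reach below T / 2, so that differences based within T / 2 of [x0] stay
   in the interval of radius T. *)
pose B := Num.bound (Num.max M (2 / T)).
have BM : Num.max M (2 / T) < B.+1%:R.
  apply: lt_trans (archi_boundP _) _; first by rewrite le_max M0.
  by rewrite ltr_nat.
move: BM; rewrite gt_max => /andP[BM BT].
exists B, (T / 2); first by rewrite divr_gt0// ltr0n.
move=> x; rewrite ltr_norml => /andP[xl xr] n h h0 nh.
have B0 : 0 < B.+1%:R :> R by rewrite ltr0n.
have iB : B.+1%:R^-1 <= T / 2.
  by rewrite -[T / 2]invrK lef_pV2 ?posrE ?invr_gt0 ?divr_gt0 ?ltr0n// invf_div ltW.
have nh0 : 0 <= n%:R * h by rewrite mulr_ge0 ?ler0n.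
have H := HM n h x h0.
have nT := le_trans nh iB.
have {}H : `|fdiffn n h g x| * T ^+ n <= M * n`!%:R * h ^+ n.
  by apply: H; move: xl xr nT T0; clear; clearbody T; [|set y := n%:R * h]; lra.
clearbody T; have T0' := ltW T0.
apply: (@le_trans _ _ (M * n`!%:R * h ^+ n / T ^+ n)).
  by rewrite ler_pdivlMr ?exprn_gt0.
rewrite -[X in X <= _]mulrA -expr_div_n.
apply: ler_pM; rewrite ?mulr_ge0 ?ler0n ?exprn_ge0 ?divr_ge0//.
  by rewrite ler_wpM2r ?ler0n// ltW.
apply: lerXn2r; rewrite ?nnegrE ?mulr_ge0 ?invr_ge0 ?ler0n//.
rewrite mulrC ler_wpM2r//.
apply: le_trans (ltW BT); rewrite -[X in X <= _]mul1r ler_wpM2r ?invr_ge0 ?(ltW T0)//.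
by rewrite ler1n.
Qed.

Lemma analytic_fdiffn_bound (g : RR -> RR) : real_analytic g -> periodic1 g ->
  exists2 B : nat, (0 < B)%N & forall (x : RR) n (h : RR), 0 <= h -> n%:R * h <= B%:R^-1 ->
    `|fdiffn n h g x| <= B%:R * n`!%:R * (B%:R * h) ^+ n.
Proof.
move=> ag pg.
pose P (B : nat) (x : RR) := forall n (h : RR), 0 <= h -> n%:R * h <= B.+1%:R^-1 ->
    `|fdiffn n h g x| <= B.+1%:R * n`!%:R * (B.+1%:R * h) ^+ n.
have [B HB] : exists B, forall x : RR, 0 <= x <= 1 -> P B x.
  apply: compact_uniform_bound => [B B' x BB' PB n h h0 nh|x0].
    apply: le_trans (PB n h h0 _) _.
      by apply: le_trans nh _; rewrite lef_pV2 ?posrE ?ltr0n// ler_nat.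
    apply: ler_pM; rewrite ?mulr_ge0 ?exprn_ge0 ?mulr_ge0//.
      by rewrite ler_wpM2r// ler_nat.
    apply: lerXn2r; rewrite ?nnegrE ?mulr_ge0//.
    by rewrite ler_wpM2r// ler_nat.
  have [r [r0 [a Ha]]] := ag x0.
  exact: fdiffn_local_bound r0 Ha.
exists B.+1 => // x n h h0 nh.
have [m [y /andP[y0 y1] ->]] := floor_decomp x.
rewrite (periodic1_int _ _ (fdiffn_periodic n h pg)).
by apply: HB => //; rewrite y0 ltW.
Qed.

(** * Sampled Fourier coefficients of analytic functions *)

Lemma RtoCM (x y : RR) : RtoC (x * y) = RtoC x * RtoC y.
Proof. exact: rmorphM. Qed.
Lemma RtoCB (x y : RR) : RtoC (x - y) = RtoC x - RtoC y.
Proof. exact: rmorphB. Qed.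
Lemma RtoC_nat (n : nat) : RtoC n%:R = n%:R.
Proof. exact: rmorph_nat. Qed.
Lemma RtoCV (x : RR) : RtoC x^-1 = (RtoC x)^-1.
Proof. exact: fmorphV. Qed.

Lemma ee_eq1_small (t : RR) : `|t| <= 1 / 2 -> ee t = 1 -> t = 0.
Proof.
move=> t2 E; apply/eqP; rewrite -normr_eq0 eq_le normr_ge0 andbT.
have := ee_sub1_ge t2; rewrite E subrr cabs0; lra.
Qed.

Lemma ee_div_eq1 (Q : nat) (m : int) : (0 < Q)%N -> ee (m%:~R / Q%:R) = 1 ->
  (Q%:Z %| m)%Z.
Proof.
move=> Q0; have Qr : 0 < Q%:R :> RR by rewrite ltr0n.
have Qr0 : Q%:R != 0 :> RR by rewrite gt_eqF.
have QZ : Q%:Z != 0 by lia.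
rewrite {1}(divz_eq m Q) intrD intrM mulrDl mulfK// addrC ee_periodic.
have := modz_ge0 m QZ; have := ltz_mod m QZ.
have -> : (Q%:Z %| m)%Z = ((m %% Q)%Z == 0).
  by apply/idP/eqP => [/dvdz_mod0P//|/dvdz_mod0P].
case: (m %% Q)%Z => [r|//]; rewrite ltz_nat => rQ _ E.
have {}rQ : (r < Q)%N by lia.
have E' : ee (r%:R / Q%:R) = 1 by exact: E.
have rQ' : r%:R < Q%:R :> RR by rewrite ltr_nat.
have r0 : 0 <= r%:R :> RR by rewrite ler0n.
have [h|h] := leqP (2 * r) Q.
  have h' : 2 * r%:R <= Q%:R :> RR by rewrite -natrM ler_nat.
  have : r%:R / Q%:R = 0 :> RR.
    apply: ee_eq1_small E'; rewrite ger0_norm ?divr_ge0 ?ler0n//.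
    by rewrite ler_pdivrMr//; lra.
  by move/eqP; rewrite mulf_eq0 invr_eq0 (negbTE Qr0) orbF pnatr_eq0 => /eqP ->.
have h' : Q%:R <= 2 * r%:R :> RR by rewrite -natrM ler_nat ltnW.
have : r%:R / Q%:R + (-1)%:~R = 0 :> RR.
  apply: ee_eq1_small; last by rewrite ee_periodic.
  have -> : r%:R / Q%:R + (-1)%:~R = - ((Q%:R - r%:R) / Q%:R) :> RR.
    by rewrite mulrBl divff// rmorphN opprB.
  rewrite normrN ger0_norm; last by rewrite divr_ge0 ?ler0n// subr_ge0 ltW.
  by rewrite ler_pdivrMr//; lra.
move=> H; exfalso; have : r%:R / Q%:R < 1 :> RR by rewrite ltr_pdivrMr// mul1r.
by move: H; rewrite rmorphN => /subr0_eq ->; rewrite ltxx.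
Qed.

Lemma ee_dvd (Q : nat) (m : int) : (0 < Q)%N -> (Q%:Z %| m)%Z -> ee (m%:~R / Q%:R) = 1.
Proof.
move=> Q0 /dvdzP[q ->]; rewrite intrM mulfK ?ee_int//.
by rewrite gt_eqF// ltr0n.
Qed.

Lemma sum_ee (Q : nat) (m : int) : (0 < Q)%N ->
  \sum_(i < Q) ee (m%:~R * (i%:R / Q%:R)) = if (Q%:Z %| m)%Z then Q%:R else 0.
Proof.
move=> Q0; pose z := ee (m%:~R / Q%:R).
have E (i : nat) : ee (m%:~R * (i%:R / Q%:R)) = z ^+ i.
  by rewrite /z -ee_natM; congr ee; rewrite mulrCA.
under eq_bigr do rewrite E.
case: ifP => [/(ee_dvd Q0) z1|/negbT nz].
  by rewrite /z z1; under eq_bigr do rewrite expr1n; rewrite sumr_const card_ord.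
have z1 : z - 1 != 0.
  by rewrite subr_eq0; apply: contra nz => /eqP /(ee_div_eq1 Q0).
apply: (mulfI z1); rewrite -subrX1 mulr0.
rewrite /z -ee_natM mulrCA divff ?mulr1 ?ee_int ?subrr//.
by rewrite gt_eqF// ltr0n.
Qed.

Lemma sum_shift_periodic (V : zmodType) (F : nat -> V) Q : F Q = F 0%N ->
  \sum_(j < Q) F j.+1 = \sum_(j < Q) F j.
Proof.
move=> FQ; apply: (@addrI _ (F 0%N)).
have <- : \sum_(j < Q.+1) F j = F 0%N + \sum_(j < Q) F j.+1 by rewrite big_ord_recl.
by rewrite big_ord_recr /= FQ addrC.
Qed.

(* Sampled Fourier coefficients: aliasing compares those at different scales, so no Fourier
   integral is needed. *)
Definition dft (Q : nat) (g : RR -> RR) (k : int) : RR[i] :=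
  RtoC (Q%:R^-1) *
  \sum_(j < Q) RtoC (g (j%:R / Q%:R)) * ee (- (k%:~R * (j%:R / Q%:R))).

(** Summation by parts on the cyclic group of order Q; periodicity of g closes the sum. *)
Lemma dft_fdiff (Q : nat) (g : RR -> RR) (k : int) : (0 < Q)%N -> periodic1 g ->
  dft Q (fdiff Q%:R^-1 g) k = (ee (k%:~R / Q%:R) - 1) * dft Q g k.
Proof.
move=> Q0 pg; have Qr0 : Q%:R != 0 :> RR by rewrite gt_eqF// ltr0n.
pose F (j : nat) := RtoC (g (j%:R / Q%:R)) * ee (- (k%:~R * (j%:R / Q%:R))).
have FQ : F Q = F 0%N.
  rewrite /F divff// mul0r mulr0 oppr0 mulr1 -{1}[1]add0r pg -mulrNz.
  by rewrite -[X in _ * ee X]add0r ee_periodic.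
have E : \sum_(j < Q) F j = \sum_(j < Q) F j.+1 by rewrite (sum_shift_periodic FQ).
rewrite /dft mulrCA; congr (_ * _).
transitivity (ee (k%:~R / Q%:R) * \sum_(j < Q) F j - \sum_(j < Q) F j); last first.
  by rewrite mulrBl mul1r.
rewrite {1}E mulr_sumr -sumrB; apply: eq_bigr => j _.
rewrite /fdiff RtoCB mulrBl; congr (_ - _).
rewrite /F [RHS]mulrCA -eeD.
have -> : j.+1%:R / Q%:R = j%:R / Q%:R + Q%:R^-1 :> RR.
  by rewrite -natr1 mulrDl mul1r.
by congr (_ * ee _); ring.
Qed.

Lemma dft_fdiffn (n Q : nat) (g : RR -> RR) (k : int) : (0 < Q)%N -> periodic1 g ->
  dft Q (fdiffn n Q%:R^-1 g) k = (ee (k%:~R / Q%:R) - 1) ^+ n * dft Q g k.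
Proof.
move=> Q0 pg; elim: n => [|n IH]; first by rewrite expr0 mul1r.
by rewrite iterS dft_fdiff ?IH ?exprS ?mulrA//; exact: fdiffn_periodic.
Qed.

Lemma cabs_dft_le (Q : nat) (g : RR -> RR) (k : int) (b : RR) : (0 < Q)%N ->
  (forall x, `|g x| <= b) -> cabs (dft Q g k) <= b.
Proof.
move=> Q0 gb; have Qr : 0 < Q%:R :> RR by rewrite ltr0n.
rewrite /dft cabsM cabs_RtoC normfV normr_nat mulrC ler_pdivrMr//.
apply: le_trans (cabs_sum _ _ _) _.
apply: (@le_trans _ _ (\sum_(j < Q) b)).
  by apply: ler_sum => j _; rewrite cabsM cabs_ee mulr1 cabs_RtoC.
by rewrite sumr_const card_ord mulr_natr.
Qed.

Lemma bernoulli_ineq (R : realType) (x : R) n : 0 <= x -> x <= 1 -> 1 - n%:R * x <= (1 - x) ^+ n.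
Proof.
move=> x0 x1; elim: n => [|n IH]; first by rewrite expr0 mul0r subr0.
rewrite exprS; have h : 0 <= 1 - x by rewrite subr_ge0.
apply: le_trans (ler_wpM2l h IH); rewrite -natr1.
have : 0 <= n%:R * x ^+ 2 by rewrite mulr_ge0 ?ler0n ?sqr_ge0.
by rewrite expr2; lra.
Qed.

(** Bernoulli's inequality gives (1 - 1 / (2 B))^B >= 1 / 2; the factor 2 pays for the remainder of
    k modulo B. *)
Lemma half_pow_div (R : realType) (B k : nat) : (0 < B)%N ->
  (2^-1 : R) ^+ (k %/ B) <= 2 * (1 - (2 * B%:R)^-1) ^+ k.
Proof.
move=> B0; set q := 1 - _.
have B1 : 1 <= B%:R :> R by rewrite ler1n.
have i0 : 0 < (2 * B%:R)^-1 :> R by rewrite invr_gt0 mulr_gt0 ?ltr0n.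
have i1 : (2 * B%:R)^-1 <= 2^-1 :> R.
  by rewrite lef_pV2 ?posrE ?mulr_gt0 ?ltr0n//; lra.
have q0 : 0 <= q by rewrite /q; lra.
have q1 : q <= 1 by rewrite /q; lra.
have qB : 2^-1 <= q ^+ B.
  have := @bernoulli_ineq R (2 * B%:R)^-1 B.
  have -> : B%:R * (2 * B%:R)^-1 = 2^-1 :> R.
    by rewrite invfM mulrCA mulfV ?mulr1// gt_eqF// ltr0n.
  rewrite -/q => H; apply: le_trans (H _ _); lra.
rewrite {2}(divn_eq k B) exprD mulnC exprM.
have r1 : q ^+ B <= q ^+ (k %% B).
  by apply: ler_wiXn2l => //; rewrite ltnW// ltn_mod.
have h2 : 0 <= 2^-1 :> R by rewrite invr_ge0 ler0n.
have : (2^-1) ^+ (k %/ B) <= (q ^+ B) ^+ (k %/ B).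
  by apply: lerXn2r => //; rewrite nnegrE exprn_ge0.
have p0 : 0 <= (q ^+ B) ^+ (k %/ B) by rewrite !exprn_ge0.
have := ler_wpM2l p0 (le_trans qB r1).
set a := _ ^+ (k %/ B); set b := _ ^+ (k %/ B); lra.
Qed.

Lemma fact_le_exp n : (n`! <= n ^ n)%N.
Proof.
elim: n => [//|n IH]; rewrite factS expnS leq_mul2l /=.
apply: leq_trans IH _; case: n => // n; by rewrite leq_exp2r.
Qed.

(** The order of the difference is optimised as n = |k| / B. Since 2 |k| <= Q, the multiplier is at
    least 2 |k| / Q, and up to a factor B the coefficient is at most n! (B / (2 |k|))^n <= (n B / (2
    |k|))^n <= 2^-n. The bound does not involve Q, so all sampling scales share it. *)
Lemma dft_decay (g : RR -> RR) : real_analytic g -> periodic1 g ->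
  exists2 C : RR, 0 <= C & exists2 q : RR, 0 < q < 1 &
  forall (Q : nat) (k : int), (0 < Q)%N -> (2 * `|k| <= Q)%N ->
    cabs (dft Q g k) <= C * q ^+ `|k|%N.
Proof.
move=> ag pg; have [B B0 HB] := analytic_fdiffn_bound ag pg.
have B1 : 1 <= B%:R :> RR by rewrite ler1n.
have Bp : 0 < B%:R :> RR by rewrite ltr0n.
exists (2 * B%:R); first by rewrite mulr_ge0 ?ler0n.
exists (1 - (2 * B%:R)^-1).
  have h : 0 < 2 * B%:R :> RR by rewrite mulr_gt0 ?ltr0n.
  have : 0 < (2 * B%:R)^-1 :> RR by rewrite invr_gt0.
  have : (2 * B%:R)^-1 < 1 :> RR by rewrite invf_lt1//; lra.
  by move=> *; apply/andP; split; lra.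
move=> Q k Q0 kQ; have Qr : 0 < Q%:R :> RR by rewrite ltr0n.
set n := (`|k| %/ B)%N.
have nk : (n * B <= `|k|)%N by exact: leq_trunc_div.
have nk' : n%:R * B%:R <= `|k|%N%:R :> RR by rewrite -natrM ler_nat.
have kQ' : 2 * `|k|%N%:R <= Q%:R :> RR by rewrite -natrM ler_nat.
have nrm : `|k%:~R / Q%:R| = `|k|%N%:R / Q%:R :> RR.
  by rewrite normrM normfV normr_nat -intr_norm -abszE.
have D : cabs (dft Q (fdiffn n Q%:R^-1 g) k) <= B%:R * n`!%:R * (B%:R / Q%:R) ^+ n.
  apply: cabs_dft_le => // x; apply: HB; first by rewrite invr_ge0 ler0n.
  rewrite ler_pdivrMr// mulrC ler_pdivlMr//.
  have k0 : 0 <= `|k|%N%:R :> RR by rewrite ler0n.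
  lra.
rewrite dft_fdiffn// cabsM cabsX in D.
have L : 2 * (`|k|%N%:R / Q%:R) <= cabs (ee (k%:~R / Q%:R) - 1).
  rewrite -nrm; apply: ee_sub1_ge; rewrite nrm ler_pdivrMr//; lra.
have d0 := cabs_ge0 (dft Q g k).
have [k0|k0] := posnP `|k|%N.
  have n0 : n = 0%N by rewrite /n k0 div0n.
  move: D; rewrite n0 k0 !expr0 fact0 !mulr1 mul1r; lra.
have kr : 0 < `|k|%N%:R :> RR by rewrite ltr0n.
have E : (2 * (`|k|%N%:R / Q%:R)) ^+ n * cabs (dft Q g k)
    <= B%:R * n`!%:R * (B%:R / Q%:R) ^+ n.
  apply: le_trans D; rewrite ler_wpM2r//; apply: lerXn2r => //.
    by rewrite nnegrE mulr_ge0 ?ler0n// divr_ge0 ?ler0n.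
  by rewrite nnegrE cabs_ge0.
have E2 : cabs (dft Q g k) <= B%:R * n`!%:R * (B%:R / (2 * `|k|%N%:R)) ^+ n.
  have P : 0 < (2 * (`|k|%N%:R / Q%:R)) ^+ n :> RR.
    by rewrite exprn_gt0// mulr_gt0 ?ltr0n// divr_gt0.
  rewrite -(ler_pM2l P); apply: le_trans E _.
  rewrite mulrCA -exprMn.
  suff -> : 2 * (`|k|%N%:R / Q%:R) * (B%:R / (2 * `|k|%N%:R)) = B%:R / Q%:R :> RR by [].
  field; apply/andP; split; exact: lt0r_neq0.
apply: le_trans E2 _; rewrite -mulrA.
have -> : 2 * B%:R * (1 - (2 * B%:R)^-1) ^+ `|k|%N = B%:R * (2 * (1 - (2 * B%:R)^-1) ^+ `|k|%N) :> RR.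
  by rewrite mulrA [_ * 2]mulrC.
rewrite ler_wpM2l ?ler0n//.
apply: le_trans (@half_pow_div RR B `|k|%N B0); rewrite -/n.
apply: (@le_trans _ _ ((n%:R * (B%:R / (2 * `|k|%N%:R))) ^+ n)).
  rewrite [X in _ <= X]exprMn; apply: ler_wpM2r.
    by rewrite exprn_ge0// divr_ge0 ?mulr_ge0 ?ler0n.
  by rewrite -natrX ler_nat fact_le_exp.
apply: lerXn2r.
- by rewrite nnegrE mulr_ge0 ?ler0n// divr_ge0 ?mulr_ge0 ?ler0n.
- by rewrite nnegrE invr_ge0 ler0n.
rewrite mulrA ler_pdivrMr ?mulr_gt0 ?ltr0n//.
have -> : 2^-1 * (2 * `|k|%N%:R) = `|k|%N%:R :> RR by field.
exact: nk'.
Qed.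

(** Any Q consecutive frequencies invert the transform. The offset t will be half the number of
    nodes, so that every frequency used lies in the range where the coefficients decay. *)
Lemma dft_inv (Q t j : nat) (g : RR -> RR) : (0 < Q)%N -> (j < Q)%N ->
  RtoC (g (j%:R / Q%:R)) =
  \sum_(i < Q) dft Q g (i%:Z - t%:Z) * ee ((i%:Z - t%:Z)%:~R * (j%:R / Q%:R)).
Proof.
move=> Q0 jQ; have Qr0 : Q%:R != 0 :> RR by rewrite gt_eqF// ltr0n.
rewrite /dft; under eq_bigr do rewrite -mulrA mulr_suml.
rewrite -mulr_sumr exchange_big /=.
have E (j' : 'I_Q) : \sum_(i < Q) RtoC (g (j'%:R / Q%:R)) *
     ee (- ((i%:Z - t%:Z)%:~R * (j'%:R / Q%:R))) * ee ((i%:Z - t%:Z)%:~R * (j%:R / Q%:R)) =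
   if (j' == j :> nat) then RtoC (g (j%:R / Q%:R)) * Q%:R else 0.
  under eq_bigr do rewrite -mulrA -eeD.
  rewrite -mulr_sumr.
  have -> : \sum_(i < Q) ee (- ((i%:Z - t%:Z)%:~R * (j'%:R / Q%:R)) + (i%:Z - t%:Z)%:~R * (j%:R / Q%:R)) =
    ee (- (t%:R * ((j%:R - j'%:R) / Q%:R))) * \sum_(i < Q) ee ((j%:Z - j'%:Z)%:~R * (i%:R / Q%:R)).
    rewrite mulr_sumr; apply: eq_bigr => i _; rewrite -eeD; congr ee.
    rewrite !intrB -![(_%:Z)%:~R]/(_%:R); field.
    exact: Qr0.
  rewrite sum_ee//; case: eqP => [->|ne].
    by rewrite !subrr dvdz0 mul0r mulr0 oppr0 ee0 mul1r.
  rewrite ifF ?mulr0//; apply/negbTE/negP => /dvdzP[q].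
  have jQ' := ltn_ord j'; move=> Eq.
  have [q0|[q1|q1]] : q = 0 \/ q >= 1 \/ q <= -1 by lia.
  - by subst q; apply: ne; lia.
  - by nia.
  - by nia.
under eq_bigr => j' _ do rewrite E.
rewrite -big_mkcond /= (big_pred1 (Ordinal jQ))//.
by rewrite RtoCV RtoC_nat mulrCA mulVf ?mulr1// pnatr_eq0 -lt0n.
Qed.

(** The exponent on the right is the smallest one occurring in a nonempty sum; with this sharper
    bound the induction on N closes. *)
Lemma geometric_left (R : realType) (q : R) (N K t : nat) : 0 <= q -> q < 1 ->
  (1 - q) * \sum_(i < N | (i + K < t)%N) q ^+ (t - i) <= q ^+ (maxn K (t - N)).+1.
Proof.
move=> q0 q1; rewrite big_mkcond /=; elim: N => [|N IH].
  by rewrite big_ord0 mulr0 exprn_ge0.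
rewrite big_ord_recr /= mulrDr; case: ifP => NKt.
  have E1 : maxn K (t - N) = (t - N)%N by lia.
  have E2 : (maxn K (t - N.+1)).+1 = (t - N)%N by lia.
  move: IH; rewrite E1 E2 exprS; lra.
have -> : maxn K (t - N.+1) = maxn K (t - N) by lia.
by rewrite mulr0 addr0.
Qed.

Lemma geometric_right (R : realType) (q : R) (N K t : nat) : 0 <= q -> q < 1 ->
  (1 - q) * \sum_(i < N | (t + K < i)%N) q ^+ (i - t) <= q ^+ K.+1 - q ^+ (maxn K.+1 (N - t)).
Proof.
move=> q0 q1; rewrite big_mkcond /=; elim: N => [|N IH].
  by rewrite big_ord0 mulr0 (_ : maxn _ _ = K.+1) ?subrr//; lia.
rewrite big_ord_recr /= mulrDr; case: ifP => NKt.
  have E1 : maxn K.+1 (N - t) = (N - t)%N by lia.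
  have E2 : maxn K.+1 (N.+1 - t) = (N - t).+1 by lia.
  move: IH; rewrite E1 E2 [q ^+ (N - t).+1]exprS; lra.
have -> : maxn K.+1 (N.+1 - t) = maxn K.+1 (N - t) by lia.
by rewrite mulr0 addr0.
Qed.

Lemma geometric_two_sided (R : realType) (q : R) (N K t : nat) : 0 <= q -> q < 1 ->
  \sum_(i < N | (K < `|i%:Z - t%:Z|)%N) q ^+ `|i%:Z - t%:Z|%N <= 2 * q ^+ K / (1 - q).
Proof.
move=> q0 q1; have q1' : 0 < 1 - q by rewrite subr_gt0.
rewrite ler_pdivlMr// mulrC.
rewrite (bigID (fun i : 'I_N => (i < t)%N)) /= mulrDr.
have -> : \sum_(i < N | (K < `|i%:Z - t%:Z|)%N && (i < t)%N) q ^+ `|i%:Z - t%:Z|%N =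
   \sum_(i < N | (i + K < t)%N) q ^+ (t - i).
  apply: eq_big => [i|i /andP[_ it]]; first by lia.
  by congr (_ ^+ _); lia.
have -> : \sum_(i < N | (K < `|i%:Z - t%:Z|)%N && ~~ (i < t)%N) q ^+ `|i%:Z - t%:Z|%N =
   \sum_(i < N | (t + K < i)%N) q ^+ (i - t).
  apply: eq_big => [i|i /andP[_ it]]; first by lia.
  by congr (_ ^+ _); lia.
have A := geometric_left N K t q0 q1.
have B := geometric_right N K t q0 q1.
have C : q ^+ (maxn K (t - N)).+1 <= q ^+ K.
  by apply: ler_wiXn2l => //; [exact: ltW|lia].
have D : q ^+ K.+1 <= q ^+ K by apply: ler_wiXn2l => //; exact: ltW.
have E : 0 <= q ^+ (maxn K.+1 (N - t)) by rewrite exprn_ge0.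
lra.
Qed.

(** Inserting the finer inversion formula at the coarse nodes, orthogonality keeps the frequencies
    congruent to k modulo Q. *)
Lemma dft_alias (Q p t : nat) (g : RR -> RR) (k : int) : (0 < Q)%N -> (0 < p)%N ->
  dft Q g k = \sum_(i < p * Q | (Q%:Z %| (i%:Z - t%:Z) - k)%Z) dft (p * Q) g (i%:Z - t%:Z).
Proof.
move=> Q0 p0; have Qr0 : Q%:R != 0 :> RR by rewrite gt_eqF// ltr0n.
have pr0 : p%:R != 0 :> RR by rewrite gt_eqF// ltr0n.
have pQ0 : (0 < p * Q)%N by rewrite muln_gt0 p0.
have G (j : 'I_Q) : RtoC (g (j%:R / Q%:R)) * ee (- (k%:~R * (j%:R / Q%:R))) =
  \sum_(i < p * Q) dft (p * Q) g (i%:Z - t%:Z) * ee ((i%:Z - t%:Z - k)%:~R * (j%:R / Q%:R)).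
  have E : j%:R / Q%:R = (p * j)%:R / (p * Q)%:R :> RR.
    by rewrite !natrM; field; rewrite pr0 Qr0.
  rewrite {1}E (@dft_inv _ t)//; last by rewrite ltn_pmul2l.
  rewrite mulr_suml; apply: eq_bigr => i _; rewrite -mulrA -E -eeD.
  by congr (_ * ee _); rewrite [in RHS]intrB mulrBl.
rewrite {1}/dft; under eq_bigr do rewrite G.
rewrite exchange_big /= mulr_sumr [RHS]big_mkcond /=; apply: eq_bigr => i _.
rewrite -mulr_sumr sum_ee//; case: ifP => _; last by rewrite !mulr0.
by rewrite RtoCV RtoC_nat mulrC mulfK// pnatr_eq0 -lt0n.
Qed.

Lemma trig_polyE c m x : trig_poly c m x =
  \sum_(k < (m + m).+1) c (k%:Z - m%:Z) * ee ((k%:Z - m%:Z)%:~R * x).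
Proof. by apply: eq_bigr => k _; rewrite /ee mulrA. Qed.

Lemma trig_poly_lipschitz c m :
  exists2 L : RR, 0 <= L & forall x y, cabs (trig_poly c m x - trig_poly c m y) <= L * `|x - y|.
Proof.
exists (\sum_(k < (m + m).+1) cabs (c (k%:Z - m%:Z)) * (8 * `|(k%:Z - m%:Z)%:~R|)).
  by apply: sumr_ge0 => k _; rewrite mulr_ge0 ?cabs_ge0// mulr_ge0 ?ler0n.
move=> x y; rewrite !trig_polyE -sumrB mulr_suml.
apply: le_trans (cabs_sum _ _ _) _; apply: ler_sum => k _.
rewrite -mulrBr cabsM -mulrA ler_wpM2l ?cabs_ge0//.
by apply: le_trans (ee_lipschitz _ _) _; rewrite -mulrBr normrM mulrA.
Qed.

Lemma residue_unique (K : nat) (k : int) : exists s0 : 'I_((K + K).+1),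
  (forall s : 'I_((K + K).+1), ((K + K).+1%:Z %| k - (s%:Z - K%:Z))%Z = (s == s0)) /\
  ((`|k| <= K)%N -> s0%:Z - K%:Z = k).
Proof.
set Q := (K + K).+1.
have QZ : Q%:Z != 0 by lia.
have r0 := modz_ge0 (k + K%:Z) QZ; have rQ := ltz_mod (k + K%:Z) QZ.
have dE := divz_eq (k + K%:Z) Q.
set r := ((k + K%:Z) %% Q)%Z in r0 rQ dE; set e := ((k + K%:Z) %/ Q)%Z in dE.
have hs : (`|r| < Q)%N by lia.
exists (Ordinal hs); split=> [s|kK]; last first.
  rewrite /=; have e0 : e = 0 by rewrite /Q in dE r0 rQ; nia.
  rewrite e0 in dE; lia.
have sQ := ltn_ord s.
rewrite -val_eqE /=; apply/dvdzP/eqP => [[q E]|E].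
  have H : (s%:Z - r) = (e - q) * Q%:Z by lia.
  have [z|[z|z]] : e - q = 0 \/ e - q >= 1 \/ e - q <= -1 by lia.
  - by rewrite z in H; lia.
  - by nia.
  - by nia.
by exists e; rewrite E; lia.
Qed.

Lemma le_archi (a b L : RR) (Q : nat) : 0 <= L -> (0 < Q)%N ->
  (forall p : nat, (0 < p)%N -> a <= b + L / (p * Q)%:R) -> a <= b.
Proof.
move=> L0 Q0 H; rewrite leNgt; apply/negP => ba.
have ab0 : 0 < a - b by rewrite subr_gt0.
have := archi_boundP (divr_ge0 L0 (ltW ab0)); set p := Num.bound _ => Hp.
have Lp : L < p.+1%:R * (a - b).
  rewrite -ltr_pdivrMr//; apply: lt_le_trans Hp _; by rewrite ler_nat.
have := H p.+1 isT; rewrite -lerBlDl leNgt => /negP; apply.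
rewrite ltr_pdivrMr ?ltr0n ?muln_gt0//.
apply: lt_le_trans Lp _; rewrite mulrC ler_wpM2l ?(ltW ab0)// ler_nat.
by rewrite leq_pmulr.
Qed.

(** The approximant has the coefficients sampled on 2 K + 1 nodes. On a grid with p times as many
    nodes, inversion and aliasing express the error through the frequencies above K alone, so the
    bound on the nodes does not depend on p. The grids become dense as p grows, and Lipschitz bounds
    carry the estimate to every point. *)
Theorem fourier_approx (g : RR -> RR) : real_analytic g -> periodic1 g ->
  exists2 C : RR, 0 <= C & exists2 q : RR, 0 < q < 1 &
  forall K : nat, exists2 a : int -> RR[i],
    forall k : int, (`|k| <= K)%N -> cabs (a k) <= C * q ^+ `|k|%N &
    forall x : RR, cabs (RtoC (g x) - trig_poly a K x) <= C * q ^+ K.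
Proof.
move=> ag pg; have [C C0 [q /andP[q0 q1] HC]] := dft_decay ag pg.
have [B B0 HB] := analytic_fdiffn_bound ag pg.
have q1' : 0 < 1 - q by rewrite subr_gt0.
pose C' := C * (4 / (1 - q)).
have CC' : C <= C'.
  rewrite /C' -[X in X <= _]mulr1 ler_wpM2l// ler_pdivlMr//; lra.
exists C'; first by apply: le_trans CC'.
exists q; first by rewrite q0.
move=> K; pose Q := (K + K).+1; exists (dft Q g) => [k kK|].
  apply: le_trans (HC _ _ _ _) _ => //; first by rewrite /Q; lia.
  by rewrite ler_wpM2r// exprn_ge0// ltW.
have node (p j : nat) : (0 < p)%N -> (j < p * Q)%N ->
    cabs (RtoC (g (j%:R / (p * Q)%:R)) - trig_poly (dft Q g) K (j%:R / (p * Q)%:R)) <= C' * q ^+ K.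
  move=> p0 jpQ; set x := j%:R / _; set t := ((p * Q) %/ 2)%N.
  have pQ0 : (0 < p * Q)%N by rewrite muln_gt0 p0.
  pose c (i : nat) := dft (p * Q) g (i%:Z - t%:Z).
  (* The mode of frequency i - t is aliased to the unique frequency in [-K, K] congruent to it. A
     frequency already in that range is aliased to itself and cancels. *)
  pose D (i : nat) := \sum_(s < Q | (Q%:Z %| (i%:Z - t%:Z) - (s%:Z - K%:Z))%Z)
     ee ((s%:Z - K%:Z)%:~R * x).
  have -> : RtoC (g x) - trig_poly (dft Q g) K x =
      \sum_(i < p * Q) c i * (ee ((i%:Z - t%:Z)%:~R * x) - D i).
    under [RHS]eq_bigr do rewrite mulrBr; rewrite sumrB; congr (_ - _).
      by rewrite /x (@dft_inv _ t).
    rewrite trig_polyE; under eq_bigr do rewrite (@dft_alias _ p t)// mulr_suml big_mkcond /=.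
    rewrite exchange_big /=; apply: eq_bigr => i _.
    by rewrite /D mulr_sumr [RHS]big_mkcond.
  have T (i : 'I_(p * Q)) : cabs (c i * (ee ((i%:Z - t%:Z)%:~R * x) - D i)) <=
     if (K < `|i%:Z - t%:Z|)%N then 2 * C * q ^+ `|i%:Z - t%:Z|%N else 0.
    have [s0 [s0P s0K]] := residue_unique K (i%:Z - t%:Z).
    have -> : D i = ee ((s0%:Z - K%:Z)%:~R * x).
      by rewrite /D (big_pred1 s0)// => s; rewrite -s0P.
    case: ltnP => [Ki|iK]; last first.
      by rewrite s0K// subrr mulr0 cabs0.
    have -> : 2 * C * q ^+ `|i%:Z - t%:Z|%N = (C * q ^+ `|i%:Z - t%:Z|%N) * 2 by ring.
    rewrite cabsM; apply: ler_pM; rewrite ?cabs_ge0//.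
      apply: HC => //; have := ltn_ord i; have := divn_eq (p * Q) 2.
      by have := ltn_pmod (p * Q) (isT : 0 < 2)%N; rewrite -/t; lia.
    apply: le_trans (cabsB _ _) _; rewrite !cabs_ee; lra.
  apply: le_trans (cabs_sum _ _ _) _.
  apply: le_trans (ler_sum _ (fun i _ => T i)) _.
  rewrite -big_mkcond /= -mulr_sumr.
  have := @geometric_two_sided RR q (p * Q) K t (ltW q0) q1.
  move/(ler_wpM2l (mulr_ge0 (ler0n RR 2) C0)) => /le_trans; apply.
  by rewrite /C' le_eqVlt; apply/orP; left; apply/eqP; field; rewrite gt_eqF.
move=> x0; have [n [x /andP[x0' x1] ->]] := floor_decomp x0.
have pT : periodic1 (trig_poly (dft Q g) K).
  move=> y; rewrite !trig_polyE; apply: eq_bigr => k _.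
  by rewrite mulrDr mulr1 ee_periodic.
rewrite (periodic1_int _ _ pg) (periodic1_int _ _ pT) {x0 n}.
have [L L0 HL] := trig_poly_lipschitz (dft Q g) K.
have Bp : 0 < B%:R :> RR by rewrite ltr0n.
(* The factor B makes the mesh at most 1 / B, the range in which the first difference of g is
   controlled. *)
apply: (@le_archi _ _ (B%:R * B%:R + L) (B * Q)) => [|//|p p0].
- by rewrite addr_ge0// mulr_ge0 ?ler0n.
- by rewrite muln_gt0 B0.
rewrite mulnA; set P := (p * B)%N; have P0 : (0 < P)%N by rewrite muln_gt0 p0.
have PQ0 : 0 < (P * Q)%:R :> RR by rewrite ltr0n muln_gt0 P0.
pose j := Num.truncn (x * (P * Q)%:R).
have jx : j%:R <= x * (P * Q)%:R < j.+1%:R.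
  by apply: truncn_itv; rewrite mulr_ge0// ltW.
have jPQ : (j < P * Q)%N.
  rewrite -(ltr_nat RR); case/andP: jx => jx _; apply: le_lt_trans jx _.
  by rewrite -[X in _ < X]mul1r ltr_pM2r.
have := node P j P0 jPQ; set y := j%:R / _ => Hy.
have [xy0 xy1] : 0 <= x - y /\ x - y <= (P * Q)%:R^-1.
  case/andP: jx => j1 j2; split.
    by rewrite subr_ge0 ler_pdivrMr.
  rewrite -[X in _ <= X]mul1r ler_pdivlMr// mulrBl divfK ?gt_eqF//.
  by move: j2; rewrite -natr1; lra.
have xyB : x - y <= B%:R^-1.
  apply: le_trans xy1 _; rewrite lef_pV2 ?posrE// ler_nat /P /Q.
  by rewrite -mulnA mulnCA leq_pmulr// muln_gt0 p0.
have gl : `|g x - g y| <= B%:R * B%:R * (x - y).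
  have := HB y 1%N (x - y) xy0; rewrite mul1r => /(_ xyB).
  by rewrite /= /fdiff [y + _]addrC subrK (_ : 1`! = 1%N)// mulr1 expr1 mulrA.
apply: le_trans (cabs_triangle (RtoC (g y)) _ _) _.
have A1 : cabs (RtoC (g x) - RtoC (g y)) <= B%:R * B%:R * (x - y).
  by rewrite -RtoCB cabs_RtoC.
have A2 := cabs_triangle (trig_poly (dft Q g) K y) (RtoC (g y)) (trig_poly (dft Q g) K x).
have A3 : cabs (trig_poly (dft Q g) K y - trig_poly (dft Q g) K x) <= L * (x - y).
  by rewrite cabs_distrC; apply: le_trans (HL _ _) _; rewrite ger0_norm.
have A4 := ler_wpM2l (addr_ge0 (mulr_ge0 (ler0n RR B) (ler0n RR B)) L0) xy1.
move: A1 A2 A3 A4 Hy; set u1 := cabs _; set u2 := cabs _; set u3 := cabs _; set u4 := cabs _.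
move=> A1 A2 A3 A4 Hy; rewrite mulrDl in A4; lra.
Qed.

(** * Continuity and mean value of an approximated function *)

Lemma lipschitz_continuous (R : realType) (g : R -> R) (d M : R) : 0 < d -> 0 <= M ->
  (forall x y, `|x - y| <= d -> `|g x - g y| <= M * `|x - y|) -> continuous g.
Proof.
move=> d0 M0 H x; apply/cvgrPdist_lt => e e0.
have P : 0 < M + 1 by rewrite ltr_wpDl.
have m0 : 0 < Num.min d (e / (M + 1)) by rewrite lt_min d0 divr_gt0.
apply/nbhs_ballP; exists (Num.min d (e / (M + 1))) => //= y.
rewrite /ball /= lt_min => /andP[h1 h2].
apply: le_lt_trans (H _ _ (ltW h1)) _.
rewrite ltr_pdivlMr// in h2; apply: le_lt_trans h2.
by rewrite mulrC; apply: ler_wpM2l => //; rewrite lerDl.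
Qed.

Lemma analytic_continuous (g : RR -> RR) : real_analytic g -> periodic1 g -> continuous g.
Proof.
move=> ag pg; have [B B0 HB] := analytic_fdiffn_bound ag pg.
have Bp : 0 < B%:R :> RR by rewrite ltr0n.
have H (x y : RR) : y <= x -> x - y <= B%:R^-1 -> `|g x - g y| <= B%:R * B%:R * (x - y).
  move=> yx xyB; have := HB y 1%N (x - y); rewrite subr_ge0 yx mul1r => /(_ isT xyB).
  by rewrite /= /fdiff [y + _]addrC subrK (_ : 1`! = 1%N)// mulr1 expr1 mulrA.
have H' (x y : RR) : `|x - y| <= B%:R^-1 -> `|g x - g y| <= B%:R * B%:R * `|x - y|.
  move=> xy; have [yx|/ltW yx] := leP y x.
    by rewrite (ger0_norm (_ : 0 <= x - y)) ?subr_ge0//; apply: H => //; rewrite -(ger0_norm (_ : 0 <= x - y)) ?subr_ge0.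
  rewrite distrC [`|x - y|]distrC (ger0_norm (_ : 0 <= y - x)) ?subr_ge0//; apply: H => //.
  by rewrite -(ger0_norm (_ : 0 <= y - x)) ?subr_ge0// distrC.
apply: (@lipschitz_continuous RR g B%:R^-1 (B%:R * B%:R)) => //; by rewrite invr_gt0.
Qed.

Lemma is_derive_bigsum (R : realType) n (h dh : nat -> R -> R) (x : R) :
  (forall i, is_derive x 1 (h i) (dh i x)) ->
  is_derive x 1 (fun y => \sum_(i < n) h i y) (\sum_(i < n) dh i x).
Proof.
move=> H; elim: n => [|n IH].
  under eq_fun do rewrite big_ord0.
  by rewrite big_ord0; exact: is_derive_cst.
under eq_fun do rewrite big_ord_recr /=.
by rewrite big_ord_recr /=; apply: is_deriveD.
Qed.

Lemma is_derive_trig_term (R : realType) (c u v x : R) : c != 0 ->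
  is_derive x 1 (fun y => u / c * sin (c * y) + v / c * cos (c * y))
    (u * cos (c * x) - v * sin (c * x)).
Proof.
move=> c0.
have L : is_derive x 1 (fun y : R => c * y) c.
  have := @is_deriveZ R R^o R^o id c x 1 1 _.
  by rewrite scaler1; apply.
have S : is_derive x 1 (fun y : R => sin (c * y)) (c * cos (c * x)).
  have := @is_derive1_comp R sin (fun y : R => c * y) x _ _ (is_derive_sin _) L.
  by rewrite mulrC.
have D : is_derive x 1 (fun y : R => cos (c * y)) (c * - sin (c * x)).
  have := @is_derive1_comp R cos (fun y : R => c * y) x _ _ (is_derive_cos _) L.
  by rewrite mulrC.
have S' := @is_deriveZ R R^o R^o _ (u / c) x 1 _ S.
have D' := @is_deriveZ R R^o R^o _ (v / c) x 1 _ D.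
have := is_deriveD S' D'.
rewrite /GRing.scale /= !mulrA !divfK// mulrN; exact.
Qed.

(** The function f is squeezed between the trigonometric sum minus e and plus e. Both have explicit
    primitives, evaluated by the fundamental theorem, and the oscillating terms drop out over
    [0, 1]. *)
Lemma trig_mean (R : realType) n (i0 : 'I_n) (u v c : nat -> R) (f : R -> R) (e : R) :
  continuous f -> (\int[@lebesgue_measure R]_(x in `[0%R, 1%R]) (f x)%:E = 0)%E ->
  c i0 = 0 -> (forall i : nat, i != i0 -> [/\ c i != 0, sin (c i) = 0 & cos (c i) = 1]) ->
  (forall x, `|f x - \sum_(i < n) (u i * cos (c i * x) - v i * sin (c i * x))| <= e) ->
  `|u i0| <= e.
Proof.
move=> cf f0 c0 ci fle.
pose h (i : nat) (y : R) := if i == i0 :> nat then u i * y else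
  u i / c i * sin (c i * y) + v i / c i * cos (c i * y).
pose dh (i : nat) (y : R) := u i * cos (c i * y) - v i * sin (c i * y).
have Hh (x : R) (i : nat) : is_derive x 1 (h i) (dh i x).
  rewrite /h /dh; case: eqP => [->|/eqP ne]; last first.
    by have [? _ _] := ci _ ne; exact: is_derive_trig_term.
  rewrite c0 mul0r sin0 cos0 mulr0 mulr1 subr0.
  have := @is_deriveZ R R^o R^o id (u i0) x 1 1 _.
  by rewrite scaler1; apply.
pose F (e : R) (y : R) := \sum_(i < n) h i y + e * y.
pose G (e : R) (y : R) := \sum_(i < n) dh i y + e.
have HF (a x : R) : is_derive x 1 (F a) (G a x).
  apply: is_deriveD; first exact: is_derive_bigsum.
  have := @is_deriveZ R R^o R^o id a x 1 1 _.
  by rewrite scaler1; apply.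
have cF a : continuous (F a).
  by move=> x; apply: differentiable_continuous; apply/derivable1_diffP; exact: ex_derive.
have cG a : continuous (G a).
  move=> x; apply: cvgD; last exact: cvg_cst.
  apply: cvg_big => // [|i _]; first by move=> ?; exact: add_continuous.
  apply: cvgB; apply: cvgM; try exact: cvg_cst.
    apply: continuous_comp; last exact: continuous_cos.
    by apply: cvgM; [exact: cvg_cst|exact: cvg_id].
  apply: continuous_comp; last exact: continuous_sin.
  by apply: cvgM; [exact: cvg_cst|exact: cvg_id].
have E a : (\int[@lebesgue_measure R]_(x in `[0%R, 1%R]) (G a x)%:E = (F a 1)%:E - (F a 0)%:E)%E.
  apply: continuous_FTC2 => //.
  - exact: continuous_subspaceT.
  - split.
    + by move=> x _; exact: ex_derive.
    + by apply: cvg_at_right_filter; exact: cF.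
    + by apply: cvg_at_left_filter; exact: cF.
  - by move=> x _; rewrite derive1E; exact: derive_val.
have int (k : R -> R) : continuous k ->
    (@lebesgue_measure R).-integrable `[0%R, 1%R] (fun x => (k x)%:E).
  move=> ck; apply: continuous_compact_integrable; first exact: segment_compact.
  exact: continuous_subspaceT.
have FE a : F a 1 - F a 0 = u i0 + a.
  rewrite /F mulr1 mulr0 addr0 addrAC -sumrB; congr (_ + _).
  rewrite (bigD1 i0)//= /h eqxx mulr1 mulr0 subr0 big1 ?addr0// => i /negbTE ne.
  rewrite -val_eqE /= in ne; rewrite ne.
  have [_ si co] := ci i (negbT ne).
  by rewrite !mulr1 !mulr0 sin0 cos0 si co subrr.
have I : (\int[@lebesgue_measure R]_(x in `[0%R, 1%R]) (f x)%:E <=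
          \int[@lebesgue_measure R]_(x in `[0%R, 1%R]) (G e x)%:E)%E.
  apply: le_integral; [exact: measurable_itv|exact: int|exact: int|move=> x _].
  by rewrite lee_fin /G -lerBlDl; apply: le_trans (ler_norm _) (fle x).
have J : (\int[@lebesgue_measure R]_(x in `[0%R, 1%R]) (G (- e) x)%:E <=
          \int[@lebesgue_measure R]_(x in `[0%R, 1%R]) (f x)%:E)%E.
  apply: le_integral; [exact: measurable_itv|exact: int|exact: int|move=> x _].
  rewrite lee_fin /G lerBlDr -lerBlDl.
  by apply: le_trans (ler_norm _) _; rewrite distrC; exact: fle.
move: I J; rewrite f0 !E -!EFinB !lee_fin !FE => I J.
by rewrite ler_norml; apply/andP; split; lra.
Qed.

Lemma Re_sum (I : Type) (r : seq I) (P : pred I) (F : I -> RR[i]) :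
  complex.Re (\sum_(i <- r | P i) F i) = \sum_(i <- r | P i) complex.Re (F i).
Proof. by elim/big_rec2: _ => // i x y _ <-; case: (F i) => a b; case: y. Qed.

(** The constant coefficient of the approximant is a sampled mean, which need not vanish with the
    integral; it only has the size of the approximation error. *)
Lemma mean_zero_coef (psi : RR -> RR) (K : nat) (a : int -> RR[i]) (e : RR) :
  continuous psi -> (\int[@lebesgue_measure RR]_(x in `[0%R, 1%R]) (psi x)%:E = 0)%E ->
  (forall x : RR, cabs (RtoC (psi x) - trig_poly a K x) <= e) ->
  `|complex.Re (a 0)| <= e.
Proof.
move=> cp p0 H.
have i0P : (K < (K + K).+1)%N by lia.
pose i0 : 'I_(K + K).+1 := Ordinal i0P.
pose u (i : nat) := complex.Re (a (i%:Z - K%:Z)).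
pose v (i : nat) := complex.Im (a (i%:Z - K%:Z)).
pose c (i : nat) : RR := 2 * pi * (i%:Z - K%:Z)%:~R.
have c0 : c i0 = 0 by rewrite /c /= subrr mulr0.
have ci (i : nat) : i != i0 -> [/\ c i != 0, sin (c i) = 0 & cos (c i) = 1].
  rewrite /= => ne; have := ee_int (i%:Z - K%:Z); rewrite /ee -/(c i) /expi.
  move=> [-> ->]; split=> //.
  rewrite /c mulf_neq0// ?intr_eq0; last by lia.
  by rewrite mulf_neq0// ?pnatr_eq0// gt_eqF// pi_gt0.
have R1 (x : RR) : complex.Re (trig_poly a K x) =
    \sum_(i < (K + K).+1) (u i * cos (c i * x) - v i * sin (c i * x)).
  by rewrite /trig_poly Re_sum; apply: eq_bigr => i _; rewrite /u /v /c /expi; case: (a _).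
have B (x : RR) : `|psi x - complex.Re (trig_poly a K x)| <= e.
  apply: le_trans (H x); apply: le_trans (Re_le_cabs _).
  by rewrite /RtoC raddfB.
have ui : u i0 = complex.Re (a 0) by rewrite /u /= subrr.
rewrite -ui; apply: (@trig_mean RR _ i0 u v c psi e cp p0 c0 ci) => x.
by rewrite -R1.
Qed.

(** * Best denominators and small divisors *)

Lemma exprn_eventually_lt (R : realType) (q e : R) : 0 <= q -> q < 1 -> 0 < e ->
  exists N : nat, forall n, (N <= n)%N -> q ^+ n < e.
Proof.
move=> q0 q1 e0.
have q1' : `|q| < 1 by rewrite ger0_norm.
have /cvgrPdist_lt/(_ e e0) [N _ H] := cvg_expr q1'.
exists N => n Nn; have := H n Nn; rewrite sub0r normrN ger0_norm// exprn_ge0//.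
Qed.

Lemma frac_bounds (R : realType) (t : R) :
  0 <= t - (Num.floor t)%:~R /\ t - (Num.floor t)%:~R < 1.
Proof.
have := floor_itv t; rewrite intrD => /andP[h1 h2].
by split; [rewrite subr_ge0|rewrite ltrBlDl].
Qed.

(** Pigeonhole: the N + 1 fractional parts of 0, a, ..., N a fall into N boxes of length 1 / N <
    d. *)
Lemma dirichlet_small (R : realType) (a d : R) : 0 < d ->
  exists2 k : nat, (0 < k)%N & exists p : int, `|k%:R * a - p%:~R| < d.
Proof.
move=> d0; have id0 : 0 < d^-1 by rewrite invr_gt0.
have := archi_boundP (ltW id0); set N := Num.bound _ => HN.
have Nr : 0 < N%:R :> R := lt_trans id0 HN.
have N0 : (0 < N)%N by rewrite -(ltr_nat R).
have dN : N%:R^-1 < d by rewrite invf_plt ?posrE.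
pose fr (i : nat) : R := i%:R * a - (Num.floor (i%:R * a))%:~R.
have frb i : 0 <= fr i /\ fr i < 1 := frac_bounds _.
pose bx (i : nat) := Num.truncn (N%:R * fr i).
have bxP i : (bx i)%:R <= N%:R * fr i < (bx i).+1%:R.
  by apply: truncn_itv; rewrite mulr_ge0 ?ler0n//; case: (frb i).
have bxN i : (bx i < N)%N.
  have [h0 h1] := frb i; have /andP[b0 _] := bxP i.
  rewrite -(ltr_nat R); apply: le_lt_trans b0 _.
  by rewrite -[X in _ < X]mulr1 ltr_pM2l.
pose f (i : 'I_N.+1) : 'I_N := Ordinal (bxN i).
have : ~~ injectiveb f.
  apply/injectiveP => finj; have := leq_card f finj.
  by rewrite !card_ord ltnn.
case/injectivePn => i [j ij fij].
have bij : bx i = bx j by have := congr1 val fij.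
have D : `|fr i - fr j| < d.
  apply: lt_trans dN; rewrite -(ltr_pM2l Nr) mulfV ?gt_eqF//.
  rewrite -[X in X * _](@ger0_norm _ N%:R) ?ler0n// -normrM mulrBr.
  have := bxP i; have := bxP j; rewrite bij -natr1 => /andP[? ?] /andP[? ?].
  by rewrite ltr_norml; apply/andP; split; lra.
wlog ltij : i j ij fij bij D / (j < i)%N.
  move=> W; have [|h|/val_inj h] := ltngtP i j.
  - by move=> h; apply: (W j i) => //; rewrite 1?eq_sym// distrC.
  - exact: (W i j).
  - by rewrite h eqxx in ij.
exists (i - j)%N; first by rewrite subn_gt0.
exists (Num.floor (i%:R * a) - Num.floor (j%:R * a)).
rewrite natrB ?(ltnW ltij)// intrB mulrBl.
suff -> : i%:R * a - j%:R * a - ((Num.floor (i%:R * a))%:~R - (Num.floor (j%:R * a))%:~R) = fr i - fr j by [].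
by rewrite /fr; ring.
Qed.

Lemma irrational_dist_pos (R : realType) (a : R) (k : nat) : irrational a -> (0 < k)%N ->
  exists2 d : R, 0 < d & forall p : int, d <= `|k%:R * a - p%:~R|.
Proof.
move=> ia k0; set t := k%:R * a.
have [f0 f1] := frac_bounds t; set fr := t - _ in f0 f1.
have kr : k%:R != 0 :> R by rewrite pnatr_eq0 -lt0n.
have fp : 0 < fr.
  rewrite lt_neqAle f0 andbT; apply/eqP => E; apply: ia.
  exists ((Num.floor t)%:~R / k%:R) => //.
  rewrite rmorphM fmorphV /= ratr_int ratr_nat.
  have -> : (Num.floor t)%:~R = k%:R * a by move: E; rewrite /fr -/t; lra.
  by rewrite mulrC mulKf.
exists (Num.min fr (1 - fr)); first by rewrite lt_min fp subr_gt0.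
move=> p; rewrite ge_min.
have tE : t = (Num.floor t)%:~R + fr by rewrite /fr addrC subrK.
have [h|h] := lerP p (Num.floor t).
  apply/orP; left; apply: le_trans (ler_norm _).
  have : p%:~R <= (Num.floor t)%:~R :> R by rewrite ler_int.
  by rewrite [X in _ -> _ <= X - _]tE; lra.
apply/orP; right; rewrite distrC; apply: le_trans (ler_norm _).
have : (Num.floor t + 1)%:~R <= p%:~R :> R by rewrite ler_int; lia.
by rewrite intrD [X in _ -> _ <= _ - X]tE; lra.
Qed.

Lemma irrational_dist_pos_upto (R : realType) (a : R) (K0 : nat) : irrational a ->
  exists2 d : R, 0 < d &
    forall (k : nat) (p : int), (0 < k < K0)%N -> d <= `|k%:R * a - p%:~R|.
Proof.
move=> ia; elim: K0 => [|K0 [d d0 IH]].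
  by exists 1 => // k p; rewrite ltn0 andbF.
case: (posnP K0) => [->|K00].
  by exists 1 => // k p; case: k.
have [d' d'0 H] := irrational_dist_pos ia K00.
exists (Num.min d d'); first by rewrite lt_min d0.
move=> k p /andP[k0]; rewrite ltnS leq_eqVlt => /orP[/eqP ->|kK].
  by rewrite ge_min H orbT.
by rewrite ge_min IH// k0.
Qed.

Definition best_denominator (R : realType) (a : R) (K : nat) : Prop :=
  (0 < K)%N /\ exists P : int, forall (k : nat) (p : int), (0 < k < K)%N ->
    `|K%:R * a - P%:~R| < `|k%:R * a - p%:~R|.

(** Let d be a lower bound for the distances to the integers of k a with 0 < k < K0. The least k
    with k a within d of an integer is a best denominator by minimality, and it is at least K0 by
    the choice of d. *)
Lemma best_denominator_unbounded (R : realType) (a : R) (K0 : nat) : irrational a ->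
  exists2 K, (K0 <= K)%N & best_denominator a K.
Proof.
move=> ia; have [d d0 Hd] := irrational_dist_pos_upto K0 ia.
pose S (k : nat) := `[< (0 < k)%N /\ exists p : int, `|k%:R * a - p%:~R| < d >].
have exS : exists k, S k.
  by have [k k0 kp] := dirichlet_small a d0; exists k; apply/asboolP.
case: (ex_minnP exS) => K /asboolP [Kp [P KP]] Kmin.
exists K.
  rewrite leqNgt; apply/negP => KK; have := Hd K P; rewrite Kp KK => /(_ isT).
  by rewrite leNgt KP.
split=> //; exists P => k p /andP[k0 kK].
apply: lt_le_trans KP _; rewrite leNgt; apply/negP => kp.
have : S k by apply/asboolP; split=> //; exists p.
by move/Kmin; rewrite leqNgt kK.
Qed.

(** The integer K p - k P equals k (K a - P) - K (k a - p). It is nonzero, since k < K and the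
    strict inequality x < y between the distances forbid the two terms to coincide; hence 1 <= k x +
    K y <= 2 K y. *)
Lemma best_denominator_dist (R : realType) (a : R) (K : nat) : best_denominator a K ->
  forall (k : nat) (p : int), (0 < k < K)%N -> (2 * K%:R)^-1 <= `|k%:R * a - p%:~R|.
Proof.
move=> [K0 [P H]] k p /andP[k0 kK].
have {H} := H k p; rewrite k0 kK => /(_ isT).
set x := `|K%:R * a - _|; set y := `|k%:R * a - _| => xy.
have Kr : 0 < K%:R :> R by rewrite ltr0n.
have kr : 0 < k%:R :> R by rewrite ltr0n.
have kK' : k%:R < K%:R :> R by rewrite ltr_nat.
have x0 : 0 <= x by rewrite normr_ge0.
have kx : k%:R * x <= K%:R * y by apply: ler_pM; rewrite ?ler0n// ltW.
have E : k%:R * (K%:R * a - P%:~R) - K%:R * (k%:R * a - p%:~R) = (K%:Z * p - k%:Z * P)%:~R :> R.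
  by rewrite intrB !intrM; ring.
rewrite -[X in X <= _]mul1r ler_pdivrMr ?mulr_gt0//.
have [D0|D0] := eqVneq (K%:Z * p - k%:Z * P) 0.
  exfalso; move: E; rewrite D0 => /subr0_eq/(congr1 Num.norm).
  rewrite !normrM !normr_nat -/x -/y => E.
  have : k%:R * x < K%:R * y by apply: ltr_pM; rewrite ?ler0n.
  by rewrite E ltxx.
have : 1 <= `|(K%:Z * p - k%:Z * P)%:~R| :> R.
  by rewrite -intr_norm (_ : 1 = 1%:~R)// ler_int; lia.
rewrite -E => /le_trans/(_ (ler_normB _ _)).
rewrite !normrM !normr_nat -/x -/y; lra.
Qed.

Lemma ee_sub1_dist (t d : RR) : (forall p : int, d <= `|t - p%:~R|) -> 2 * d <= cabs (ee t - 1).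
Proof.
move=> H.
have [p hp] : exists p : int, `|t - p%:~R| <= 1 / 2.
  exists (Num.floor (t + 1 / 2)); have := frac_bounds (t + 1 / 2); set f := _%:~R => -[h1 h2].
  by rewrite ler_norml; apply/andP; split; lra.
have := ee_sub1_ge hp; rewrite -mulrNz ee_periodic.
have := H p; rewrite -mulrNz; lra.
Qed.

Lemma cabs_ee_sub1_abs (a : RR) (k : int) :
  cabs (ee (k%:~R * a) - 1) = cabs (ee (`|k|%N%:R * a) - 1).
Proof.
case: k => k //; rewrite NegzE abszN mulrNz mulNr -conj_ee.
by rewrite -[X in _ - X]conjc1 -rmorphB cabs_conj.
Qed.

Lemma best_denominator_small_divisor (a : RR) (K : nat) (k : int) : best_denominator a K ->
  (0 < `|k| < K)%N -> K%:R^-1 <= cabs (ee (k%:~R * a) - 1).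
Proof.
move=> HK kK.
have Kr : 0 < K%:R :> RR by case: HK => K0 _; rewrite ltr0n.
rewrite cabs_ee_sub1_abs.
have -> : K%:R^-1 = 2 * (2 * K%:R)^-1 :> RR by field; rewrite gt_eqF.
by apply: ee_sub1_dist => p; exact: best_denominator_dist.
Qed.

(** Every divisor is at least 1 / K, which alone gives a bound linear in K. The terms below [k0]
    form a constant, negligible against s K once K is large, and beyond [k0] the geometric tail
    makes the linear constant as small as desired. *)
Lemma small_divisor_sum (a q s : RR) (K0 : nat) : irrational a -> 0 < q -> q < 1 -> 0 < s ->
  exists2 K, (K0 <= K)%N & best_denominator a K /\
    \sum_(1 <= k < K) q ^+ k / cabs (ee (k%:R * a) - 1) <= s * K%:R.
Proof.
move=> ia q0 q1 s0; have q1' : 0 < 1 - q by rewrite subr_gt0.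
have e0 : 0 < s / 2 * (1 - q) by rewrite mulr_gt0// divr_gt0// ltr0n.
have [n0 Hn0] := exprn_eventually_lt (ltW q0) q1 e0.
pose k0 := n0.+1.
pose F (k : nat) := q ^+ k / cabs (ee (k%:R * a) - 1).
have F0 k : 0 <= F k by rewrite divr_ge0 ?cabs_ge0// exprn_ge0// ltW.
pose D := \sum_(1 <= k < k0) F k.
have D0 : 0 <= D by apply: sumr_ge0.
have [K KK0 HK] := best_denominator_unbounded (maxn K0 (maxn k0 (Num.bound (2 / s * D)))) ia.
exists K; first by lia.
split=> //.
have Kr : 0 < K%:R :> RR by case: HK => ? _; rewrite ltr0n.
have DK : D <= s / 2 * K%:R.
  have h : 2 / s * D <= K%:R.
    apply: le_trans (ltW (archi_boundP _)) _.
      by rewrite mulr_ge0// divr_ge0 ?ler0n// ltW.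
    by rewrite ler_nat; lia.
  have -> : D = s / 2 * (2 / s * D) by field; rewrite gt_eqF.
  by rewrite ler_wpM2l// divr_ge0 ?ler0n// ltW.
rewrite (@big_cat_nat _ _ _ k0)//=; last by lia.
suff : \sum_(k0 <= k < K) F k <= s / 2 * K%:R by move: DK; rewrite -/D; lra.
apply: (@le_trans _ _ (\sum_(k0 <= k < K) K%:R * q ^+ k)).
  rewrite big_nat_cond [X in _ <= X]big_nat_cond; apply: ler_sum => k; rewrite andbT => /andP[k1 k2].
  rewrite /F mulrC ler_wpM2r// ?exprn_ge0 ?(ltW q0)//.
  rewrite -[K%:R]invrK lef_pV2 ?posrE ?invr_gt0//.
    by apply: (@best_denominator_small_divisor _ _ k%:Z HK); rewrite absz_nat; lia.
  apply: lt_le_trans (@best_denominator_small_divisor _ _ k%:Z HK _); rewrite ?invr_gt0// absz_nat; lia.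
rewrite -mulr_sumr mulrC ler_wpM2r ?ler0n//.
rewrite -[X in \sum_(X <= _ < _) _]add0n big_addn big_mkord.
under eq_bigr do rewrite exprD.
rewrite -mulr_suml.
have A := geometric_sum_le (K - k0) (ltW q0) q1.
have B := ltW (Hn0 k0 (leqnSn _)).
apply: (@le_trans _ _ ((1 - q)^-1 * (s / 2 * (1 - q)))).
  apply: ler_pM => //; last by rewrite exprn_ge0// ltW.
  by apply: sumr_ge0 => i _; rewrite exprn_ge0// ltW.
by rewrite mulrCA mulVf ?mulr1// gt_eqF.
Qed.

(** * Trigonometric polynomials with weighted norms *)

(** Pairs of a frequency and a coefficient, repetitions allowed, so sums and products need no normal
    form. [tnorm] is the l1 norm with weights r^|k|, computed on the list; it dominates the norm of
    the coefficients gathered by [tcoef]. *)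
Definition tpoly := seq (int * RR[i]).

Definition tev (P : tpoly) (x : RR) : RR[i] := \sum_(t <- P) t.2 * ee (t.1%:~R * x).
Definition tnorm (r : RR) (P : tpoly) : RR := \sum_(t <- P) cabs t.2 * r ^+ `|t.1|%N.
Definition tcoef (P : tpoly) (m : int) : RR[i] := \sum_(t <- P | t.1 == m) t.2.

Definition tscale (c : RR[i]) (P : tpoly) : tpoly := [seq (t.1, c * t.2) | t <- P].
Definition tmul (P Q : tpoly) : tpoly := [seq (s.1 + t.1, s.2 * t.2) | s <- P, t <- Q].
Definition tconj (P : tpoly) : tpoly := [seq (- t.1, t.2^*%C) | t <- P].
Definition tshift (a : RR) (P : tpoly) : tpoly := [seq (t.1, t.2 * ee (t.1%:~R * a)) | t <- P].
Definition tconst (c : RR[i]) : tpoly := [:: (0, c)].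
Definition tpow (P : tpoly) (n : nat) : tpoly := iter n (tmul P) (tconst 1).
Definition tpoly_of (a : int -> RR[i]) (K : nat) : tpoly :=
  [seq (k%:Z - K%:Z, a (k%:Z - K%:Z)) | k <- iota 0 (K + K).+1].

Lemma tev_cat P Q x : tev (P ++ Q) x = tev P x + tev Q x.
Proof. exact: big_cat. Qed.

Lemma tev_scale c P x : tev (tscale c P) x = c * tev P x.
Proof. by rewrite /tev big_map mulr_sumr; apply: eq_bigr => t _; rewrite mulrA. Qed.

Lemma tev_mul P Q x : tev (tmul P Q) x = tev P x * tev Q x.
Proof.
rewrite /tev big_allpairs_dep /= mulr_suml; apply: eq_bigr => s _.
rewrite mulr_sumr; apply: eq_bigr => t _.
by rewrite intrD mulrDl eeD mulrACA.
Qed.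

Lemma tev_conj P x : tev (tconj P) x = ((tev P x)^*)%C.
Proof.
rewrite /tev big_map rmorph_sum; apply: eq_bigr => t _.
by rewrite /= mulrNz mulNr -conj_ee; symmetry; exact: rmorphM.
Qed.

Lemma tev_shift a P x : tev (tshift a P) x = tev P (x + a).
Proof.
rewrite /tev big_map; apply: eq_bigr => t _ /=.
by rewrite -mulrA -eeD mulrDr addrC.
Qed.

Lemma tev_const c x : tev (tconst c) x = c.
Proof. by rewrite /tev big_seq1 /= mul0r ee0 mulr1. Qed.

Lemma tev_pow P n x : tev (tpow P n) x = tev P x ^+ n.
Proof. by elim: n => [|n IH]; rewrite ?tev_const ?expr0// exprS -IH -tev_mul. Qed.

Lemma tev_of a K x : tev (tpoly_of a K) x = trig_poly a K x.
Proof. by rewrite trig_polyE /tev big_map -(big_mkord xpredT (fun k : nat => a (k%:Z - K%:Z) * ee ((k%:Z - K%:Z)%:~R * x))) /index_iota subn0. Qed.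

Lemma tnorm_ge0 r P : 0 <= r -> 0 <= tnorm r P.
Proof. by move=> r0; apply: sumr_ge0 => t _; rewrite mulr_ge0 ?cabs_ge0 ?exprn_ge0. Qed.

Lemma tnorm_cat r P Q : tnorm r (P ++ Q) = tnorm r P + tnorm r Q.
Proof. exact: big_cat. Qed.

Lemma tnorm_scale r c P : tnorm r (tscale c P) = cabs c * tnorm r P.
Proof. by rewrite /tnorm big_map mulr_sumr; apply: eq_bigr => t _; rewrite cabsM mulrA. Qed.

Lemma tnorm_mul r P Q : 1 <= r -> tnorm r (tmul P Q) <= tnorm r P * tnorm r Q.
Proof.
move=> r1; have r0 : 0 <= r := le_trans ler01 r1.
rewrite /tnorm big_allpairs_dep /= mulr_suml; apply: ler_sum => s _.
rewrite mulr_sumr; apply: ler_sum => t _.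
rewrite cabsM [X in _ <= X]mulrACA ler_wpM2l ?mulr_ge0 ?cabs_ge0//.
rewrite -exprD; apply: ler_weXn2l => //; lia.
Qed.

Lemma tnorm_conj r P : tnorm r (tconj P) = tnorm r P.
Proof. by rewrite /tnorm big_map; apply: eq_bigr => t _ /=; rewrite cabs_conj abszN. Qed.

Lemma tnorm_const r c : tnorm r (tconst c) = cabs c.
Proof. by rewrite /tnorm big_seq1 /= expr0 mulr1. Qed.

Lemma tnorm_pow r P n : 1 <= r -> tnorm r (tpow P n) <= tnorm r P ^+ n.
Proof.
move=> r1; have r0 : 0 <= r := le_trans ler01 r1.
elim: n => [|n IH]; first by rewrite tnorm_const cabs1 expr0.
apply: le_trans (tnorm_mul _ _ r1) _; rewrite exprS ler_wpM2l//.
exact: tnorm_ge0.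
Qed.

Lemma tev_le_tnorm r P x : 1 <= r -> cabs (tev P x) <= tnorm r P.
Proof.
move=> r1; apply: le_trans (cabs_sum _ _ _) _; apply: ler_sum => t _.
rewrite cabsM cabs_ee mulr1 -[X in X <= _]mulr1 ler_wpM2l ?cabs_ge0//.
exact: exprn_ege1.
Qed.

Lemma tcoef_cat P Q m : tcoef (P ++ Q) m = tcoef P m + tcoef Q m.
Proof. exact: big_cat. Qed.

Lemma tcoef_scale c P m : tcoef (tscale c P) m = c * tcoef P m.
Proof. by rewrite /tcoef big_map mulr_sumr. Qed.

Lemma tcoef_conj P m : tcoef (tconj P) m = ((tcoef P (- m))^*)%C.
Proof.
rewrite /tcoef big_map rmorph_sum; apply: eq_bigl => t /=.
by rewrite eqr_oppLR.
Qed.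

Lemma tcoef_shift a P m : tcoef (tshift a P) m = tcoef P m * ee (m%:~R * a).
Proof. by rewrite /tcoef big_map mulr_suml; apply: eq_bigr => t /eqP /= ->. Qed.

Lemma tcoef_mul P Q m : tcoef (tmul P Q) m = \sum_(s <- P) s.2 * tcoef Q (m - s.1).
Proof.
rewrite /tcoef big_mkcond big_allpairs_dep /=; apply: eq_bigr => s _.
rewrite mulr_sumr [RHS]big_mkcond; apply: eq_bigr => t _.
by rewrite [t.1 == _]eq_sym subr_eq [t.1 + _]addrC eq_sym.
Qed.

Lemma tcoef_le_tnorm r P m : 1 <= r -> cabs (tcoef P m) * r ^+ `|m|%N <= tnorm r P.
Proof.
move=> r1; have r0 : 0 <= r := le_trans ler01 r1.
apply: (@le_trans _ _ (\sum_(t <- P | t.1 == m) cabs t.2 * r ^+ `|t.1|%N)).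
  apply: le_trans (ler_wpM2r (exprn_ge0 _ r0) (cabs_sum _ _ _)) _.
  by rewrite mulr_suml le_eqVlt; apply/orP; left; apply/eqP; apply: eq_bigr => t /eqP ->.
rewrite big_mkcond; apply: ler_sum => t _; case: ifP => // _.
by rewrite mulr_ge0 ?cabs_ge0 ?exprn_ge0.
Qed.

Lemma eq_of_dvdz_small (Q : nat) (a b : int) :
  (`|a| + `|b| < Q)%N -> (Q%:Z %| a - b)%Z -> a = b.
Proof. by move=> abQ; rewrite dvdzE => /dvdn_leq; rewrite absz_nat; lia. Qed.

(** The average over Q equidistant points, with Q larger than every difference of frequencies that
    occurs, extracts a coefficient exactly. *)
Lemma tcoef_le_sup P m b : (forall x, cabs (tev P x) <= b) -> cabs (tcoef P m) <= b.
Proof.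
move=> H; pose D := (\sum_(t <- P) `|t.1| + `|m|)%N; pose Q := D.+1.
have tD t : t \in P -> (`|t.1| + `|m| <= D)%N.
  by move=> tP; rewrite leq_add2r (big_rem t)//= leq_addr.
have Qr : 0 < Q%:R :> RR by rewrite ltr0n.
have Qc : Q%:R != 0 :> RR[i] by rewrite pnatr_eq0.
have E : tcoef P m * Q%:R =
    \sum_(j < Q) tev P (j%:R / Q%:R) * ee (- (m%:~R * (j%:R / Q%:R))).
  under [RHS]eq_bigr do rewrite /tev mulr_suml.
  rewrite exchange_big /= /tcoef big_mkcond mulr_suml big_seq [RHS]big_seq.
  apply: eq_bigr => t tP.
  under [RHS]eq_bigr do rewrite -mulrA -eeD -mulrBl -intrB.
  rewrite -mulr_sumr sum_ee//; case: eqP => [->|ne]; first by rewrite subrr dvdz0.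
  rewrite ifF ?mulr0 ?mul0r//; apply/negbTE/negP => tm; apply: ne.
  by apply: eq_of_dvdz_small tm; rewrite /Q ltnS; exact: tD.
have := congr1 cabs E; rewrite cabsM -RtoC_nat cabs_RtoC normr_nat => E'.
rewrite -(ler_pM2r Qr) E'; apply: le_trans (cabs_sum _ _ _) _.
apply: (@le_trans _ _ (\sum_(j < Q) b)).
  by apply: ler_sum => j _; rewrite cabsM cabs_ee mulr1.
by rewrite sumr_const card_ord mulr_natr.
Qed.

(** Cutting at frequency M costs the weighted norm divided by r^M. Conversely, a value that is not
    small forces some coefficient of low frequency not to be small. *)
Lemma tev_le_tcoef r P x M : 1 <= r ->
  cabs (tev P x) <= \sum_(i < (M + M).+1) cabs (tcoef P (i%:Z - M%:Z)) + tnorm r P / r ^+ M.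
Proof.
move=> r1; have r0 : 0 < r := lt_le_trans ltr01 r1.
rewrite /tev (bigID (fun t : int * RR[i] => (`|t.1| <= M)%N)) /=.
apply: le_trans (cabsD _ _) (lerD _ _); last first.
  apply: le_trans (cabs_sum _ _ _) _; rewrite mulr_suml big_mkcond.
  apply: ler_sum => t _; case: ifP => [|_]; last first.
    by rewrite mulr_ge0 ?invr_ge0 ?mulr_ge0 ?cabs_ge0 ?exprn_ge0// ltW.
  rewrite -ltnNge => Mt; rewrite cabsM cabs_ee mulr1 -mulrA -[X in X <= _]mulr1.
  rewrite ler_wpM2l ?cabs_ge0// ler_pdivlMr ?exprn_gt0// mul1r.
  by apply: ler_weXn2l => //; exact: ltnW.
have -> : \sum_(t <- P | (`|t.1| <= M)%N) t.2 * ee (t.1%:~R * x) =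
    \sum_(i < (M + M).+1) tcoef P (i%:Z - M%:Z) * ee ((i%:Z - M%:Z)%:~R * x).
  under [RHS]eq_bigr do rewrite /tcoef mulr_suml big_mkcond /=.
  rewrite exchange_big /= big_mkcond; apply: eq_bigr => t _.
  case: ifP => [tM|/negbT tM].
    have hi : (`|(t.1 + M%:Z)%R|%N < (M + M).+1)%N by lia.
    rewrite (bigD1 (Ordinal hi))//= ifT; last by lia.
    rewrite big1 ?addr0 => [|i ne]; first by congr (_ * ee (_%:~R * _)); lia.
    rewrite ifF//; apply/negbTE; apply: contra ne => /eqP E.
    by rewrite -val_eqE /=; lia.
  rewrite big1// => i _; rewrite ifF//; apply/negbTE.
  by have := ltn_ord i; apply: contraL; lia.
apply: le_trans (cabs_sum _ _ _) _; apply: ler_sum => i _.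
by rewrite cabsM cabs_ee mulr1.
Qed.

Lemma cabs_exprB (a b : RR[i]) (c : RR) n : cabs a <= c -> cabs b <= c -> 1 <= c ->
  cabs (a ^+ n - b ^+ n) <= n%:R * c ^+ n * cabs (a - b).
Proof.
move=> ac bc c1; have c0 : 0 <= c := le_trans ler01 c1.
elim: n => [|n IH]; first by rewrite !expr0 subrr cabs0 !mul0r.
have -> : a ^+ n.+1 - b ^+ n.+1 = a * (a ^+ n - b ^+ n) + (a - b) * b ^+ n.
  by rewrite !exprS; ring.
apply: le_trans (cabsD _ _) _; rewrite !cabsM cabsX.
have d0 := cabs_ge0 (a - b).
have A : cabs a * cabs (a ^+ n - b ^+ n) <= c * (n%:R * c ^+ n * cabs (a - b)).
  by apply: ler_pM; rewrite ?cabs_ge0.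
have B : cabs b ^+ n <= c ^+ n.+1.
  apply: (@le_trans _ _ (c ^+ n)); first by apply: lerXn2r; rewrite ?nnegrE ?cabs_ge0.
  by apply: ler_weXn2l.
have B' := ler_wpM2l d0 B.
rewrite -natr1 mulrDl mul1r mulrDl exprS in A B' *.
by move: A B'; set u := c ^+ n; set w := cabs (a - b); lra.
Qed.

Lemma tev_Re_part P x : tev (tscale (RtoC (1 / 2)) (P ++ tconj P)) x = RtoC (complex.Re (tev P x)).
Proof.
rewrite tev_scale tev_cat tev_conj addcJ mulrA -RtoC_nat -RtoCM.
by rewrite divfK ?pnatr_eq0// mul1r.
Qed.

(** The approximant is (1 + i phi / J)^J: submultiplicativity bounds its norm by (1 + N / J)^J <=
    exp N for every J, so the accuracy e does not enter the norm. *)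
Lemma expi_tpoly_approx (r : RR) (P : tpoly) (e : RR) : 1 <= r -> 0 < e ->
  exists2 E : tpoly, tnorm r E <= expR (tnorm r P) &
    forall x, cabs (tev E x - expi (complex.Re (tev P x))) <= e.
Proof.
move=> r1 e0; set N := tnorm r P; have r0 := le_trans ler01 r1.
have N0 : 0 <= N by exact: tnorm_ge0.
(* The J factors are each off by at most 2 (phi / J)^2, and the powers contribute at most exp N: the
   total error is at most A / J. *)
pose A := 2 * N ^+ 2 * expR N.
have A0 : 0 <= A by rewrite !mulr_ge0 ?ler0n ?exprn_ge0// expR_ge0.
have := archi_boundP (divr_ge0 A0 (ltW e0)); set J0 := Num.bound _ => HJ0.
pose J := J0.+1; have Jr : 0 < J%:R :> RR by rewrite ltr0n.
have HJ : A <= e * J%:R.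
  rewrite mulrC -ler_pdivrMr//; apply: le_trans (ltW HJ0) _.
  by rewrite ler_nat.
pose P' := tscale (RtoC (1 / 2)) (P ++ tconj P).
have nP' : tnorm r P' = N.
  rewrite tnorm_scale tnorm_cat tnorm_conj cabs_RtoC -/N ger0_norm ?divr_ge0 ?ler0n//.
  by field.
pose T := tconst 1 ++ tscale (RtoC J%:R^-1 * 'i%C) P'.
have ci : cabs 'i%C = 1 by rewrite /= expr0n expr1n add0r sqrtr1.
have nT : tnorm r T <= expR (N / J%:R).
  rewrite tnorm_cat tnorm_const cabs1 tnorm_scale nP' cabsM cabs_RtoC ci mulr1.
  rewrite ger0_norm ?invr_ge0 ?ler0n// mulrC; exact: expR_ge1Dx.
have EJ : expR (N / J%:R) ^+ J = expR N.
  by rewrite -expRM_natr divfK// gt_eqF.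
exists (tpow T J).
  apply: le_trans (tnorm_pow _ _ r1) _; rewrite -EJ.
  by apply: lerXn2r; rewrite ?nnegrE ?expR_ge0 ?tnorm_ge0.
move=> x; set phi := complex.Re (tev P x).
have phiN : `|phi| <= N by apply: le_trans (Re_le_cabs _) (tev_le_tnorm _ _ r1).
have ET : tev T x = 1 + RtoC (phi / J%:R) * 'i%C.
  rewrite tev_cat tev_const tev_scale tev_Re_part -/phi RtoCM; congr (_ + _).
  by rewrite mulrC mulrA.
have Ephi : expi phi = expi (phi / J%:R) ^+ J.
  have X n (t : RR) : expi t ^+ n = expi (n%:R * t).
    elim: n => [|n IH]; first by rewrite mul0r expr0 expi0.
    by rewrite exprS IH -expiD -natr1 mulrDl mul1r addrC.
  by rewrite X mulrC divfK// gt_eqF.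
rewrite tev_pow Ephi.
have c1 : 1 <= expR (N / J%:R).
  apply: le_trans (expR_ge1Dx _); rewrite lerDl divr_ge0 ?ler0n//.
apply: le_trans (cabs_exprB _ _ _ c1) _.
- exact: le_trans (tev_le_tnorm _ _ r1) nT.
- by rewrite cabs_expi.
rewrite EJ ET cabs_distrC.
have L := cabs_expi_sub1_lin (phi / J%:R).
have phi2 : (phi / J%:R) ^+ 2 <= N ^+ 2 / J%:R ^+ 2.
  rewrite expr_div_n ler_wpM2r ?invr_ge0 ?exprn_ge0 ?ler0n//.
  by rewrite -real_normK ?num_real//; apply: lerXn2r; rewrite ?nnegrE.
apply: (@le_trans _ _ (J%:R * expR N * (2 * (N ^+ 2 / J%:R ^+ 2)))).
  rewrite ler_wpM2l ?mulr_ge0 ?ler0n ?expR_ge0//.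
  by apply: le_trans L _; rewrite ler_wpM2l ?ler0n.
have -> : J%:R * expR N * (2 * (N ^+ 2 / J%:R ^+ 2)) = A / J%:R.
  by rewrite /A; field; rewrite gt_eqF.
by rewrite ler_pdivrMr.
Qed.

Lemma sum_abs_sym (F : nat -> RR) (K : nat) :
  \sum_(i < (K + K).+1) F `|i%:Z - K%:Z|%N = F 0%N + 2 * \sum_(1 <= k < K.+1) F k.
Proof.
rewrite -(big_mkord xpredT (fun i : nat => F `|i%:Z - K%:Z|%N)) -addnS big_mkord.
rewrite big_split_ord /= big_add1 big_mkord /=.
have -> : \sum_(i < K) F `|i%:Z - K%:Z|%N = \sum_(i < K) F i.+1.
  rewrite (reindex_inj rev_ord_inj) /=; apply: eq_bigr => i _; congr F.
  by have := ltn_ord i; lia.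
have -> : \sum_(i < K.+1) F `|(K + i)%:Z - K%:Z|%N = \sum_(i < K.+1) F i.
  by apply: eq_bigr => i _; congr F; lia.
rewrite [X in _ + X]big_ord_recl.
have -> : \sum_(i < K) F (lift ord0 i) = \sum_(i < K) F i.+1 by apply: eq_bigr.
by rewrite /=; ring.
Qed.

(** * Matrix and vector norms *)

(** This entrywise l1 norm is submultiplicative and invariant under the adjoint. [sqnorm], the
    square of the norm that defines domination, is compared with it up to dimensional constants. *)
Definition mxnorm {m n} (A : 'M[RR[i]]_(m, n)) : RR := \sum_i \sum_j cabs (A i j).

Lemma mxnorm_ge0 m n (A : 'M[RR[i]]_(m, n)) : 0 <= mxnorm A.
Proof. by apply: sumr_ge0 => i _; apply: sumr_ge0 => j _; exact: cabs_ge0. Qed.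

Lemma mxnormD m n (A B : 'M[RR[i]]_(m, n)) : mxnorm (A + B) <= mxnorm A + mxnorm B.
Proof.
rewrite /mxnorm -big_split /=; apply: ler_sum => i _; rewrite -big_split /=.
by apply: ler_sum => j _; rewrite mxE; exact: cabsD.
Qed.

Lemma mxnormN m n (A : 'M[RR[i]]_(m, n)) : mxnorm (- A) = mxnorm A.
Proof.
by apply: eq_bigr => i _; apply: eq_bigr => j _; rewrite mxE cabsN.
Qed.

Lemma mxnormB m n (A B : 'M[RR[i]]_(m, n)) : mxnorm (A - B) <= mxnorm A + mxnorm B.
Proof. by rewrite -(mxnormN B); exact: mxnormD. Qed.

Lemma mxnorm0 m n : mxnorm (0 : 'M[RR[i]]_(m, n)) = 0.
Proof. by rewrite /mxnorm big1// => i _; rewrite big1// => j _; rewrite mxE cabs0. Qed.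

Lemma mxnorm_entry m n (A : 'M[RR[i]]_(m, n)) i j : cabs (A i j) <= mxnorm A.
Proof.
rewrite /mxnorm (bigD1 i)//= (bigD1 j)//= -addrA lerDl addr_ge0//.
  by apply: sumr_ge0 => k _; exact: cabs_ge0.
by apply: sumr_ge0 => k _; apply: sumr_ge0 => l _; exact: cabs_ge0.
Qed.

Lemma mxnorm_gt0 m n (A : 'M[RR[i]]_(m, n)) : (0 < mxnorm A) = (A != 0).
Proof.
apply/idP/idP => [|A0].
  by apply: contraTneq => ->; rewrite mxnorm0 ltxx.
rewrite lt_neqAle mxnorm_ge0 andbT eq_sym; apply: contra A0 => /eqP H.
apply/eqP/matrixP => i j; rewrite mxE; apply/eqP; apply: contraT; rewrite -cabs_gt0 => h.
by have := lt_le_trans h (mxnorm_entry A i j); rewrite H ltxx.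
Qed.

Lemma mxnormM m n p (A : 'M[RR[i]]_(m, n)) (B : 'M[RR[i]]_(n, p)) :
  mxnorm (A *m B) <= mxnorm A * mxnorm B.
Proof.
rewrite {1}/mxnorm mulr_suml; apply: ler_sum => i _; rewrite mulr_suml.
apply: (@le_trans _ _ (\sum_j \sum_k cabs (A i k) * cabs (B k j))).
  apply: ler_sum => j _; rewrite mxE; apply: le_trans (cabs_sum _ _ _) _.
  by apply: ler_sum => k _; rewrite cabsM.
rewrite exchange_big /=; apply: ler_sum => k _; rewrite -mulr_sumr.
rewrite ler_wpM2l ?cabs_ge0// /mxnorm [X in _ <= X](bigD1 k)//= lerDl.
by apply: sumr_ge0 => l _; apply: sumr_ge0 => j _; exact: cabs_ge0.
Qed.

Lemma mxnorm_adj m n (A : 'M[RR[i]]_(m, n)) : mxnorm (adjmx A) = mxnorm A.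
Proof.
rewrite /mxnorm exchange_big /=; apply: eq_bigr => i _; apply: eq_bigr => j _.
by rewrite !mxE cabs_conj.
Qed.

Lemma adjmxM m n p (A : 'M[RR[i]]_(m, n)) (B : 'M[RR[i]]_(n, p)) :
  adjmx (A *m B) = adjmx B *m adjmx A.
Proof. by rewrite /adjmx map_mxM trmx_mul. Qed.

Lemma adjmx1 n : adjmx (1%:M : 'M[RR[i]]_n) = 1%:M.
Proof. by rewrite /adjmx map_mx1 trmx1. Qed.

Definition sqnorm {n} (u : 'cV[RR[i]]_n) : RR := \sum_i cabs (u i 0) ^+ 2.

Lemma sqnorm_ge0 n (u : 'cV[RR[i]]_n) : 0 <= sqnorm u.
Proof. by apply: sumr_ge0 => i _; exact: sqr_ge0. Qed.

Lemma sqnorm0 n : sqnorm (0 : 'cV[RR[i]]_n) = 0.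
Proof. by rewrite /sqnorm big1// => i _; rewrite mxE cabs0 expr0n. Qed.

Lemma vnormE n (u : 'cV[RR[i]]_n) : vnorm u = Num.sqrt (sqnorm u).
Proof. by congr Num.sqrt; apply: eq_bigr => i _; rewrite sqr_cabs. Qed.

Lemma sqnormZ n (c : RR) (u : 'cV[RR[i]]_n) : sqnorm (RtoC c *: u) = c ^+ 2 * sqnorm u.
Proof.
rewrite /sqnorm mulr_sumr; apply: eq_bigr => i _.
by rewrite mxE cabsM cabs_RtoC exprMn real_normK ?num_real.
Qed.

Lemma sqnorm_le_mxnorm n (u : 'cV[RR[i]]_n) : sqnorm u <= mxnorm u ^+ 2.
Proof.
rewrite expr2 {1}/mxnorm mulr_suml; apply: ler_sum => i _.
by rewrite big_ord1 expr2 ler_wpM2l ?cabs_ge0//; exact: mxnorm_entry.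
Qed.

Lemma mxnorm_le_sqnorm n (u : 'cV[RR[i]]_n) : mxnorm u ^+ 2 <= n%:R ^+ 2 * sqnorm u.
Proof.
have s0 := sqnorm_ge0 u.
have H : mxnorm u <= n%:R * Num.sqrt (sqnorm u).
  apply: (@le_trans _ _ (\sum_(i < n) Num.sqrt (sqnorm u))).
    apply: ler_sum => i _; rewrite big_ord1.
    rewrite -(@ler_pXn2r _ 2)// ?nnegrE ?cabs_ge0 ?sqrtr_ge0// sqr_sqrtr//.
    rewrite /sqnorm (bigD1 i)//= lerDl.
    by apply: sumr_ge0 => k _; exact: sqr_ge0.
  by rewrite sumr_const card_ord mulr_natl.
have := lerXn2r 2 _ _ H; rewrite !nnegrE mxnorm_ge0 mulr_ge0 ?ler0n ?sqrtr_ge0//.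
by rewrite exprMn sqr_sqrtr//; apply.
Qed.

Lemma sqnorm_eq0 n (u : 'cV[RR[i]]_n) : sqnorm u = 0 -> u = 0.
Proof.
move=> u0; apply/eqP; apply: contraT; rewrite -mxnorm_gt0 => h.
have := mxnorm_le_sqnorm u; rewrite u0 mulr0 leNgt => /negP; case.
exact: exprn_gt0.
Qed.

Lemma adjmx_self n (u : 'cV[RR[i]]_n) : cabs ((adjmx u *m u) 0 0) = sqnorm u.
Proof.
have -> : (adjmx u *m u) 0 0 = RtoC (sqnorm u).
  rewrite mxE /sqnorm /RtoC rmorph_sum; apply: eq_bigr => i _; rewrite !mxE.
  rewrite sqr_cabs; case: (u i 0) => a b /=; simpc; congr (_ +i* _); ring.
by rewrite cabs_RtoC ger0_norm// sqnorm_ge0.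
Qed.

(** * Cocycles preserving a nondegenerate form *)

(** The columns of Q and those of W Q span subspaces of dimension above d in dimension 2 d, so these
    meet. *)
Lemma rank_cap_image (d k : nat) (W : 'M[RR[i]]_(d + d)) (Q : 'M[RR[i]]_(d + d, k)) :
  W \in unitmx -> (d < \rank Q)%N ->
  exists a b : 'cV[RR[i]]_k, Q *m a != 0 /\ Q *m a = W *m (Q *m b).
Proof.
move=> Wu rQ; set A := Q^T; set B := (W *m Q)^T.
have rA : \rank A = \rank Q by rewrite mxrank_tr.
have rB : \rank B = \rank Q.
  by rewrite /B trmx_mul mxrankMfree ?mxrank_tr// row_free_unit unitmx_tr.
have rc : (0 < \rank (A :&: B)%MS)%N.
  have := mxrank_sum_cap A B; rewrite rA rB.
  by have := rank_leq_col (A + B)%MS; lia.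
have /rowV0Pn[w wAB w0] : (A :&: B)%MS != 0 by rewrite -mxrank_eq0 -lt0n.
move: wAB; rewrite sub_capmx => /andP[/submxP[a Ea] /submxP[b Eb]].
exists a^T, b^T.
have E1 : Q *m a^T = w^T by rewrite Ea trmx_mul trmxK.
have E2 : W *m (Q *m b^T) = w^T by rewrite Eb trmx_mul trmxK mulmxA.
by rewrite E1 E2; split=> //; rewrite trmx_eq0.
Qed.

(* A subspace of dimension > d is not W-isotropic: it contains a nonzero W b with b in it. *)
Lemma symplectic_not_contracting (d : nat) (W : 'M[RR[i]]_(d + d)) : W \in unitmx ->
  exists2 c : RR, 0 < c & forall k (B : 'M[RR[i]]_(d + d)) (Q : 'M[RR[i]]_(d + d, k)),
    adjmx B *m W *m B = W -> (d < \rank Q)%N ->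
    exists a : 'cV[RR[i]]_k, Q *m a != 0 /\ mxnorm (Q *m a) <= c * mxnorm (B *m (Q *m a)).
Proof.
move=> Wu; set M := (d + d)%:R ^+ 2 * mxnorm W * mxnorm (invmx W).
have M0 : 0 <= M by rewrite !mulr_ge0 ?mxnorm_ge0 ?exprn_ge0 ?ler0n.
exists (M + 1); first by rewrite ltr_wpDl.
set c := M + 1; have c0 : 0 < c by rewrite ltr_wpDl.
move=> k B Q BW rQ; have [a [b [w0 wE]]] := rank_cap_image Wu rQ.
have w'0 : Q *m b != 0 by apply: contra w0 => /eqP E; rewrite wE E mulmx0.
have [h|h] := leP (mxnorm (Q *m a)) (c * mxnorm (B *m (Q *m a))); first by exists a.
have [h'|h'] := leP (mxnorm (Q *m b)) (c * mxnorm (B *m (Q *m b))); first by exists b.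
exfalso; set w := Q *m a in w0 wE h *; set w' := Q *m b in w'0 wE h' *.
have w'w : mxnorm w' <= mxnorm (invmx W) * mxnorm w.
  by have -> : w' = invmx W *m w; [rewrite wE mulKmx|exact: mxnormM].
(* Since w = W w', the square norm of w is the form at (w, w'), hence at (B w, B w'). If both
   vectors were contracted by more than c, this would be too small, because c^2 > M. *)
have E : sqnorm w <= mxnorm (B *m w) * mxnorm W * mxnorm (B *m w').
  rewrite -adjmx_self {2}wE mulmxA -{1}BW.
  have -> : adjmx w *m (adjmx B *m W *m B) *m w' = adjmx (B *m w) *m W *m (B *m w').
    by rewrite adjmxM !mulmxA.
  apply: le_trans (mxnorm_entry _ _ _) _; apply: le_trans (mxnormM _ _) _.
  rewrite ler_wpM2r ?mxnorm_ge0//; apply: le_trans (mxnormM _ _) _.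
  by rewrite mxnorm_adj.
have wp : 0 < mxnorm w by rewrite mxnorm_gt0.
have w'p : 0 < mxnorm w' by rewrite mxnorm_gt0.
have F := mxnorm_le_sqnorm w.
set x := mxnorm (B *m w) in h E; set y := mxnorm (B *m w') in h' E.
have x0 : 0 <= x by exact: mxnorm_ge0.
have y0 : 0 <= y by exact: mxnorm_ge0.
have W0 := mxnorm_ge0 W.
have n0 : 0 <= (d + d)%:R ^+ 2 :> RR by rewrite exprn_ge0 ?ler0n.
have G1 : (c * x) * (c * y) <= mxnorm w * mxnorm w'.
  by apply: ler_pM; rewrite ?mulr_ge0 ?(ltW c0)// ltW.
have G2 : mxnorm w * mxnorm w' <= mxnorm (invmx W) * mxnorm w ^+ 2.
  by rewrite expr2 mulrCA ler_wpM2l// ltW.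
have G3 : mxnorm w ^+ 2 <= (d + d)%:R ^+ 2 * (x * mxnorm W * y).
  by apply: le_trans F _; rewrite ler_wpM2l.
have G4 : c ^+ 2 * mxnorm w ^+ 2 <= M * mxnorm w ^+ 2.
  apply: (@le_trans _ _ ((d + d)%:R ^+ 2 * mxnorm W * ((c * x) * (c * y)))).
    by move: (ler_wpM2l (sqr_ge0 c) G3); rewrite !expr2 => ?; lra.
  have -> : M * mxnorm w ^+ 2 = (d + d)%:R ^+ 2 * mxnorm W * (mxnorm (invmx W) * mxnorm w ^+ 2).
    by rewrite /M; ring.
  apply: ler_wpM2l; first by rewrite mulr_ge0.
  exact: le_trans G1 G2.
have : c ^+ 2 <= M by rewrite -(ler_pM2r (exprn_gt0 2 wp)).
have : 0 <= M * M by rewrite mulr_ge0.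
by rewrite /c expr2; lra.
Qed.

Lemma cociterD n (alpha : RR) (A : RR -> 'M[RR[i]]_n) (p q : nat) x :
  cociter alpha A (p + q) x = cociter alpha A p (x + q%:R * alpha) *m cociter alpha A q x.
Proof.
elim: p => [|p IH] /=; first by rewrite mul1mx.
by rewrite IH mulmxA natrD mulrDl [p%:R * _ + _]addrC addrA.
Qed.

Lemma cociter_symplectic n (alpha : RR) (A : RR -> 'M[RR[i]]_n) W p x :
  (forall x, adjmx (A x) *m W *m A x = W) ->
  adjmx (cociter alpha A p x) *m W *m cociter alpha A p x = W.
Proof.
move=> AW; elim: p => [|p IH] /=; first by rewrite adjmx1 mul1mx mulmx1.
rewrite adjmxM; set B := A _; set D := cociter _ _ _ _ in IH *.
have -> : adjmx D *m adjmx B *m W *m (B *m D) = adjmx D *m (adjmx B *m W *m B) *m D.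
  by rewrite !mulmxA.
by rewrite AW.
Qed.

Lemma symplectic_unitmx n (W B : 'M[RR[i]]_n) : W \in unitmx -> adjmx B *m W *m B = W ->
  B \in unitmx.
Proof. by move=> Wu E; move: Wu; rewrite -{1}E unitmx_mul => /andP[]. Qed.

Lemma symplectic_invmx n (W B : 'M[RR[i]]_n) : W \in unitmx -> adjmx B *m W *m B = W ->
  adjmx (invmx B) *m W *m invmx B = W.
Proof.
move=> Wu E; have Bu := symplectic_unitmx Wu E.
have E1 : adjmx (invmx B) *m adjmx B = 1%:M by rewrite -adjmxM mulmxV ?adjmx1.
by rewrite -{1}E -!mulmxA mulmxV// mulmx1 mulmxA E1 mul1mx.
Qed.

Lemma invariant_cociter n (alpha : RR) (A : RR -> 'M[RR[i]]_n) P p x u :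
  Defs.invariant alpha A P -> in_sub (P x) u ->
  in_sub (P (x + p%:R * alpha)) (cociter alpha A p x *m u).
Proof.
move=> inv Pu; elim: p => [|p IH] /=; first by rewrite mul0r addr0 mul1mx.
rewrite -natr1 mulrDl mul1r addrA -mulmxA.
by have [H _] := inv (x + p%:R * alpha); exact: H.
Qed.

Lemma in_subZ n (P : 'M[RR[i]]_n) (c : RR[i]) u : in_sub P u -> in_sub P (c *: u).
Proof. by rewrite /in_sub => Pu; rewrite -scalemxAr Pu. Qed.
Lemma in_subD n (P : 'M[RR[i]]_n) u v : in_sub P u -> in_sub P v -> in_sub P (u + v).
Proof. by rewrite /in_sub => Pu Pv; rewrite mulmxDr Pu Pv. Qed.
Lemma in_sub_proj n (P : 'M[RR[i]]_n) (a : 'cV[RR[i]]_n) : orth_proj P -> in_sub P (P *m a).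
Proof. by move=> [PP _]; rewrite /in_sub mulmxA PP. Qed.

Lemma complementary_decomposition n k (P Q : 'M[RR[i]]_n) : (k <= n)%N ->
  orth_proj P -> orth_proj Q -> \rank P = k -> \rank Q = (n - k)%N ->
  (forall u, in_sub P u -> in_sub Q u -> u = 0) ->
  forall y : 'cV[RR[i]]_n, exists u v, [/\ in_sub P u, in_sub Q v & y = u + v].
Proof.
move=> kn [PP _] [QQ _] rP rQ PQ0 y.
have sP w : (w <= P^T)%MS -> P *m w^T = w^T.
  by move=> /submxP[D ->]; rewrite trmx_mul trmxK mulmxA PP.
have sQ w : (w <= Q^T)%MS -> Q *m w^T = w^T.
  by move=> /submxP[D ->]; rewrite trmx_mul trmxK mulmxA QQ.
have cap0 : (P^T :&: Q^T)%MS = 0.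
  apply/eqP/rowV0P => w; rewrite sub_capmx => /andP[/sP wP /sQ wQ].
  by rewrite -[w]trmxK (PQ0 w^T)// trmx0.
have rk : \rank (P^T + Q^T)%MS = n.
  by rewrite mxrank_disjoint_sum// !mxrank_tr rP rQ subnKC.
have : (y^T <= P^T + Q^T)%MS by apply: submx_full; rewrite /row_full rk.
case/sub_addsmxP => -[a b] /= E.
exists (P *m a^T), (Q *m b^T); split.
- by rewrite /in_sub mulmxA PP.
- by rewrite /in_sub mulmxA QQ.
- by rewrite -[y]trmxK E linearD /= !trmx_mul !trmxK.
Qed.

(** * Compactness and uniform domination *)

(** The domain is an arbitrary space, so that the same closure properties serve on the line and on
    the space of triples (x, u, v). On the line, [mcont] unfolds to [cont_cmx]. *)
Definition ccont {T : topologicalType} (f : T -> RR[i]) : Prop :=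
  continuous (fun t => complex.Re (f t)) /\ continuous (fun t => complex.Im (f t)).

Definition mcont {T : topologicalType} {m n} (A : T -> 'M[RR[i]]_(m, n)) : Prop :=
  forall i j, ccont (fun t => A t i j).

Lemma continuousD_fun (T : topologicalType) (R : realType) (f g : T -> R) :
  continuous f -> continuous g -> continuous (fun t => f t + g t).
Proof. by move=> cf cg t; apply: cvgD; [exact: cf|exact: cg]. Qed.

Lemma continuousB_fun (T : topologicalType) (R : realType) (f g : T -> R) :
  continuous f -> continuous g -> continuous (fun t => f t - g t).
Proof. by move=> cf cg t; apply: cvgB; [exact: cf|exact: cg]. Qed.

Lemma continuousM_fun (T : topologicalType) (R : realType) (f g : T -> R) :
  continuous f -> continuous g -> continuous (fun t => f t * g t).
Proof. by move=> cf cg t; apply: cvgM; [exact: cf|exact: cg]. Qed.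

Lemma Re_add (x y : RR[i]) : complex.Re (x + y) = complex.Re x + complex.Re y.
Proof. by case: x => a b; case: y. Qed.

Lemma Im_add (x y : RR[i]) : complex.Im (x + y) = complex.Im x + complex.Im y.
Proof. by case: x => a b; case: y. Qed.

Lemma Re_mul (x y : RR[i]) :
  complex.Re (x * y) = complex.Re x * complex.Re y - complex.Im x * complex.Im y.
Proof. by case: x => a b; case: y. Qed.

Lemma Im_mul (x y : RR[i]) :
  complex.Im (x * y) = complex.Re x * complex.Im y + complex.Im x * complex.Re y.
Proof. by case: x => a b; case: y. Qed.

Lemma ccontD (T : topologicalType) (f g : T -> RR[i]) : ccont f -> ccont g ->
  ccont (fun t => f t + g t).
Proof.
move=> [f1 f2] [g1 g2]; split.
  under eq_fun do rewrite Re_add.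
  exact: (continuousD_fun f1 g1).
under eq_fun do rewrite Im_add.
exact: (continuousD_fun f2 g2).
Qed.

Lemma ccontM (T : topologicalType) (f g : T -> RR[i]) : ccont f -> ccont g ->
  ccont (fun t => f t * g t).
Proof.
move=> [f1 f2] [g1 g2]; split.
  under eq_fun do rewrite Re_mul.
  exact: (continuousB_fun (continuousM_fun f1 g1) (continuousM_fun f2 g2)).
under eq_fun do rewrite Im_mul.
exact: (continuousD_fun (continuousM_fun f1 g2) (continuousM_fun f2 g1)).
Qed.

Lemma ccont_cst (T : topologicalType) (c : RR[i]) : ccont (fun _ : T => c).
Proof. by split=> t; exact: cvg_cst. Qed.

Lemma ccont_sum (T : topologicalType) (I : Type) (r : seq I) (f : I -> T -> RR[i]) :
  (forall i, ccont (f i)) -> ccont (fun t => \sum_(i <- r) f i t).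
Proof.
move=> H; elim: r => [|i r IH].
  by under eq_fun do rewrite big_nil; exact: ccont_cst.
by under eq_fun do rewrite big_cons; exact: ccontD.
Qed.

Lemma ccont_comp (T S : topologicalType) (h : T -> S) (f : S -> RR[i]) :
  continuous h -> ccont f -> ccont (fun t => f (h t)).
Proof.
move=> ch [f1 f2]; split=> t; first exact: (continuous_comp (ch t) (f1 _)).
exact: (continuous_comp (ch t) (f2 _)).
Qed.

Lemma mcont_mul (T : topologicalType) m n p (A : T -> 'M[RR[i]]_(m, n)) (B : T -> 'M[RR[i]]_(n, p)) :
  mcont A -> mcont B -> mcont (fun t => A t *m B t).
Proof.
move=> cA cB i j.
have -> : (fun t => (A t *m B t) i j) = (fun t => \sum_k A t i k * B t k j).
  by apply: funext => t; rewrite mxE.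
by apply: ccont_sum => k; apply: ccontM.
Qed.

Lemma mcontB (T : topologicalType) m n (A B : T -> 'M[RR[i]]_(m, n)) :
  mcont A -> mcont B -> mcont (fun t => A t - B t).
Proof.
move=> cA cB i j.
have -> : (fun t => (A t - B t) i j) = (fun t => A t i j + (-1) * B t i j).
  by apply: funext => t; rewrite !mxE mulN1r.
by apply: ccontD => //; apply: ccontM => //; exact: ccont_cst.
Qed.

Lemma mcontD (T : topologicalType) m n (A B : T -> 'M[RR[i]]_(m, n)) :
  mcont A -> mcont B -> mcont (fun t => A t + B t).
Proof.
move=> cA cB i j.
have -> : (fun t => (A t + B t) i j) = (fun t => A t i j + B t i j).
  by apply: funext => t; rewrite !mxE.
exact: ccontD.
Qed.

Lemma mcont_comp (T S : topologicalType) m n (h : T -> S) (A : S -> 'M[RR[i]]_(m, n)) :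
  continuous h -> mcont A -> mcont (fun t => A (h t)).
Proof. by move=> ch cA i j; apply: (@ccont_comp _ _ h (fun s => A s i j)). Qed.

Lemma continuous_sqnorm (T : topologicalType) n (u : T -> 'cV[RR[i]]_n) :
  mcont u -> continuous (fun t => sqnorm (u t)).
Proof.
move=> cu; rewrite /sqnorm.
have -> : (fun t => \sum_i cabs (u t i 0) ^+ 2) =
    (fun t => complex.Re (\sum_i (RtoC (complex.Re (u t i 0)) * RtoC (complex.Re (u t i 0)) +
                RtoC (complex.Im (u t i 0)) * RtoC (complex.Im (u t i 0))))).
  apply: funext => t; rewrite Re_sum; apply: eq_bigr => i _.
  by rewrite sqr_cabs Re_add !Re_mul /= !mul0r !subr0 !expr2.
have R1 i : ccont (fun t => RtoC (complex.Re (u t i 0))).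
  by split; [exact: (cu i 0).1|move=> t; exact: cvg_cst].
have I1 i : ccont (fun t => RtoC (complex.Im (u t i 0))).
  by split; [exact: (cu i 0).2|move=> t; exact: cvg_cst].
have H := @ccont_sum T _ (index_enum 'I_n) (fun i t => RtoC (complex.Re (u t i 0)) * RtoC (complex.Re (u t i 0)) +
                RtoC (complex.Im (u t i 0)) * RtoC (complex.Im (u t i 0))) (fun i => ccontD (ccontM (R1 i) (R1 i)) (ccontM (I1 i) (I1 i))).
exact: H.1.
Qed.

Lemma mcont_cociter n (alpha : RR) (A : RR -> 'M[RR[i]]_n) p :
  mcont A -> mcont (cociter alpha A p).
Proof.
move=> cA; elim: p => [|p IH] /=; first by move=> i j; exact: ccont_cst.
apply: mcont_mul => //; apply: (@mcont_comp _ _ _ _ (fun x : RR => x + p%:R * alpha)) => //.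
apply: (@continuousD_fun _ RR id (fun=> p%:R * alpha)) => x; [exact: cvg_id|exact: cvg_cst].
Qed.

Lemma compact_positive (R : realType) N (S : set 'rV[R]_N) (F : 'rV[R]_N -> R) :
  closed S -> (forall r i, S r -> `|r 0 i| <= 1) -> continuous F ->
  (forall r, S r -> 0 < F r) -> exists2 m : R, 0 < m & forall r, S r -> m <= F r.
Proof.
move=> cS bS cF Fp.
have [S0|/set0P S0] := eqVneq S set0; first by exists 1 => // r; rewrite S0.
have kS : compact S.
  have kB := @rV_compact R N (fun=> `[-1, 1]%classic) (fun=> @segment_compact R (-1) 1).
  apply: subclosed_compact kB _ => // r Sr /= i.
  by rewrite in_itv /= -ler_norml; exact: bS.
have [|c cS' cmin] := @EVT_min_rV R N F S S0 kS; first exact: continuous_subspaceT.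
exists (F c); first by apply: Fp; rewrite inE in cS'.
by move=> r Sr; apply: cmin; rewrite inE.
Qed.

(** Complex columns are read off real rows, where closed bounded sets are compact. *)
Definition dec_vec {n} (v : 'rV[RR]_(n + n)) : 'cV[RR[i]]_n :=
  \col_i (v 0 (lshift n i) +i* v 0 (rshift n i)).

Definition enc_vec {n} (u : 'cV[RR[i]]_n) : 'rV[RR]_(n + n) :=
  row_mx (\row_i complex.Re (u i 0)) (\row_i complex.Im (u i 0)).

Lemma enc_vecK n (u : 'cV[RR[i]]_n) : dec_vec (enc_vec u) = u.
Proof.
apply/matrixP => i j; rewrite ord1 mxE row_mxEl row_mxEr !mxE.
by case: (u i 0).
Qed.

Lemma mcont_dec_vec (T : topologicalType) n (v : T -> 'rV[RR]_(n + n)) :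
  (forall i, continuous (fun t => v t 0 i)) -> mcont (fun t => dec_vec (v t)).
Proof.
move=> H i j; split.
  have -> : (fun t => complex.Re (dec_vec (v t) i j)) = (fun t => v t 0 (lshift n i)).
    by apply: funext => t; rewrite mxE.
  exact: H.
have -> : (fun t => complex.Im (dec_vec (v t) i j)) = (fun t => v t 0 (rshift n i)).
  by apply: funext => t; rewrite mxE.
exact: H.
Qed.

Lemma closed_preimage01 (T : topologicalType) (R : realType) (f : T -> R) :
  continuous f -> closed [set t | 0 <= f t <= 1].
Proof.
move=> cf; have -> : [set t | 0 <= f t <= 1] = f @^-1` `[0, 1]%classic.
  by apply/seteqP; split=> t /=; rewrite in_itv.
by apply: closed_comp => [t _|]; [exact: cf|exact: interval_closed].
Qed.

Lemma closed_preimage0 (T : topologicalType) (R : realType) (f : T -> R) :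
  continuous f -> closed [set t | f t = 0].
Proof.
by move=> cf; apply: (@closed_comp _ _ f [set y : R | y = 0]) => [t _|]; [exact: cf|exact: closed_eq].
Qed.

(** The constraint is the vanishing of one function G, hence closed. Continuity is required along
    all continuous families, so that it can be instantiated with the real coordinates of (x, u,
    v). *)
Lemma compact_positive_pair n (G F : RR -> 'cV[RR[i]]_n -> 'cV[RR[i]]_n -> RR) :
  (forall (T : topologicalType) (x : T -> RR) (u v : T -> 'cV[RR[i]]_n),
     continuous x -> mcont u -> mcont v ->
     continuous (fun t => G (x t) (u t) (v t)) /\ continuous (fun t => F (x t) (u t) (v t))) ->
  (forall x u v, G x u v = 0 -> sqnorm u <= 1 /\ sqnorm v <= 1) ->
  (forall x u v, G x u v = 0 -> 0 < F x u v) ->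
  exists2 m : RR, 0 < m & forall x u v, 0 <= x <= 1 -> G x u v = 0 -> m <= F x u v.
Proof.
move=> cFG bG pF.
pose X (r : 'rV[RR]_(1 + ((n + n) + (n + n)))) : RR := r 0 (lshift _ 0).
pose U (r : 'rV[RR]_(1 + ((n + n) + (n + n)))) := dec_vec (\row_i r 0 (rshift 1 (lshift _ i))).
pose V (r : 'rV[RR]_(1 + ((n + n) + (n + n)))) := dec_vec (\row_i r 0 (rshift 1 (rshift _ i))).
have cX : continuous X by move=> r; exact: coord_continuous.
have cU : mcont U.
  apply: mcont_dec_vec => i.
  have -> : (fun t : 'rV[RR]_(1 + ((n + n) + (n + n))) => (\row_i0 t 0 (rshift 1 (lshift _ i0))) 0 i) =
     (fun t => t 0 (rshift 1 (lshift _ i))) by apply: funext => t; rewrite mxE.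
  by move=> r; exact: coord_continuous.
have cV : mcont V.
  apply: mcont_dec_vec => i.
  have -> : (fun t : 'rV[RR]_(1 + ((n + n) + (n + n))) => (\row_i0 t 0 (rshift 1 (rshift _ i0))) 0 i) =
     (fun t => t 0 (rshift 1 (rshift _ i))) by apply: funext => t; rewrite mxE.
  by move=> r; exact: coord_continuous.
have [cG cF] := cFG _ X U V cX cU cV.
pose S := [set r : 'rV[RR]_(1 + ((n + n) + (n + n))) | 0 <= X r <= 1 /\ G (X r) (U r) (V r) = 0].
have [||||m m0 Hm] := @compact_positive RR _ S (fun r => F (X r) (U r) (V r)).
- apply: closedI; first exact: (closed_preimage01 cX).
  exact: (closed_preimage0 cG).
- move=> r i [xr Gr]; have [Ub Vb] := bG _ _ _ Gr.
  have H (u : 'cV[RR[i]]_n) k : sqnorm u <= 1 -> cabs (u k 0) <= 1.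
    move=> u1; rewrite -(@ler_pXn2r _ 2) ?nnegrE ?cabs_ge0 ?ler01// expr1n.
    apply: le_trans u1; rewrite /sqnorm (bigD1 k)//= lerDl.
    by apply: sumr_ge0 => l _; exact: sqr_ge0.
  case: (split_ordP i) => [k ->|k ->].
    by rewrite (ord1 k) -/(X r) ger0_norm; case/andP: xr.
  case: (split_ordP k) => [k1 ->|k1 ->].
    case: (split_ordP k1) => [k2 ->|k2 ->].
      by apply: le_trans (H _ k2 Ub); apply: le_trans (Re_le_cabs _); rewrite !mxE /= ?mxE.
    by apply: le_trans (H _ k2 Ub); apply: le_trans (Im_le_cabs _); rewrite !mxE /= ?mxE.
  case: (split_ordP k1) => [k2 ->|k2 ->].
    by apply: le_trans (H _ k2 Vb); apply: le_trans (Re_le_cabs _); rewrite !mxE /= ?mxE.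
  by apply: le_trans (H _ k2 Vb); apply: le_trans (Im_le_cabs _); rewrite !mxE /= ?mxE.
- exact: cF.
- by move=> r [_ Gr]; exact: pF.
exists m => // x u v x01 Guv.
pose r := row_mx (\row_(_ < 1) x) (row_mx (enc_vec u) (enc_vec v)).
have Xr : X r = x by rewrite /X /r row_mxEl mxE.
have Ur : U r = u.
  rewrite -[RHS]enc_vecK; congr dec_vec; apply/matrixP => i j.
  by rewrite mxE ord1 /r row_mxEr row_mxEl.
have Vr : V r = v.
  rewrite -[RHS]enc_vecK; congr dec_vec; apply/matrixP => i j.
  by rewrite mxE ord1 /r row_mxEr row_mxEr.
by have := Hm r; rewrite /S /= Xr Ur Vr; apply.
Qed.

(** Compactness turns the strict inequality on unit vectors into a gap m between the squared norms,
    and the bound G turns the gap into a ratio q < 1. The homogeneous form without division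
    multiplies along iterates. *)
Lemma dominated_uniform n (alpha : RR) (A Pp Pm : RR -> 'M[RR[i]]_n) (N : nat) (G : RR) :
  mcont A -> periodic1 A -> mcont Pp -> mcont Pm -> periodic1 Pp -> periodic1 Pm ->
  (forall x (u : 'cV_n), sqnorm (cociter alpha A N x *m u) <= G * sqnorm u) ->
  (forall x u u', in_sub (Pp x) u -> in_sub (Pm x) u' -> vnorm u = 1 -> vnorm u' = 1 ->
     vnorm (cociter alpha A N x *m u') < vnorm (cociter alpha A N x *m u)) ->
  exists2 q : RR, 0 <= q < 1 & forall x u u', in_sub (Pp x) u -> in_sub (Pm x) u' ->
    sqnorm (cociter alpha A N x *m u') * sqnorm u <= q * (sqnorm (cociter alpha A N x *m u) * sqnorm u').
Proof.
move=> cA pA cPp cPm pPp pPm HG H.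
have cB := mcont_cociter alpha N cA.
set B := cociter alpha A N in HG H cB *.
have pB : periodic1 B.
  move=> x; rewrite /B; elim: (N) => [//|p IH] /=.
  by rewrite IH addrAC pA.
(* All terms are nonnegative, so the single equation g = 0 expresses membership in both bundles and
   both normalizations. *)
pose g (x : RR) (u v : 'cV[RR[i]]_n) := sqnorm (Pp x *m u - u) + sqnorm (Pm x *m v - v) +
   ((sqnorm u - 1) * (sqnorm u - 1) + (sqnorm v - 1) * (sqnorm v - 1)).
have sq0 (y : RR) : 0 <= y * y by rewrite -expr2 sqr_ge0.
have gP x u v : g x u v = 0 ->
   [/\ in_sub (Pp x) u, in_sub (Pm x) v, sqnorm u = 1 & sqnorm v = 1].
  move=> g0; have h1 := sqnorm_ge0 (Pp x *m u - u); have h2 := sqnorm_ge0 (Pm x *m v - v).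
  have h3 := sq0 (sqnorm u - 1); have h4 := sq0 (sqnorm v - 1).
  rewrite /g in g0; split.
  - by apply/subr0_eq/sqnorm_eq0; lra.
  - by apply/subr0_eq/sqnorm_eq0; lra.
  - have /eqP : (sqnorm u - 1) * (sqnorm u - 1) = 0 by lra.
    by rewrite mulf_eq0 orbb subr_eq0 => /eqP.
  - have /eqP : (sqnorm v - 1) * (sqnorm v - 1) = 0 by lra.
    by rewrite mulf_eq0 orbb subr_eq0 => /eqP.
have gP' x u v : in_sub (Pp x) u -> in_sub (Pm x) v -> sqnorm u = 1 -> sqnorm v = 1 -> g x u v = 0.
  rewrite /in_sub /g => -> -> -> ->; rewrite !subrr.
  by rewrite sqnorm0 !mul0r !addr0.
have [|||m m0 Hm] := @compact_positive_pair n g (fun x u v => sqnorm (B x *m u) - sqnorm (B x *m v)).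
- move=> T x u v cx cu cv; split; last first.
    apply: continuousB_fun; apply: continuous_sqnorm; apply: mcont_mul => //; exact: mcont_comp.
  have c1 : continuous (fun _ : T => 1 : RR) by move=> t; exact: cvg_cst.
  have e1 := continuousB_fun (continuous_sqnorm cu) c1.
  have e2 := continuousB_fun (continuous_sqnorm cv) c1.
  apply: continuousD_fun; apply: continuousD_fun; try exact: continuousM_fun.
    by apply: continuous_sqnorm; apply: mcontB => //; apply: mcont_mul => //; exact: mcont_comp.
  by apply: continuous_sqnorm; apply: mcontB => //; apply: mcont_mul => //; exact: mcont_comp.
- by move=> x u v /gP[_ _ -> ->].
- move=> x u v /gP[Pu Pv u1 v1].
  have := H x u v Pu Pv; rewrite !vnormE u1 v1 sqrtr1 => /(_ erefl erefl) h.
  rewrite subr_gt0 ltNge; apply/negP => h'.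
  by move: h; rewrite ltNge => /negP; apply; exact: ler_wsqrtr.
have Hm' x u v : in_sub (Pp x) u -> in_sub (Pm x) v -> sqnorm u = 1 -> sqnorm v = 1 ->
    m <= sqnorm (B x *m u) - sqnorm (B x *m v).
  have [z [y /andP[y0 y1] ->]] := floor_decomp x.
  rewrite !(periodic1_int _ _ pPp) !(periodic1_int _ _ pPm) !(periodic1_int _ _ pB).
  by move=> *; apply: Hm; [rewrite y0 ltW|exact: gP'].
(* If 0 <= a <= |G| then a - m <= q a; the summand m in the denominator keeps q nonnegative. *)
pose q := 1 - m / (`|G| + m).
have Gm : 0 < `|G| + m by rewrite ltr_wpDl.
have q01 : 0 <= q < 1.
  rewrite /q subr_ge0 ler_pdivrMr// mul1r lerDr normr_ge0 /=.
  by rewrite ltrBlDr ltrDl divr_gt0.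
exists q => // x u v Pu Pv.
have [u0|un0] := eqVneq (sqnorm u) 0.
  rewrite u0 mulr0; case/andP: q01 => q0 _.
  by rewrite !mulr_ge0 ?sqnorm_ge0.
have [v0|vn0] := eqVneq (sqnorm v) 0.
  by rewrite v0 (sqnorm_eq0 v0) mulmx0 sqnorm0 mul0r !mulr0.
have up : 0 < sqnorm u by rewrite lt_neqAle eq_sym un0 sqnorm_ge0.
have vp : 0 < sqnorm v by rewrite lt_neqAle eq_sym vn0 sqnorm_ge0.
pose a := (Num.sqrt (sqnorm u))^-1; pose b := (Num.sqrt (sqnorm v))^-1.
have a2 : a ^+ 2 * sqnorm u = 1 by rewrite /a exprVn sqr_sqrtr ?(ltW up)// mulVf.
have b2 : b ^+ 2 * sqnorm v = 1 by rewrite /b exprVn sqr_sqrtr ?(ltW vp)// mulVf.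
have := Hm' x (RtoC a *: u) (RtoC b *: v) (in_subZ _ Pu) (in_subZ _ Pv).
rewrite -!scalemxAr !sqnormZ a2 b2 => /(_ erefl erefl) K.
have := HG x u; set s := sqnorm (B x *m u) in K *; set t := sqnorm (B x *m v) in K *.
move=> sG.
have aG : a ^+ 2 * s <= `|G|.
  apply: (@le_trans _ _ (a ^+ 2 * (G * sqnorm u))); first by rewrite ler_wpM2l ?sqr_ge0.
  by rewrite mulrCA a2 mulr1 ler_norm.
have K2 : b ^+ 2 * t <= q * (a ^+ 2 * s).
  apply: (@le_trans _ _ (a ^+ 2 * s - m)); first lra.
  rewrite /q mulrBl mul1r lerD2l lerN2.
  rewrite -[X in _ <= X]mulr1 -mulrA ler_wpM2l ?(ltW m0)//.
  by rewrite mulrC ler_pdivrMr// mul1r; apply: le_trans aG _; rewrite lerDl ltW.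
have P : 0 < sqnorm u * sqnorm v by rewrite mulr_gt0.
have := ler_wpM2l (ltW P) K2.
have -> : sqnorm u * sqnorm v * (b ^+ 2 * t) = (b ^+ 2 * sqnorm v) * (t * sqnorm u) by ring.
have -> : sqnorm u * sqnorm v * (q * (a ^+ 2 * s)) = (a ^+ 2 * sqnorm u) * (q * (s * sqnorm v)) by ring.
by rewrite a2 b2 !mul1r.
Qed.

(** Compactness again: the bundles meet only at 0 over each point of the circle, so their angle is
    bounded below. *)
Lemma splitting_angle n (Pp Pm : RR -> 'M[RR[i]]_n) :
  mcont Pp -> mcont Pm -> periodic1 Pp -> periodic1 Pm ->
  (forall x u, in_sub (Pp x) u -> in_sub (Pm x) u -> u = 0) ->
  exists2 c : RR, 0 < c & forall x u v, in_sub (Pp x) u -> in_sub (Pm x) v ->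
    sqnorm u + sqnorm v <= c * sqnorm (u + v).
Proof.
move=> cPp cPm pPp pPm H.
have sq0 (y : RR) : 0 <= y * y by rewrite -expr2 sqr_ge0.
pose g (x : RR) (u v : 'cV[RR[i]]_n) := sqnorm (Pp x *m u - u) + sqnorm (Pm x *m v - v) +
   (sqnorm u + sqnorm v - 1) * (sqnorm u + sqnorm v - 1).
have gP x u v : g x u v = 0 ->
   [/\ in_sub (Pp x) u, in_sub (Pm x) v & sqnorm u + sqnorm v = 1].
  move=> g0; have h1 := sqnorm_ge0 (Pp x *m u - u); have h2 := sqnorm_ge0 (Pm x *m v - v).
  have h3 := sq0 (sqnorm u + sqnorm v - 1).
  rewrite /g in g0; split.
  - by apply/subr0_eq/sqnorm_eq0; lra.
  - by apply/subr0_eq/sqnorm_eq0; lra.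
  - have /eqP : (sqnorm u + sqnorm v - 1) * (sqnorm u + sqnorm v - 1) = 0 by lra.
    by rewrite mulf_eq0 orbb subr_eq0 => /eqP.
have gP' x u v : in_sub (Pp x) u -> in_sub (Pm x) v -> sqnorm u + sqnorm v = 1 -> g x u v = 0.
  by rewrite /in_sub /g => -> -> ->; rewrite !subrr sqnorm0 mul0r !addr0.
have [|||m m0 Hm] := @compact_positive_pair n g (fun x u v => sqnorm (u + v)).
- move=> T x u v cx cu cv; split; last by apply: continuous_sqnorm; exact: mcontD.
  have c1 : continuous (fun _ : T => 1 : RR) by move=> t; exact: cvg_cst.
  have e1 := continuousB_fun (continuousD_fun (continuous_sqnorm cu) (continuous_sqnorm cv)) c1.
  apply: continuousD_fun; last exact: continuousM_fun.
  by apply: continuousD_fun; apply: continuous_sqnorm; apply: mcontB => //; apply: mcont_mul => //; exact: mcont_comp.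
- move=> x u v /gP[_ _ uv]; have := sqnorm_ge0 u; have := sqnorm_ge0 v.
  by move=> *; split; lra.
- move=> x u v /gP[Pu Pv uv1].
  rewrite lt_neqAle sqnorm_ge0 andbT eq_sym; apply/eqP => /sqnorm_eq0 uv.
  have uE : u = - v by apply/eqP; rewrite -subr_eq0 opprK uv.
  have u0 : u = 0.
    apply: (H x) => //; rewrite uE -scaleN1r; exact: in_subZ.
  have v0 : v = 0 by move: uE; rewrite u0 => /eqP; rewrite eq_sym oppr_eq0 => /eqP.
  by move: uv1; rewrite u0 v0 sqnorm0 addr0 => /eqP; rewrite eq_sym oner_eq0.
have Hm' x u v : in_sub (Pp x) u -> in_sub (Pm x) v -> sqnorm u + sqnorm v = 1 ->
    m <= sqnorm (u + v).
  have [z [y /andP[y0 y1] ->]] := floor_decomp x.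
  rewrite !(periodic1_int _ _ pPp) !(periodic1_int _ _ pPm).
  by move=> *; apply: (Hm y); [rewrite y0 ltW|exact: gP'].
exists m^-1; first by rewrite invr_gt0.
move=> x u v Pu Pv; have s0 : 0 <= sqnorm u + sqnorm v by rewrite addr_ge0 ?sqnorm_ge0.
have [E|N0] := eqVneq (sqnorm u + sqnorm v) 0.
  by rewrite E mulr_ge0 ?invr_ge0 ?sqnorm_ge0// ltW.
have sp : 0 < sqnorm u + sqnorm v by rewrite lt_neqAle eq_sym N0.
pose a := (Num.sqrt (sqnorm u + sqnorm v))^-1.
have a2 : a ^+ 2 * (sqnorm u + sqnorm v) = 1 by rewrite /a exprVn sqr_sqrtr// mulVf.
have := Hm' x (RtoC a *: u) (RtoC a *: v) (in_subZ _ Pu) (in_subZ _ Pv).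
rewrite -scalerDr !sqnormZ -mulrDr a2 => /(_ erefl) K.
rewrite mulrC ler_pdivlMr//.
have := ler_wpM2l s0 K; rewrite mulrA [_ * a ^+ 2]mulrC a2 mul1r; exact.
Qed.

(** * Domination excludes decaying planes *)

Lemma mxnorm_le_of_sqnorm n m (u : 'cV[RR[i]]_n) (v : 'cV[RR[i]]_m) (e : RR) : 0 <= e ->
  n%:R ^+ 2 * sqnorm u <= e ^+ 2 * sqnorm v -> mxnorm u <= e * mxnorm v.
Proof.
move=> e0 H; rewrite -(@ler_pXn2r _ 2) ?nnegrE ?mulr_ge0 ?mxnorm_ge0//.
apply: le_trans (mxnorm_le_sqnorm u) _; apply: le_trans H _.
by rewrite exprMn ler_wpM2l ?sqr_ge0// sqnorm_le_mxnorm.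
Qed.

Lemma rank_basis_complement n k (Z : 'M[RR[i]]_(n, k)) (P : 'M[RR[i]]_n) :
  (forall c : 'cV_k, in_sub P (Z *m c) -> c = 0) -> orth_proj P ->
  \rank (row_mx Z P) = (k + \rank P)%N.
Proof.
move=> ZP [PP _].
have Zi (c : 'cV_k) : Z *m c = 0 -> c = 0.
  by move=> Zc; apply: ZP; rewrite /in_sub Zc mulmx0.
rewrite -mxrank_tr tr_row_mx -addsmxE mxrank_disjoint_sum.
  rewrite !mxrank_tr; congr addn; rewrite -mxrank_tr; apply/eqP.
  rewrite -[_ == _]/(row_free _) -kermx_eq0; apply/eqP/row_matrixP => i.
  rewrite row0; apply: (can_inj trmxK); rewrite trmx0; apply: Zi.
  have /sub_kermxP := row_sub i (kermx Z^T).
  by move=> /(congr1 trmx); rewrite trmx_mul trmxK trmx0.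
apply/eqP/rowV0P => w; rewrite sub_capmx => /andP[/submxP[a Ea] /submxP[b Eb]].
have Ea' : w^T = Z *m a^T by rewrite Ea trmx_mul trmxK.
have Eb' : w^T = P *m b^T by rewrite Eb trmx_mul trmxK.
have a0 : a^T = 0.
  by apply: ZP; rewrite /in_sub -Ea' Eb' mulmxA PP.
by apply: (can_inj trmxK); rewrite Ea' a0 mulmx0 trmx0.
Qed.

Lemma mxnorm_mul_bound (n p : nat) (alpha L : RR) (A : RR -> 'M[RR[i]]_n) x :
  (forall x, mxnorm (A x) <= L) -> mxnorm (cociter alpha A p x) <= L ^+ p * n%:R.
Proof.
move=> HL; have L0 : 0 <= L := le_trans (mxnorm_ge0 _) (HL 0).
elim: p => [|p IH] /=.
  rewrite expr0 mul1r /mxnorm -[X in _ <= X%:R]card_ord -sumr_const.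
  apply: ler_sum => i _; rewrite (bigD1 i)//= mxE eqxx cabs1 big1 ?addr0// => j ji.
  by rewrite mxE eq_sym (negbTE ji) cabs0.
apply: le_trans (mxnormM _ _) _; rewrite exprS -mulrA.
by apply: ler_pM; rewrite ?mxnorm_ge0.
Qed.

(** The dominant bundle has dimension d + 1, so the inverse of the iterate B does not contract all
    of its image: some u in it is expanded by B at most by a fixed factor c. Domination compares
    every vector of the other bundle with this u and gains q^k. *)
Lemma dominated_stable_contraction (d : nat) (alpha L : RR) (A Pp Pm : RR -> 'M[RR[i]]_(d + d))
    (W : 'M[RR[i]]_(d + d)) (N : nat) :
  mcont A -> periodic1 A -> (forall x, mxnorm (A x) <= L) ->
  W \in unitmx -> (forall x, adjmx (A x) *m W *m A x = W) ->
  mcont Pp -> mcont Pm -> periodic1 Pp -> periodic1 Pm ->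
  (forall x, orth_proj (Pp x)) -> (forall x, \rank (Pp x) = d.+1) ->
  Defs.invariant alpha A Pp -> Defs.invariant alpha A Pm ->
  (forall x u u', in_sub (Pp x) u -> in_sub (Pm x) u' -> vnorm u = 1 -> vnorm u' = 1 ->
     vnorm (cociter alpha A N x *m u') < vnorm (cociter alpha A N x *m u)) ->
  forall e : RR, 0 < e -> exists k0, forall k x v, (k0 <= k)%N -> in_sub (Pm x) v ->
    mxnorm (cociter alpha A (k * N) x *m v) <= e * mxnorm v.
Proof.
move=> cA pA HL Wu AW cPp cPm pPp pPm oPp rPp iPp iPm dom e e0.
pose G := (L ^+ N * (d + d)%:R) ^+ 2 * (d + d)%:R ^+ 2.
have HG x (u : 'cV_(d + d)) : sqnorm (cociter alpha A N x *m u) <= G * sqnorm u.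
  apply: le_trans (sqnorm_le_mxnorm _) _.
  apply: (@le_trans _ _ ((L ^+ N * (d + d)%:R * mxnorm u) ^+ 2)).
    apply: lerXn2r; rewrite ?nnegrE ?mxnorm_ge0//.
      apply: mulr_ge0; last exact: mxnorm_ge0.
      exact: le_trans (mxnorm_ge0 _) (mxnorm_mul_bound N alpha 0 HL).
    apply: le_trans (mxnormM _ _) _; rewrite ler_wpM2r ?mxnorm_ge0//.
    exact: mxnorm_mul_bound.
  by rewrite exprMn /G -mulrA ler_wpM2l ?sqr_ge0// mxnorm_le_sqnorm.
have [q /andP[q0 q1] Hq] := dominated_uniform cA pA cPp cPm pPp pPm HG dom.
have Hk k x u u' : in_sub (Pp x) u -> in_sub (Pm x) u' ->
    sqnorm (cociter alpha A (k * N) x *m u') * sqnorm u <=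
    q ^+ k * (sqnorm (cociter alpha A (k * N) x *m u) * sqnorm u').
  move=> Pu Pu'; elim: k => [|k IH]; first by rewrite mul0n /= expr0 !mul1mx mul1r mulrC.
  rewrite mulSn cociterD -!mulmxA; set y := x + (k * N)%:R * alpha.
  have H1 := Hq y _ _ (invariant_cociter (k * N) iPp Pu) (invariant_cociter (k * N) iPm Pu').
  set u1 := cociter alpha A (k * N) x *m u in IH H1 *.
  set v1 := cociter alpha A (k * N) x *m u' in IH H1 *.
  set B := cociter alpha A N y in H1 *.
  have [u10|u1n] := eqVneq (sqnorm u1) 0.
    have Bu := symplectic_unitmx Wu (cociter_symplectic alpha (k * N) x AW).
    have u0 : u = 0.
      by rewrite -[u](mulKmx Bu) -/u1 (sqnorm_eq0 u10) mulmx0.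
    by rewrite u0 sqnorm0 mulr0 ?mulr_ge0 ?sqnorm_ge0 ?exprn_ge0.
  have u1p : 0 < sqnorm u1 by rewrite lt_neqAle eq_sym u1n sqnorm_ge0.
  rewrite -(ler_pM2l u1p).
  have A1 := ler_wpM2r (sqnorm_ge0 u) H1.
  have A2 := ler_wpM2l (mulr_ge0 q0 (sqnorm_ge0 (B *m u1))) IH.
  rewrite exprS; lra.
have [c c0 Hc] := symplectic_not_contracting Wu.
pose n2 : RR := (d + d)%:R ^+ 2.
have n20 : 0 <= n2 by rewrite exprn_ge0 ?ler0n.
pose D := n2 * (c ^+ 2 * n2) + 1.
have D0 : 0 < D by rewrite ltr_wpDl// (mulr_ge0 n20 (mulr_ge0 (sqr_ge0 c) n20)).
have eD : 0 < e ^+ 2 / D by rewrite divr_gt0 ?exprn_gt0.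
have [k0 Hk0] := exprn_eventually_lt q0 q1 eD.
exists k0 => k x v k0k Pv.
set B := cociter alpha A (k * N) x.
have BW := cociter_symplectic alpha (k * N) x AW.
have Bu := symplectic_unitmx Wu BW.
have [|a [Ba0 Ba]] := Hc _ (invmx B) (B *m Pp x) (symplectic_invmx Wu BW).
  by rewrite -mxrank_tr trmx_mul mxrankMfree ?mxrank_tr ?rPp// row_free_unit unitmx_tr.
rewrite -mulmxA mulKmx// in Ba0 Ba; set u := Pp x *m a in Ba0 Ba.
have Pu : in_sub (Pp x) u by exact: in_sub_proj.
have up : 0 < sqnorm u.
  rewrite lt_neqAle sqnorm_ge0 andbT eq_sym; apply: contra Ba0 => /eqP /sqnorm_eq0 ->.
  by rewrite mulmx0.
have F1 : sqnorm (B *m u) <= c ^+ 2 * n2 * sqnorm u.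
  apply: le_trans (sqnorm_le_mxnorm _) _; rewrite -mulrA.
  apply: (@le_trans _ _ ((c * mxnorm u) ^+ 2)).
    by apply: lerXn2r; rewrite ?nnegrE ?mulr_ge0 ?mxnorm_ge0 ?(ltW c0).
  by rewrite exprMn ler_wpM2l ?sqr_ge0// mxnorm_le_sqnorm.
have F2 := Hk k x u v Pu Pv; rewrite -/B in F2.
have qk0 : 0 <= q ^+ k by rewrite exprn_ge0.
have v0 := sqnorm_ge0 v.
have F3 : sqnorm (B *m v) <= q ^+ k * (c ^+ 2 * n2 * sqnorm v).
  rewrite -(ler_pM2r up); apply: le_trans F2 _.
  have -> : q ^+ k * (c ^+ 2 * n2 * sqnorm v) * sqnorm u =
     q ^+ k * (c ^+ 2 * n2 * sqnorm u * sqnorm v) by ring.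
  by rewrite ler_wpM2l// ler_wpM2r.
apply: mxnorm_le_of_sqnorm; first exact: ltW.
apply: (@le_trans _ _ (n2 * (q ^+ k * (c ^+ 2 * n2 * sqnorm v)))).
  by rewrite ler_wpM2l.
have -> : n2 * (q ^+ k * (c ^+ 2 * n2 * sqnorm v)) = (q ^+ k * (n2 * (c ^+ 2 * n2))) * sqnorm v by ring.
rewrite ler_wpM2r//.
have F4 : q ^+ k * D <= e ^+ 2.
  by rewrite -ler_pdivlMr// ltW// Hk0.
by apply: le_trans F4; rewrite ler_wpM2l// /D lerDl.
Qed.

(** A vector of the plane is decomposed along the splitting at time - k N, when it was no longer
    than at time 0. Its subdominant part is contracted on the way, so at time 0 the plane is close
    to the dominant bundle, hence transverse to the other one with an angle that does not depend on
    k. *)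
Lemma dominated_no_decaying_plane (d : nat) (alpha L : RR) (A : RR -> 'M[RR[i]]_(d + d))
    (W : 'M[RR[i]]_(d + d)) :
  mcont A -> periodic1 A -> (forall x, mxnorm (A x) <= L) ->
  W \in unitmx -> (forall x, adjmx (A x) *m W *m A x = W) ->
  dominated alpha A d.+1 ->
  exists2 N : nat, (0 < N)%N & exists2 e : RR, 0 < e & exists k0 : nat,
    forall k (X Z : 'M[RR[i]]_(d + d, 2)), (k0 <= k)%N ->
      cociter alpha A (k * N) (- ((k * N)%:R * alpha)) *m X = Z ->
      (forall c : 'cV_2, c != 0 -> Z *m c != 0) ->
      (forall c : 'cV_2, mxnorm (X *m c) <= mxnorm (Z *m c)) ->
      (forall c : 'cV_2, mxnorm (cociter alpha A (k * N) 0 *m (Z *m c)) <= e * mxnorm (Z *m c)) ->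
      False.
Proof.
move=> cA pA HL Wu AW [Pp [Pm [cPp [cPm [pPp [pPm [oP [rP [cap [iPp [iPm [N [N1 dom]]]]]]]]]]]]].
have {}N1 : (0 < N)%N by [].
have dd : (d.+1 <= d + d)%N by rewrite -(rP 0).1 rank_leq_col.
have oPp x := (oP x).1; have oPm x := (oP x).2.
have rPp x := (rP x).1; have rPm x := (rP x).2.
have [c c0 Hc] := splitting_angle cPp cPm pPp pPm cap.
have [g g0 Hg] := symplectic_not_contracting Wu.
pose n2 : RR := (d + d)%:R ^+ 2.
have n20 : 0 <= n2 by rewrite exprn_ge0 ?ler0n.
pose C := n2 * c + 1.
have nc0 : 0 <= n2 * c by rewrite mulr_ge0// ltW.
have C1 : 1 <= C by rewrite lerDr.
have C0 : 0 < C := lt_le_trans ltr01 C1.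
have CC : n2 * c <= C ^+ 2.
  have := ler_pM ler01 ler01 C1 C1; rewrite expr2 /C; nra.
have Hp x u v : in_sub (Pp x) u -> in_sub (Pm x) v ->
    mxnorm u <= C * mxnorm (u + v) /\ mxnorm v <= C * mxnorm (u + v).
  move=> Pu Pv; have h := Hc x u v Pu Pv; have u0 := sqnorm_ge0 u; have v0 := sqnorm_ge0 v.
  have s0 := sqnorm_ge0 (u + v).
  have K : n2 * (c * sqnorm (u + v)) <= C ^+ 2 * sqnorm (u + v) by rewrite mulrA ler_wpM2r.
  split; apply: mxnorm_le_of_sqnorm; rewrite ?(ltW C0)//; apply: le_trans K;
    rewrite ler_wpM2l//; lra.
(* C is the angle constant and g the non-contraction constant. This e gives e C <= 1 / 2 in the
   transversality estimate, and makes the contraction factor e (4 C + 1) of the sum smaller than 1 /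
   g. *)
pose e := (2 * C * (g + 1) * (4 * C + 1))^-1.
have eD : 0 < 2 * C * (g + 1) * (4 * C + 1).
  by rewrite !mulr_gt0 ?ltr0n// addr_gt0// mulr_gt0.
have e0 : 0 < e by rewrite invr_gt0.
have eE : e * (2 * C * (g + 1) * (4 * C + 1)) = 1 by rewrite mulVf// gt_eqF.
have [k0 Hk0] := dominated_stable_contraction cA pA HL Wu AW cPp cPm pPp pPm oPp rPp iPp iPm dom e0.
exists N => //; exists e => //; exists k0 => k X Z k0k XZ Z0 XZn Ze.
set x := - ((k * N)%:R * alpha) in XZ.
have dec (a : 'cV_2) : exists p m, [/\ in_sub (Pp 0) p, in_sub (Pm 0) m, Z *m a = p + m &
    mxnorm m <= e * C * mxnorm (Z *m a)].
  have [p [m [Pp' Pm' E]]] := complementary_decomposition dd (oPp x) (oPm x) (rPp x) (rPm x) (cap x) (X *m a).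
  exists (cociter alpha A (k * N) x *m p), (cociter alpha A (k * N) x *m m).
  have x0 : x + (k * N)%:R * alpha = 0 by rewrite /x addNr.
  split.
  - by rewrite -x0; exact: invariant_cociter.
  - by rewrite -x0; exact: invariant_cociter.
  - by rewrite -mulmxDr -E mulmxA XZ.
  apply: le_trans (Hk0 k x m k0k Pm') _; rewrite -mulrA ler_wpM2l ?(ltW e0)//.
  have [_ h] := Hp x p m Pp' Pm'; apply: le_trans h _.
  by rewrite -E ler_wpM2l ?(ltW C0).
have eC : e * C <= 1 / 2.
  move: eE; have : 0 < e * C by rewrite mulr_gt0.
  set y := e * C => y0; have -> : e * (2 * C * (g + 1) * (4 * C + 1)) = 2 * y * ((g + 1) * (4 * C + 1)) by rewrite /y; ring.
  have : 1 <= (g + 1) * (4 * C + 1).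
    by rewrite -[X in X <= _]mulr1; apply: ler_pM => //; lra.
  move=> h E; have := ler_wpM2l (ltW y0) h; lra.
(* Adding a subdominant s leaves the dominant component p unchanged, and p carries at least half of
   Z a. *)
have est (a : 'cV_2) (s : 'cV_(d + d)) : in_sub (Pm 0) s ->
    mxnorm (Z *m a) <= 2 * C * mxnorm (Z *m a + s).
  move=> Ps; have [p [m [Pp' Pm' E mE]]] := dec a.
  have [h _] := Hp 0 p (m + s) Pp' (in_subD Pm' Ps).
  rewrite addrA -E in h.
  have h1 : mxnorm (Z *m a) <= mxnorm p + mxnorm m by rewrite {1}E mxnormD.
  have h2 := ler_wpM2r (mxnorm_ge0 (Z *m a)) eC.
  have h3 := mxnorm_ge0 (Z *m a); lra.
have ZP (a : 'cV_2) : in_sub (Pm 0) (Z *m a) -> a = 0.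
  move=> Pa; apply/eqP; apply: contraT => /Z0; rewrite -mxnorm_gt0 => Zp.
  have := est a (- (Z *m a)); rewrite subrr mxnorm0 mulr0 leNgt Zp; apply.
  by rewrite -scaleN1r; exact: in_subZ.
have rk : (d < \rank (row_mx Z (Pm 0%R)))%N.
  by rewrite (rank_basis_complement ZP (oPm 0)) rPm; move: dd; clear; lia.
have BW := cociter_symplectic alpha (k * N) 0 AW.
have [ab [w0 wE]] := Hg _ _ _ BW rk.
rewrite -[ab]vsubmxK mul_row_col in w0 wE.
set v := Z *m _ in w0 wE; set s := Pm 0 *m _ in w0 wE.
have Ps : in_sub (Pm 0) s by exact: in_sub_proj.
have h1 := est (usubmx ab) s Ps; rewrite -/v in h1.
have h2 := Ze (usubmx ab); rewrite -/v in h2.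
have h3 := Hk0 k 0 s k0k Ps.
have h4 : mxnorm s <= mxnorm (v + s) + mxnorm v.
  have E4 : s = (v + s) - v by rewrite [v + s]addrC addrK.
  by rewrite {1}E4 mxnormB.
have wp : 0 < mxnorm (v + s) by rewrite mxnorm_gt0.
have h5 : mxnorm (cociter alpha A (k * N) 0 *m (v + s)) <= e * mxnorm v + e * mxnorm s.
  by rewrite mulmxDr; apply: le_trans (mxnormD _ _) _; exact: lerD.
have h6 : e * mxnorm v + e * mxnorm s <= e * (4 * C + 1) * mxnorm (v + s).
  rewrite -mulrDr -[X in _ <= X]mulrA; apply: (ler_wpM2l (ltW e0)); move: h1 h4; clear; lra.
have h7 := le_trans wE (ler_wpM2l (ltW g0) (le_trans h5 h6)).
set y := e * (4 * C + 1) in h7.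
have y0 : 0 <= y := mulr_ge0 (ltW e0) (addr_ge0 (mulr_ge0 (ler0n _ 4) (ltW C0)) ler01).
have g1 : 0 <= (g + 1) * y := mulr_ge0 (addr_ge0 (ltW g0) ler01) y0.
have h8 : 2 * ((g + 1) * y) <= 1.
  rewrite -[X in _ <= X]eE.
  have -> : e * (2 * C * (g + 1) * (4 * C + 1)) = 2 * (C * ((g + 1) * y)) by rewrite /y; ring.
  by apply: ler_wpM2l; [rewrite ler0n|rewrite -[X in X <= _]mul1r ler_wpM2r].
have h9 := ler_wpM2r (ltW wp) h8.
have h10 : 0 <= y * mxnorm (v + s) by rewrite mulr_ge0// ltW.
have F (w a b : RR) : w <= a * (b * w) -> 2 * ((a + 1) * b) * w <= 1 * w ->
    0 <= b * w -> 0 < w -> False by clear => *; lra.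
exact: F h7 h9 h10 wp.
Qed.

(** * The form preserved by the transfer matrices *)

Lemma conjB (a b : RR[i]) : ((a - b)^*)%C = (a^*)%C - (b^*)%C.
Proof. exact: rmorphB. Qed.
Lemma conjD (a b : RR[i]) : ((a + b)^*)%C = (a^*)%C + (b^*)%C.
Proof. exact: rmorphD. Qed.
Lemma conjM (a b : RR[i]) : ((a * b)^*)%C = (a^*)%C * (b^*)%C.
Proof. exact: rmorphM. Qed.
Lemma conj_RtoC (a : RR) : ((RtoC a)^*)%C = RtoC a.
Proof. exact: conjc_real. Qed.

Lemma tcoef_of (a : int -> RR[i]) (K : nat) (m : int) :
  tcoef (tpoly_of a K) m = if (`|m| <= K)%N then a m else 0.
Proof.
rewrite /tcoef /tpoly_of big_map /=.
have -> : 0%N :: iota 1 (K + K) = index_iota 0 (K + K).+1 by rewrite /index_iota subn0.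
rewrite big_mkcond /= big_mkord; case: ifP => [mK|/negbT mK].
  have hi : (`|(m + K%:Z)%R|%N < (K + K).+1)%N by lia.
  have E : (Ordinal hi)%:Z - K%:Z = m by rewrite /=; lia.
  rewrite (bigD1 (Ordinal hi))//= E eqxx big1 ?addr0// => i ne.
  rewrite ifF//; apply/negbTE; apply: contra ne => /eqP Ei.
  by rewrite -val_eqE /=; lia.
rewrite big1// => i _; rewrite ifF//; apply/negbTE.
by have := ltn_ord i; apply: contraL => /eqP; lia.
Qed.

Lemma real_trig_poly_fix (a : int -> RR[i]) (K : nat) x :
  real_valued a K -> ((trig_poly a K x)^*)%C = trig_poly a K x.
Proof. by move=> ra; have := ra x; case: (trig_poly a K x) => p q /= ->; rewrite oppr0. Qed.

(** The polynomial minus its conjugate vanishes at every point, so its coefficients vanish. *)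
Lemma real_trig_poly_conj (a : int -> RR[i]) (K : nat) (k : int) :
  real_valued a K -> (`|k| <= K)%N -> ((a k)^*)%C = a (- k).
Proof.
move=> ra kK; pose P := tpoly_of a K ++ tscale (-1) (tconj (tpoly_of a K)).
have P0 x : cabs (tev P x) <= 0.
  rewrite /P tev_cat tev_scale tev_conj tev_of mulN1r.
  by rewrite real_trig_poly_fix// subrr cabs0.
have := tcoef_le_sup (- k) P0; rewrite le_eqVlt ltNge cabs_ge0 orbF => /eqP /Normc.eq0_normc.
rewrite tcoef_cat tcoef_scale tcoef_conj !tcoef_of abszN opprK kK mulN1r => /subr0_eq ->.
by [].
Qed.

Lemma C_mx_unit (w : int -> RR[i]) (l : nat) : w l%:Z != 0 -> C_mx w l \in unitmx.
Proof.
move=> wl; rewrite -unitmx_tr unitmxE det_trig.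
  rewrite unitfE; apply/prodf_neq0 => i _; rewrite !mxE leqnn.
  by rewrite subrK.
by apply/is_trig_mxP => i j ij; rewrite !mxE leqNgt ij.
Qed.

Lemma adjmx_unit n (A : 'M[RR[i]]_n) : A \in unitmx -> adjmx A \in unitmx.
Proof.
move=> Au; have E : adjmx (invmx A) *m adjmx A = 1%:M by rewrite -adjmxM mulmxV ?adjmx1.
by have [] := mulmx1_unit E.
Qed.

Lemma S_mx_unit (w : int -> RR[i]) (l : nat) : w l%:Z != 0 -> S_mx w l \in unitmx.
Proof.
move=> wl; have Cu := C_mx_unit wl; have Cu' := adjmx_unit Cu.
have E : S_mx w l *m block_mx 0 (invmx (C_mx w l)) (- invmx (adjmx (C_mx w l))) 0 = 1%:M.
  rewrite /S_mx mulmx_block !mul0mx !mulmx0 !addr0 !add0r mulNmx mulmxN opprK.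
  by rewrite !mulmxV// -scalar_mx_block.
by have [] := mulmx1_unit E.
Qed.

(** Coefficients are given on all integers, but only those with |k| <= d belong to the polynomial;
    the truncation permits sums over any window. *)
Definition trunc_coef (v : int -> RR[i]) (d : nat) (k : int) : RR[i] :=
  if (`|k| <= d)%N then v k else 0.

(** The matrix is the commutator of the Toeplitz matrix with entries v_(a - b) and the projection on
    the first d coordinates, that is, the discrete Wronskian of the difference operator. Reality of
    v identifies the upper right block. *)
Lemma S_mxE (v : int -> RR[i]) (d : nat) (a b : 'I_(d + d)) : real_valued v d ->
  S_mx v d a b = trunc_coef v d (a%:Z - b%:Z) * ((b < d)%N%:R - (a < d)%N%:R).
Proof.
move=> rv; rewrite /S_mx /trunc_coef.
case: (split_ordP a) => i ->; case: (split_ordP b) => j ->; have hi := ltn_ord i; have hj := ltn_ord j.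
- by rewrite block_mxEul mxE subrr mulr0.
- rewrite block_mxEur sub0r mulrN1 !mxE /=.
  case: ifP => [ji|/negbT ji].
    rewrite ifT; last by lia.
    rewrite (real_trig_poly_conj rv); last by lia.
    by congr (- v _); lia.
  by rewrite ifF ?conjc0//; lia.
- rewrite block_mxEdl subr0 mulr1 !mxE /=.
  case: ifP => [ji|/negbT ji].
    rewrite ifT; last by lia.
    by congr v; lia.
  by rewrite ifF//; lia.
- by rewrite block_mxEdr mxE subrr mulr0.
Qed.

Lemma sesqui_ext n (M M' : 'M[RR[i]]_n) :
  (forall z z' : 'cV_n, (adjmx z *m M *m z') 0 0 = (adjmx z *m M' *m z') 0 0) -> M = M'.
Proof.
move=> H; apply/matrixP => a b.
have E (X : 'M[RR[i]]_n) : (adjmx (delta_mx a 0 : 'cV_n) *m X *m (delta_mx b 0 : 'cV_n)) 0 0 = X a b.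
  have -> : adjmx (delta_mx a 0 : 'cV[RR[i]]_n) = delta_mx 0 a.
    rewrite /adjmx; apply/matrixP => p q; rewrite !mxE.
    by case: (_ && _) (andbC (q == a) (p == 0)) => <-; rewrite ?conjc1 ?conjc0.
  by rewrite -rowE -colE !mxE.
by rewrite -!E H.
Qed.

(** Here z is the window s 1, ..., s (2 d) and its image the window s 0, ..., s (2 d - 1): only the
    first row says something, namely the difference equation centred at s d. *)
Lemma transfer_mx_solution (v : int -> RR[i]) (d : nat) (q : RR -> RR[i]) (E x : RR)
    (z : 'cV[RR[i]]_(d + d)) (s : nat -> RR[i]) : v d%:Z != 0 -> (0 < d)%N ->
  (forall i : 'I_(d + d), z i 0 = s i.+1) ->
  (forall i : 'I_(d + d), (transfer_mx v d q E x *m z) i 0 = s i) <->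
  \sum_(i < (d + d).+1) trunc_coef v d (d%:Z - i%:Z) * s i = (RtoC E - q x) * s d.
Proof.
move=> vd d0 zs.
have shift (i : 'I_(d + d)) : (0 < i)%N -> (transfer_mx v d q E x *m z) i 0 = s i.
  move=> i0; have hi : (i.-1 < d + d)%N by have := ltn_ord i; lia.
  rewrite mxE (bigD1 (Ordinal hi))//= !mxE gtn_eqF//= zs /= (ltn_predK i0) eqxx mul1r.
  rewrite big1 ?addr0// => j ji; rewrite !mxE gtn_eqF//=.
  by rewrite -val_eqE /= in ji; case: eqP => [e|]; rewrite ?mul0r//; exfalso; move/eqP: ji; lia.
have hd : (d.-1 < d + d)%N by lia.
pose jd : 'I_(d + d) := Ordinal hd.
have row0 : (transfer_mx v d q E x *m z) (Ordinal (ltn_addl d d0 : 0 < d + d)%N) 0 * v d%:Z =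
    (RtoC E - q x) * s d - \sum_(j < d + d) trunc_coef v d (d%:Z - j.+1%:Z) * s j.+1.
  rewrite mxE mulr_suml (bigD1 jd)//= [in RHS](bigD1 jd)//= !mxE /= eqxx zs /= (ltn_predK d0).
  rewrite mulrAC divfK// opprD addrA mulrBl subrr.
  rewrite [trunc_coef v d 0]/trunc_coef /= -sumrN; congr (_ + _).
  apply: eq_bigr => j ji; rewrite !mxE /= zs ifF; last first.
    by apply/negbTE; apply: contra ji => /eqP e; rewrite -val_eqE /= e.
  rewrite mulrAC divfK// /trunc_coef ifT; last by have := ltn_ord j; lia.
  by rewrite mulNr; congr (- (v _ * _)); lia.
rewrite big_ord_recl /= subr0 {1}/trunc_coef absz_nat leqnn.
split=> [/(_ (Ordinal (ltn_addl d d0 : 0 < d + d)%N)) /= e|e].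
  by move: row0; rewrite e mulrC => ->; rewrite subrK.
move=> i; have [i0|i0] := posnP i; last exact: shift.
have -> : i = Ordinal (ltn_addl d d0 : 0 < d + d)%N by apply: val_inj.
apply: (mulIf vd); rewrite row0 -e /= mulrC.
by rewrite addrK.
Qed.

(** Green's identity. Moving the cut of the commutator from d to d + 1 changes the form by terms at
    index d alone, and these cancel because both sequences solve the same symmetric equation with a
    real c. Since V has range d, the form with cut d does not see the index 2 d, and the form with
    cut d + 1 does not see the index 0. *)
Lemma sum_shift_form (V : int -> RR[i]) (d : nat) (s s' : nat -> RR[i]) (c : RR[i]) :
  (forall k, (d < `|k|)%N -> V k = 0) -> (forall k, ((V k)^*)%C = V (- k)) -> ((c^*)%C = c) ->
  \sum_(i < (d + d).+1) V (d%:Z - i%:Z) * s i = c * s d ->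
  \sum_(i < (d + d).+1) V (d%:Z - i%:Z) * s' i = c * s' d ->
  \sum_(j < d + d) \sum_(i < d + d)
     ((s i)^*)%C * (V (i%:Z - j%:Z) * ((j < d)%N%:R - (i < d)%N%:R)) * s' j =
  \sum_(j < d + d) \sum_(i < d + d)
     ((s i.+1)^*)%C * (V (i%:Z - j%:Z) * ((j < d)%N%:R - (i < d)%N%:R)) * s' j.+1.
Proof.
move=> V0 Vc cr es es'.
pose T (t i j : nat) := ((s i)^*)%C * (V (i%:Z - j%:Z) * ((j < t)%N%:R - (i < t)%N%:R)) * s' j.
pose F t := \sum_(j < (d + d).+1) \sum_(i < (d + d).+1) T t i j.
have z1 i : T d i (d + d)%N = 0.
  rewrite /T; case: (ltnP i d) => h; last by rewrite ltnNge leq_addr subrr !mulr0 mul0r.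
  by rewrite V0 ?mul0r ?mulr0 ?mul0r//; lia.
have z2 j : T d (d + d)%N j = 0.
  rewrite /T; case: (ltnP j d) => h; last by rewrite ltnNge leq_addr subrr !mulr0 mul0r.
  by rewrite V0 ?mul0r ?mulr0 ?mul0r//; lia.
have z3 i : T d.+1 i 0%N = 0.
  rewrite /T; case: (ltnP i d.+1) => h; first by rewrite ltnS leq0n subrr !mulr0 mul0r.
  by rewrite V0 ?mul0r ?mulr0 ?mul0r//; lia.
have z4 j : T d.+1 0%N j = 0.
  rewrite /T; case: (ltnP j d.+1) => h; first by rewrite ltnS leq0n subrr !mulr0 mul0r.
  by rewrite V0 ?mul0r ?mulr0 ?mul0r//; lia.
have E1 : F d = \sum_(j < d + d) \sum_(i < d + d) T d i j.
  rewrite /F big_ord_recr /= [X in _ + X]big1 ?addr0 => [|i _]; last exact: z1.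
  by apply: eq_bigr => j _; rewrite big_ord_recr /= z2 addr0.
have E2 : F d.+1 = \sum_(j < d + d) \sum_(i < d + d) T d.+1 i.+1 j.+1.
  rewrite /F big_ord_recl /= big1 ?add0r => [|i _]; last exact: z3.
  by apply: eq_bigr => j _; rewrite big_ord_recl /= z4 add0r; apply: eq_bigr.
have E3 : F d.+1 = F d.
  apply/eqP; rewrite -subr_eq0 /F -sumrB; apply/eqP.
  have D i j : T d.+1 i j - T d i j =
      (if j == d then ((s i)^*)%C * V (i%:Z - j%:Z) * s' j else 0) -
      (if i == d then ((s i)^*)%C * V (i%:Z - j%:Z) * s' j else 0).
    rewrite /T -mulrBl -mulrBr -mulrBr.
    have B (n : nat) : (n < d.+1)%N%:R = (n < d)%N%:R + (n == d)%:R :> RR[i].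
      by rewrite ltnS leq_eqVlt; case: eqP => [->|_]; rewrite ?ltnn ?add0r ?addr0.
    rewrite !B; have -> (a b e f : RR[i]) : a + b - (e + f) - (a - e) = b - f by ring.
    by case: (j == d); case: (i == d); rewrite ?subrr ?sub0r ?subr0 ?mulr0 ?mul0r ?mulr1 ?mulrN1 ?mulrN ?mulNr.
  under eq_bigr do rewrite -sumrB.
  under eq_bigr do under eq_bigr do rewrite D.
  under eq_bigr do rewrite sumrB.
  rewrite sumrB.
  have hd : (d < (d + d).+1)%N by lia.
  have L1 : \sum_(j < (d + d).+1) \sum_(i < (d + d).+1)
      (if j == d :> nat then ((s i)^*)%C * V (i%:Z - j%:Z) * s' j else 0) = c * ((s d)^*)%C * s' d.
    rewrite (bigD1 (Ordinal hd))//= eqxx [X in _ + X]big1 ?addr0; last first.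
      by move=> j jd; rewrite big1// => i _; rewrite ifF//; apply/negbTE.
    rewrite -mulr_suml; congr (_ * _).
    rewrite -[in RHS]cr -rmorphM -es rmorph_sum; apply: eq_bigr => i _.
    by rewrite rmorphM /= Vc mulrC opprB.
  have L2 : \sum_(j < (d + d).+1) \sum_(i < (d + d).+1)
      (if i == d :> nat then ((s i)^*)%C * V (i%:Z - j%:Z) * s' j else 0) = ((s d)^*)%C * (c * s' d).
    rewrite exchange_big /= (bigD1 (Ordinal hd))//= [X in _ + X]big1 ?addr0; last first.
      by move=> i id; rewrite big1// => j _; rewrite ifF//; apply/negbTE.
    by rewrite -es' mulr_sumr; apply: eq_bigr => j _; rewrite eqxx mulrA.
  by rewrite L1 L2; ring.
rewrite -[LHS]E1 -E3 E2; apply: eq_bigr => j _; apply: eq_bigr => i _.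
by rewrite /T !ltnS; congr (_ * (V _ * _) * _); lia.
Qed.

Lemma transfer_symplectic (v : int -> RR[i]) (d : nat) (q : RR -> RR[i]) (E x : RR) :
  v d%:Z != 0 -> (0 < d)%N -> real_valued v d -> (((q x)^*)%C = q x) ->
  adjmx (transfer_mx v d q E x) *m S_mx v d *m transfer_mx v d q E x = S_mx v d.
Proof.
move=> vd d0 rv qr; set A := transfer_mx v d q E x; apply: sesqui_ext => z z'.
(* The first entry of A y followed by the entries of y: thus y and A y are two windows of one
   solution. *)
pose ext (y : 'cV[RR[i]]_(d + d)) (n : nat) : RR[i] :=
  if n is n'.+1 then (if insub n' is Some i then y i 0 else 0)
  else (A *m y) (Ordinal (ltn_addl d d0 : 0 < d + d)%N) 0.
have extS (y : 'cV[RR[i]]_(d + d)) (i : 'I_(d + d)) : y i 0 = ext y i.+1.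
  by rewrite /ext; case: insubP => [j _ /val_inj ->//|]; rewrite ltn_ord.
have extA (y : 'cV[RR[i]]_(d + d)) (i : 'I_(d + d)) : (A *m y) i 0 = ext y i.
  have [i0|i0] := posnP i.
    by have -> : i = Ordinal (ltn_addl d d0 : 0 < d + d)%N by apply: val_inj.
  have hi : (i.-1 < d + d)%N by have := ltn_ord i; lia.
  have -> : ext y i = y (Ordinal hi) 0 by rewrite extS; congr (ext y _); rewrite /= (ltn_predK i0).
  rewrite mxE (bigD1 (Ordinal hi))//= !mxE gtn_eqF//= (ltn_predK i0) eqxx mul1r.
  rewrite big1 ?addr0// => j ji; rewrite !mxE gtn_eqF//=.
  by rewrite -val_eqE /= in ji; case: eqP => [e|]; rewrite ?mul0r//; exfalso; move/eqP: ji; lia.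
have eq (y : 'cV[RR[i]]_(d + d)) : \sum_(i < (d + d).+1) trunc_coef v d (d%:Z - i%:Z) * ext y i = (RtoC E - q x) * ext y d.
  by apply/(transfer_mx_solution q E x vd d0 (extS y)).
have form (y y' : 'cV[RR[i]]_(d + d)) : (adjmx y *m S_mx v d *m y') 0 0 =
    \sum_(j < d + d) \sum_(i < d + d)
     ((y i 0)^*)%C * (trunc_coef v d (i%:Z - j%:Z) * ((j < d)%N%:R - (i < d)%N%:R)) * y' j 0.
  rewrite mxE; apply: eq_bigr => j _; rewrite mxE mulr_suml; apply: eq_bigr => i _.
  by rewrite S_mxE// !mxE.
have -> : adjmx z *m (adjmx A *m S_mx v d *m A) *m z' = adjmx (A *m z) *m S_mx v d *m (A *m z').
  by rewrite adjmxM !mulmxA.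
rewrite !form.
under eq_bigr do under eq_bigr do rewrite !extA.
under [RHS]eq_bigr do under eq_bigr do rewrite !extS.
apply: (@sum_shift_form _ _ _ _ (RtoC E - q x)) => //.
- by move=> k dk; rewrite /trunc_coef leqNgt dk.
- move=> k; rewrite /trunc_coef abszN; case: ifP => h; last exact: conjc0.
  exact: real_trig_poly_conj.
- by rewrite conjB conj_RtoC qr.
Qed.

(** * Continuity, periodicity and boundedness of the transfer matrices *)

Lemma continuous_cos_lin (R : realType) (c : R) : continuous (fun x : R => cos (c * x)).
Proof.
move=> x; apply: (@continuous_comp _ _ _ (fun x : R => c * x) cos); last exact: continuous_cos.
by apply: cvgM; [exact: cvg_cst|exact: cvg_id].
Qed.

Lemma continuous_sin_lin (R : realType) (c : R) : continuous (fun x : R => sin (c * x)).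
Proof.
move=> x; apply: (@continuous_comp _ _ _ (fun x : R => c * x) sin); last exact: continuous_sin.
by apply: cvgM; [exact: cvg_cst|exact: cvg_id].
Qed.

Lemma ccont_trig_poly c m : ccont (trig_poly c m).
Proof.
have -> : trig_poly c m = (fun x => \sum_(k < (m + m).+1)
     c (k%:Z - m%:Z) * expi (2 * pi * (k%:Z - m%:Z)%:~R * x)) by [].
apply: ccont_sum => k; apply: ccontM; first exact: ccont_cst.
by split; [exact: continuous_cos_lin|exact: continuous_sin_lin].
Qed.

Lemma trig_poly_periodic c m : periodic1 (trig_poly c m).
Proof.
move=> x; rewrite !trig_polyE; apply: eq_bigr => k _.
by rewrite mulrDr mulr1 ee_periodic.
Qed.

Lemma trig_poly_bound c m x : cabs (trig_poly c m x) <= \sum_(k < (m + m).+1) cabs (c (k%:Z - m%:Z)).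
Proof.
rewrite trig_polyE; apply: le_trans (cabs_sum _ _ _) _; apply: ler_sum => k _.
by rewrite cabsM cabs_ee mulr1.
Qed.

Lemma mcont_transfer (v w : int -> RR[i]) (d l : nat) (E : RR) :
  mcont (transfer_mx v d (trig_poly w l) E).
Proof.
move=> i j.
have [i0|i0] := eqVneq (i : nat) 0%N; last first.
  have -> : (fun x => transfer_mx v d (trig_poly w l) E x i j) = (fun=> ((j : nat).+1 == i)%:R).
    by apply: funext => x; rewrite mxE (negbTE i0).
  exact: ccont_cst.
have [j0|j0] := eqVneq (j : nat) d.-1; last first.
  have -> : (fun x => transfer_mx v d (trig_poly w l) E x i j) =
      (fun=> - v (d.-1%:Z - (j : nat)%:Z) / v d%:Z).
    by apply: funext => x; rewrite mxE i0 eqxx (negbTE j0).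
  exact: ccont_cst.
have -> : (fun x => transfer_mx v d (trig_poly w l) E x i j) =
   (fun x => (RtoC E + (-1) * trig_poly w l x + - v 0) * (v d%:Z)^-1).
  by apply: funext => x; rewrite mxE i0 j0 !eqxx mulN1r.
apply: ccontM; last exact: ccont_cst.
apply: ccontD; last exact: ccont_cst.
apply: ccontD; first exact: ccont_cst.
by apply: ccontM; [exact: ccont_cst|exact: ccont_trig_poly].
Qed.

Lemma transfer_periodic (v w : int -> RR[i]) (d l : nat) (E : RR) :
  periodic1 (transfer_mx v d (trig_poly w l) E).
Proof. by move=> x; apply/matrixP => i j; rewrite !mxE trig_poly_periodic. Qed.

Lemma transfer_bound (v w : int -> RR[i]) (d l : nat) (E : RR) :
  exists L : RR, forall x, mxnorm (transfer_mx v d (trig_poly w l) E x) <= L.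
Proof.
pose b (j : 'I_(d + d)) : RR := (`|E| + \sum_(k < (l + l).+1) cabs (w (k%:Z - l%:Z)) + cabs (v 0) +
   cabs (v (d.-1%:Z - (j : nat)%:Z))) / cabs (v d%:Z) + 1.
exists (\sum_(i < d + d) \sum_(j < d + d) b j) => x.
apply: ler_sum => i _; apply: ler_sum => j _; rewrite mxE.
set s := \sum_(k < _) _ in b *.
have s0 : 0 <= s by apply: sumr_ge0 => k _; exact: cabs_ge0.
have v0 := cabs_ge0 (v 0); have vj := cabs_ge0 (v (d.-1%:Z - (j : nat)%:Z)).
have vd := cabs_ge0 (v d%:Z); have E0 := normr_ge0 E.
have i0 : 0 <= (cabs (v d%:Z))^-1 by rewrite invr_ge0.
case: eqP => _; last first.
  apply: (@le_trans _ _ 1); first by case: eqP => _; rewrite ?cabs1 ?cabs0 ?ler01.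
  by rewrite lerDr mulr_ge0// !addr_ge0.
apply: (@le_trans _ _ ((`|E| + s + cabs (v 0) + cabs (v (d.-1%:Z - (j : nat)%:Z))) / cabs (v d%:Z))); last by rewrite lerDl ler01.
rewrite cabsM cabsV ler_wpM2r//; case: eqP => _; last by rewrite cabsN lerDr !addr_ge0.
apply: le_trans (cabsB _ _) _; rewrite -addrA; apply: lerD; last by rewrite lerDl.
apply: le_trans (cabsB _ _) _; rewrite cabs_RtoC; apply: lerD => //.
exact: trig_poly_bound.
Qed.

(** * Aubry duality for approximate solutions *)

(** As phi (x + alpha) - phi x is th x up to e, the factor exp (i phi) absorbs the multiplier exp (i
    th): the functions G satisfy the equations of h without multiplier, up to a multiple of e. *)
Lemma conjugated_approx (l : nat) (alpha E e Ch : RR) (w : int -> RR[i]) (V : RR -> RR[i]) (Vb : RR)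
    (h : nat -> RR -> RR[i]) (phi th : RR -> RR) (G : nat -> tpoly) :
  (0 < l)%N ->
  (forall j x, (0 < j < l + l)%N -> expi (th x) * h j (x + alpha) = h j.-1 x) ->
  (forall x, w l%:Z * (expi (th x) * h 0%N (x + alpha)) +
     \sum_(j < l + l) w (l%:Z - 1 - j%:Z) * h j x + (V x - RtoC E) * h l.-1 x = 0) ->
  (forall x, `|phi (x + alpha) - phi x - th x| <= e) ->
  (forall j x, (j < l + l)%N -> cabs (h j x) <= Ch) ->
  (forall x, cabs (V x) <= Vb) ->
  (forall j x, (j < l + l)%N -> cabs (tev (G j) x - expi (phi x) * h j x) <= e) ->
  (forall j x, (0 < j < l + l)%N ->
     cabs (tev (G j) (x + alpha) - tev (G j.-1) x) <= (2 + Ch) * e) /\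
  (forall x, cabs (w l%:Z * tev (G 0%N) (x + alpha) +
     \sum_(j < l + l) w (l%:Z - 1 - j%:Z) * tev (G j) x + (V x - RtoC E) * tev (G l.-1) x) <=
     (cabs (w l%:Z) * (1 + Ch) + \sum_(j < l + l) cabs (w (l%:Z - 1 - j%:Z)) + (Vb + `|E|)) * e).
Proof.
move=> l0 h1 h2 hphi hb Vbd hG.
have e0 : 0 <= e := le_trans (normr_ge0 _) (hphi 0).
have K j x : (j < l + l)%N ->
    cabs (tev (G j) (x + alpha) - expi (phi x) * (expi (th x) * h j (x + alpha))) <= (1 + Ch) * e.
  move=> jl; apply: le_trans (cabs_triangle (expi (phi (x + alpha)) * h j (x + alpha)) _ _) _.
  rewrite mulrDl mul1r; apply: lerD; first exact: hG.
  rewrite mulrA -expiD -mulrBl cabsM mulrC; apply: ler_pM; rewrite ?cabs_ge0//.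
    exact: hb.
  by apply: le_trans (expi_lipschitz _ _) _; rewrite opprD addrA.
split=> [j x /andP[j0 jl]|x].
  apply: le_trans (cabs_triangle (expi (phi x) * h j.-1 x) _ _) _.
  rewrite -(h1 j x) ?j0//.
  have A := K j x jl.
  have B : cabs (expi (phi x) * (expi (th x) * h j (x + alpha)) - tev (G j.-1) x) <= e.
    by rewrite h1 ?j0// cabs_distrC; apply: hG; lia.
  by lra.
set S := \sum_(j < l + l) cabs _.
have Z : expi (phi x) * (w l%:Z * (expi (th x) * h 0%N (x + alpha)) +
     \sum_(j < l + l) w (l%:Z - 1 - j%:Z) * h j x + (V x - RtoC E) * h l.-1 x) = 0.
  by rewrite h2 mulr0.
have EQ : w l%:Z * (tev (G 0%N) (x + alpha) - expi (phi x) * (expi (th x) * h 0%N (x + alpha))) +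
   \sum_(j < l + l) w (l%:Z - 1 - j%:Z) * (tev (G j) x - expi (phi x) * h j x) +
   (V x - RtoC E) * (tev (G l.-1) x - expi (phi x) * h l.-1 x) =
   w l%:Z * tev (G 0%N) (x + alpha) +
     \sum_(j < l + l) w (l%:Z - 1 - j%:Z) * tev (G j) x + (V x - RtoC E) * tev (G l.-1) x -
   expi (phi x) * (w l%:Z * (expi (th x) * h 0%N (x + alpha)) +
     \sum_(j < l + l) w (l%:Z - 1 - j%:Z) * h j x + (V x - RtoC E) * h l.-1 x).
  under [in LHS]eq_bigr do rewrite mulrBr mulrCA.
  by rewrite sumrB -mulr_sumr; ring.
rewrite Z subr0 in EQ; rewrite -EQ.
rewrite [X in _ <= X]mulrDl [X in _ <= X + _]mulrDl.
apply: le_trans (cabsD _ _) (lerD _ _).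
  apply: le_trans (cabsD _ _) (lerD _ _).
    by rewrite cabsM -mulrA ler_wpM2l ?cabs_ge0//; apply: K; lia.
  apply: le_trans (cabs_sum _ _ _) _; rewrite /S mulr_suml; apply: ler_sum => j _.
  by rewrite cabsM ler_wpM2l ?cabs_ge0//; exact: hG.
rewrite cabsM; apply: ler_pM; rewrite ?cabs_ge0//; last by apply: hG; lia.
apply: le_trans (cabsB _ _) _; rewrite cabs_RtoC; apply: lerD => //.
Qed.

(** On Fourier coefficients the translation by alpha is a phase, so all components have the same
    coefficients up to phases. The reference component l - 1 is the one that v - E multiplies in the
    first row. *)
Lemma coef_telescope (l : nat) (alpha e : RR) (G : nat -> tpoly) (m : int) :
  (0 < l)%N ->
  (forall j x, (0 < j < l + l)%N -> cabs (tev (G j) (x + alpha) - tev (G j.-1) x) <= e) ->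
  forall j, (j < l + l)%N ->
  cabs (tcoef (G j) m - ee (((l%:Z - 1 - j%:Z)%:~R * (m%:~R * alpha))) * tcoef (G l.-1) m) <=
    (l + l)%:R * e.
Proof.
move=> l0 H j jl.
pose y (i : nat) := tcoef (G i) m * ee (i%:R * (m%:~R * alpha)).
have st i : (0 < i < l + l)%N -> cabs (y i - y i.-1) <= e.
  move=> il; have [i0 _] := andP il.
  have -> : y i - y i.-1 = (tcoef (tshift alpha (G i)) m - tcoef (G i.-1) m) * ee (i.-1%:R * (m%:~R * alpha)).
    rewrite tcoef_shift /y mulrBl; congr (_ - _); rewrite -mulrA -eeD; congr (_ * ee _).
    by rewrite -{1}(ltn_predK i0) -natr1; ring.
  rewrite cabsM cabs_ee mulr1.
  have -> : tcoef (tshift alpha (G i)) m - tcoef (G i.-1) m =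
     tcoef (tshift alpha (G i) ++ tscale (-1) (G i.-1)) m.
    by rewrite tcoef_cat tcoef_scale mulN1r.
  by apply: tcoef_le_sup => x; rewrite tev_cat tev_scale tev_shift mulN1r; exact: H.
have e0 : 0 <= e.
  by apply: le_trans (H 1%N 0 _); rewrite ?cabs_ge0//; lia.
have tel i k : (i + k < l + l)%N -> cabs (y (i + k)%N - y i) <= k%:R * e.
  elim: k => [|k IH] ik; first by rewrite addn0 subrr cabs0 mul0r.
  apply: le_trans (cabs_triangle (y (i + k)%N) _ _) _.
  rewrite -natr1 mulrDl mul1r addrC; apply: lerD; first by apply: IH; lia.
  by rewrite addnS; apply: (st (i + k).+1); lia.
have ya : cabs (y j - y l.-1) <= (l + l)%:R * e.
  have [h|h] := leqP j l.-1.
    rewrite cabs_distrC; have := @tel j (l.-1 - j)%N; rewrite subnKC// => /(_ ltac:(lia)) A.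
    by apply: le_trans A _; rewrite ler_wpM2r// ler_nat; lia.
  have := @tel l.-1 (j - l.-1)%N; rewrite subnKC ?(ltnW h)// => /(_ jl) A.
  by apply: le_trans A _; rewrite ler_wpM2r// ler_nat; lia.
have E : tcoef (G j) m - ee (((l%:Z - 1 - j%:Z)%:~R * (m%:~R * alpha))) * tcoef (G l.-1) m =
    ee (- (j%:R * (m%:~R * alpha))) * (y j - y l.-1).
  have X (a b c : RR[i]) : a * (b * c) = (a * c) * b by ring.
  rewrite /y mulrBr !X -!eeD addNr ee0 mul1r; congr (_ - ee _ * _).
  have -> : l.-1%:R = l%:R - 1 :> RR by rewrite -{2}(ltn_predK l0) -natr1 addrK.
  by rewrite !intrB; ring.
by rewrite E cabsM cabs_ee mul1r.
Qed.

(** The m-th Fourier coefficient of the first-row equation is taken: multiplication by v becomes a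
    convolution, and the phases of the components add up to the value of w at m alpha, the potential
    of the dual equation. *)
Lemma dual_recursion (d l : nat) (alpha E e : RR) (v w : int -> RR[i]) (G : nat -> tpoly) (m : int) :
  (0 < l)%N ->
  (forall j x, (0 < j < l + l)%N -> cabs (tev (G j) (x + alpha) - tev (G j.-1) x) <= e) ->
  (forall x, cabs (w l%:Z * tev (G 0%N) (x + alpha) +
     \sum_(j < l + l) w (l%:Z - 1 - j%:Z) * tev (G j) x +
     (trig_poly v d x - RtoC E) * tev (G l.-1) x) <= e) ->
  cabs (\sum_(k < (d + d).+1) v (k%:Z - d%:Z) * tcoef (G l.-1) (m - (k%:Z - d%:Z)) +
     (trig_poly w l (m%:~R * alpha) - RtoC E) * tcoef (G l.-1) m) <=
  (1 + (cabs (w l%:Z) + \sum_(j < l + l) cabs (w (l%:Z - 1 - j%:Z))) * (l + l)%:R) * e.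
Proof.
move=> l0 H1 H2; have T := coef_telescope m l0 H1.
pose sumG : tpoly := flatten [seq tscale (w (l%:Z - 1 - j%:Z)) (G j) | j <- iota 0 (l + l)].
have evS x : tev sumG x = \sum_(j < l + l) w (l%:Z - 1 - j%:Z) * tev (G j) x.
  rewrite -(big_mkord xpredT (fun j : nat => w (l%:Z - 1 - j%:Z) * tev (G j) x)) /index_iota subn0.
  rewrite /sumG; elim: (iota 0 _) => [|j s IH]; first by rewrite /tev !big_nil.
  by rewrite /= tev_cat tev_scale IH big_cons.
have cfS : tcoef sumG m = \sum_(j < l + l) w (l%:Z - 1 - j%:Z) * tcoef (G j) m.
  rewrite -(big_mkord xpredT (fun j : nat => w (l%:Z - 1 - j%:Z) * tcoef (G j) m)) /index_iota subn0.
  rewrite /sumG; elim: (iota 0 _) => [|j s IH]; first by rewrite /tcoef !big_nil.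
  by rewrite /= tcoef_cat tcoef_scale IH big_cons.
pose Q := tscale (w l%:Z) (tshift alpha (G 0%N)) ++ sumG ++
   (tmul (tpoly_of v d) (G l.-1) ++ tscale (- RtoC E) (G l.-1)).
have Qe : cabs (tcoef Q m) <= e.
  apply: tcoef_le_sup => x; apply: le_trans (H2 x); rewrite le_eqVlt; apply/orP; left; apply/eqP.
  congr cabs; rewrite /Q (tev_cat (tscale _ _)) (tev_cat sumG) (tev_cat (tmul _ _)) evS (tev_mul (tpoly_of v d)) tev_of !tev_scale tev_shift.
  ring.
set u := tcoef (G l.-1) in T *.
have cQ : tcoef Q m = w l%:Z * (tcoef (G 0%N) m * ee (m%:~R * alpha)) +
    \sum_(j < l + l) w (l%:Z - 1 - j%:Z) * tcoef (G j) m +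
    (\sum_(k < (d + d).+1) v (k%:Z - d%:Z) * u (m - (k%:Z - d%:Z)) - RtoC E * u m).
  rewrite /Q (tcoef_cat (tscale _ _)) (tcoef_cat sumG) (tcoef_cat (tmul _ _)) !tcoef_scale tcoef_shift cfS (tcoef_mul (tpoly_of v d)) mulNr -addrA; congr (_ + (_ + (_ + _))).
  rewrite /tpoly_of big_map -(big_mkord xpredT (fun k : nat => v (k%:Z - d%:Z) * u (m - (k%:Z - d%:Z)))).
  by rewrite /index_iota subn0.
(* The components carry the phases of index l - 1 down to - l; the remaining index l comes from the
   translated component [G 0]. *)
have wE : trig_poly w l (m%:~R * alpha) =
   w l%:Z * (ee ((l%:Z - 1 - 0%:Z)%:~R * (m%:~R * alpha)) * ee (m%:~R * alpha)) +
   \sum_(j < l + l) w (l%:Z - 1 - j%:Z) * ee ((l%:Z - 1 - j%:Z)%:~R * (m%:~R * alpha)).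
  rewrite trig_polyE big_ord_recr /= addrC; congr (_ + _).
    rewrite -eeD PoszD addrK; congr (_ * ee _); rewrite subr0 intrB; ring.
  rewrite (reindex_inj rev_ord_inj) /=; apply: eq_bigr => j _.
  have -> : (l + l - j.+1)%N%:Z - l%:Z = l%:Z - 1 - j%:Z by have := ltn_ord j; lia.
  by [].
pose r (j : nat) := tcoef (G j) m - ee (((l%:Z - 1 - j%:Z)%:~R * (m%:~R * alpha))) * u m.
have sr : \sum_(j < l + l) w (l%:Z - 1 - j%:Z) * r j =
    \sum_(j < l + l) w (l%:Z - 1 - j%:Z) * tcoef (G j) m -
    (\sum_(j < l + l) w (l%:Z - 1 - j%:Z) * ee ((l%:Z - 1 - j%:Z)%:~R * (m%:~R * alpha))) * u m.
  by rewrite mulr_suml -sumrB; apply: eq_bigr => j _; rewrite /r; ring.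
have -> : \sum_(k < (d + d).+1) v (k%:Z - d%:Z) * u (m - (k%:Z - d%:Z)) +
     (trig_poly w l (m%:~R * alpha) - RtoC E) * u m =
   tcoef Q m - (w l%:Z * (r 0%N * ee (m%:~R * alpha)) + \sum_(j < l + l) w (l%:Z - 1 - j%:Z) * r j).
  by rewrite cQ wE sr /r; ring.
apply: le_trans (cabsB _ _) _; rewrite [X in _ <= X]mulrDl mul1r; apply: lerD => //.
have e0 : 0 <= e := le_trans (cabs_ge0 _) Qe.
apply: le_trans (cabsD _ _) _; rewrite [X in _ <= X * _]mulrDl [X in _ <= X]mulrDl; apply: lerD.
  rewrite !cabsM cabs_ee mulr1 -mulrA ler_wpM2l ?cabs_ge0//.
  by apply: T; lia.
apply: le_trans (cabs_sum _ _ _) _; rewrite -mulrA mulr_suml; apply: ler_sum => j _.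
by rewrite cabsM ler_wpM2l ?cabs_ge0//; exact: T.
Qed.

(* The conjugate turns the convolution of u with the coefficients of v into the operator with
   symbol v. *)
Definition site_vec (n : nat) (u : int -> RR[i]) (m : int) : 'cV[RR[i]]_(n + n) :=
  \col_(i < n + n) ((u (m + n%:Z - 1 - i%:Z))^*)%C.

(** The lower rows shift the window exactly, so the whole error sits in the first entry, where it is
    the conjugate of the defect of the recursion divided by v_d. *)
Lemma dual_transfer (d l : nat) (alpha E e : RR) (v w : int -> RR[i]) (u : int -> RR[i]) (m : int) :
  (0 < d)%N -> v d%:Z != 0 -> real_valued v d -> real_valued w l ->
  cabs (\sum_(k < (d + d).+1) v (k%:Z - d%:Z) * u (m - (k%:Z - d%:Z)) +
     (trig_poly w l (m%:~R * alpha) - RtoC E) * u m) <= e ->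
  mxnorm (site_vec d u (m + 1) - transfer_mx v d (trig_poly w l) E (m%:~R * alpha) *m site_vec d u m)
    <= e / cabs (v d%:Z).
Proof.
move=> d0 vd rv rw H; set A := transfer_mx _ _ _ _ _.
set Z := site_vec d u.
have shift (i : 'I_(d + d)) : (0 < i)%N -> (A *m Z m) i 0 = Z (m + 1) i 0.
  move=> i0; have hi : (i.-1 < d + d)%N by have := ltn_ord i; lia.
  rewrite mxE (bigD1 (Ordinal hi))//= !mxE gtn_eqF//= (ltn_predK i0) eqxx mul1r.
  rewrite big1 ?addr0 => [|j ji]; first by congr ((u _)^*)%C; lia.
  rewrite !mxE gtn_eqF//=.
  by rewrite -val_eqE /= in ji; case: eqP => [e'|]; rewrite ?mul0r//; exfalso; move/eqP: ji; lia.
pose o : 'I_(d + d) := Ordinal (ltn_addl d d0 : 0 < d + d)%N.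
have N1 : mxnorm (Z (m + 1) - A *m Z m) = cabs ((Z (m + 1) - A *m Z m) o 0).
  rewrite /mxnorm (bigD1 o)//= [X in _ + X]big1 ?addr0 ?big_ord1// => i io.
  rewrite big_ord1 [X in cabs X]mxE [X in _ + X]mxE shift ?subrr ?cabs0//.
  by rewrite lt0n; apply: contra io => /eqP i0; apply/eqP/val_inj.
rewrite N1 ler_pdivlMr ?cabs_gt0// -cabsM.
suff -> : (Z (m + 1) - A *m Z m) o 0 * v d%:Z =
   ((\sum_(k < (d + d).+1) v (k%:Z - d%:Z) * u (m - (k%:Z - d%:Z)) +
     (trig_poly w l (m%:~R * alpha) - RtoC E) * u m)^*)%C by rewrite cabs_conj.
have hd : (d.-1 < d + d)%N by lia.
pose jd : 'I_(d + d) := Ordinal hd.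
have R1 : ((\sum_(k < (d + d).+1) v (k%:Z - d%:Z) * u (m - (k%:Z - d%:Z)) +
     (trig_poly w l (m%:~R * alpha) - RtoC E) * u m)^*)%C =
   \sum_(k < (d + d).+1) v (d%:Z - k%:Z) * ((u (m + d%:Z - k%:Z))^*)%C +
     (trig_poly w l (m%:~R * alpha) - RtoC E) * ((u m)^*)%C.
  rewrite conjD conjM conjB conj_RtoC real_trig_poly_fix//; congr (_ + _).
  rewrite rmorph_sum; apply: eq_bigr => k _; rewrite [LHS]conjM.
  rewrite (real_trig_poly_conj rv); last by have := ltn_ord k; lia.
  by congr (v _ * (u _)^*)%C; lia.
rewrite R1 big_ord_recl /= subr0 mxE [X in _ + X]mxE mulrBl.
have -> : Z (m + 1) o 0 * v d%:Z = v d%:Z * ((u (m + d%:Z - 0%:Z))^*)%C.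
  by rewrite mxE mulrC; congr (_ * (u _)^*)%C; rewrite /=; lia.
rewrite -!addrA; congr (_ + _).
rewrite mxE mulr_suml (bigD1 jd)//= [in RHS](bigD1 jd)//= !mxE /= eqxx.
have -> : bump 0 d.-1 = d by rewrite /bump /=; lia.
rewrite subrr mulrAC divfK// opprD addrAC [in RHS]addrAC; congr (_ + _).
  have -> : m + d%:Z - 1 - d.-1%:Z = m by lia.
  have -> : m + d%:Z - d%:Z = m by lia.
  by ring.
rewrite -sumrN; apply: eq_bigr => j ji; rewrite !mxE /= ifF; last first.
  by apply/negbTE; apply: contra ji => /eqP e'; rewrite -val_eqE /= e'.
rewrite mulrAC divfK// mulNr opprK /bump /=; congr (v _ * (u _)^*)%C; lia.
Qed.

(** * From localized approximate solutions to a contradiction *)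

Lemma orbit_shadowing n k (alpha L e : RR) (A : RR -> 'M[RR[i]]_n) (Z : int -> 'M[RR[i]]_(n, k)) :
  1 <= L -> (forall x, mxnorm (A x) <= L) ->
  (forall m, mxnorm (Z (m + 1) - A (m%:~R * alpha) *m Z m) <= e) ->
  forall p m, mxnorm (cociter alpha A p (m%:~R * alpha) *m Z m - Z (m + p%:Z)) <= p%:R * L ^+ p * e.
Proof.
move=> L1 HL HZ p m; have L0 : 0 <= L := le_trans ler01 L1.
have e0 : 0 <= e := le_trans (mxnorm_ge0 _) (HZ 0).
elim: p => [|p IH] /=.
  by rewrite mul1mx addr0 subrr mxnorm0 !mul0r.
set B := cociter _ _ _ _ in IH *.
have -> : m%:~R * alpha + p%:R * alpha = (m + p%:Z)%:~R * alpha by rewrite intrD mulrDl.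
set A' := A _.
have -> : A' *m B *m Z m - Z (m + p.+1%:Z) =
    A' *m (B *m Z m - Z (m + p%:Z)) - (Z (m + p%:Z + 1) - A' *m Z (m + p%:Z)).
  rewrite mulmxBr mulmxA opprB addrA subrK; congr (_ - Z _); lia.
apply: le_trans (mxnormB _ _) _.
have h1 : mxnorm (A' *m (B *m Z m - Z (m + p%:Z))) <= L * (p%:R * L ^+ p * e).
  by apply: le_trans (mxnormM _ _) _; apply: ler_pM; rewrite ?mxnorm_ge0// /A'.
have h2 := HZ (m + p%:Z); rewrite -/A' in h2.
have h3 : e <= L ^+ p.+1 * e by rewrite -[X in X <= _]mul1r ler_wpM2r// exprn_ege1.
have -> : p.+1%:R * L ^+ p.+1 * e = L * (p%:R * L ^+ p * e) + L ^+ p.+1 * e.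
  by rewrite -natr1 exprS; ring.
exact: le_trans (lerD h1 h2) (lerD (lexx _) h3).
Qed.

(** The inverse is conjugate by W to the adjoint, so backward iterates obey the same growth bound as
    forward ones. *)
Lemma symplectic_inv_bound n (W B : 'M[RR[i]]_n) : W \in unitmx -> adjmx B *m W *m B = W ->
  mxnorm (invmx B) <= mxnorm (invmx W) * mxnorm W * mxnorm B.
Proof.
move=> Wu BW; have Bu := symplectic_unitmx Wu BW.
have -> : invmx B = invmx W *m adjmx B *m W.
  have E : (invmx W *m adjmx B *m W) *m B = 1%:M.
    by rewrite -!mulmxA (mulmxA (adjmx B)) BW mulVmx.
  by rewrite -[RHS](mulmxK Bu) E mul1mx.
apply: le_trans (mxnormM _ _) _; rewrite mulrAC ler_wpM2r ?mxnorm_ge0//.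
by apply: le_trans (mxnormM _ _) _; rewrite mxnorm_adj.
Qed.

Lemma sqr_le_expn2 M : (M.+1 ^ 2 <= 4 * 2 ^ M)%N.
Proof.
elim: M => [//|M IH]; case: M IH => [//|[//|M]] IH.
rewrite [(2 ^ M.+3)%N]expnS; have := leq0n M; nia.
Qed.

(** Over n = D M N sites the decay beats the size b^M even after a loss L^M, and the accuracy rho^(P
    M) beats the amplification L^(2 n + M); both end below T^M. *)
Lemma decay_numeric (L b rho T : RR) (N D P M : nat) : 1 <= L -> 0 <= b -> 0 <= rho -> rho <= 1 ->
  (0 < N)%N -> L * b * rho ^+ D <= T -> L ^+ (2 * N * D).+1 * rho ^+ P <= T ->
  L ^+ M * (b ^+ M * rho ^+ (D * M * N)) <= T ^+ M /\
  L ^+ (2 * (D * M * N) + M) * rho ^+ (P * M) <= T ^+ M.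
Proof.
move=> L1 b0 r0 r1 N0 h1 h2; have L0 : 0 <= L := le_trans ler01 L1.
split.
  apply: (@le_trans _ _ ((L * b * rho ^+ D) ^+ M)).
    rewrite !exprMn -mulrA ler_wpM2l ?exprn_ge0// ler_wpM2l ?exprn_ge0//.
    by rewrite -exprM; apply: ler_wiXn2l => //; rewrite leq_pmulr.
  apply: lerXn2r => //; rewrite nnegrE ?mulr_ge0 ?exprn_ge0//.
  by apply: le_trans h1; rewrite ?mulr_ge0 ?exprn_ge0.
have -> : (2 * (D * M * N) + M)%N = ((2 * N * D).+1 * M)%N by lia.
rewrite exprM [rho ^+ _]exprM -exprMn; apply: lerXn2r => //; rewrite nnegrE ?mulr_ge0 ?exprn_ge0//.
by apply: le_trans h2; rewrite ?mulr_ge0 ?exprn_ge0.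
Qed.

(** The lower bound is available only at some site |m| <= M depending on c. Iterates move it to the
    site 0 with a loss L^M; the decay at the sites n and - n is strong enough to remain small in
    comparison. *)
Theorem no_localized_planes (d : nat) (alpha L0 C b rho : RR) (A : RR -> 'M[RR[i]]_(d + d))
    (W : 'M[RR[i]]_(d + d)) :
  mcont A -> periodic1 A -> (forall x, mxnorm (A x) <= L0) ->
  W \in unitmx -> (forall x, adjmx (A x) *m W *m A x = W) ->
  0 < C -> 0 < b -> 0 < rho -> rho < 1 ->
  (forall P M0 : nat, exists2 M : nat, (M0 <= M)%N & exists Z : int -> 'M[RR[i]]_(d + d, 2),
    [/\ forall m, mxnorm (Z (m + 1) - A (m%:~R * alpha) *m Z m) <= C * rho ^+ (P * M),
        forall m, mxnorm (Z m) <= C * b ^+ M * rho ^+ `|m|%N &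
        forall c : 'cV_2, exists2 m : int, (`|m| <= M)%N &
          mxnorm c <= C * M.+1%:R * mxnorm (Z m *m c)]) ->
  ~ dominated alpha A d.+1.
Proof.
move=> cA pA HL0 Wu AW C0 b0 r0 r1 H dom.
have [N N0 [e e0 [k0 Hno]]] := dominated_no_decaying_plane cA pA HL0 Wu AW dom.
pose L := `|L0| + 1.
have L1 : 1 <= L by rewrite lerDr.
have HL x : mxnorm (A x) <= L.
  by apply: le_trans (HL0 x) _; rewrite -[X in X <= _]addr0 lerD// ler_norm.
have Lp : 0 < L := lt_le_trans ltr01 L1.
pose n0 : RR := (d + d)%:R + 1.
have n01 : 1 <= n0 by rewrite lerDr ler0n.
pose kp := mxnorm (invmx W) * mxnorm W + 1.
have kp0 : 0 <= mxnorm (invmx W) * mxnorm W by rewrite mulr_ge0 ?mxnorm_ge0.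
have kp1 : 1 <= kp by rewrite lerDr.
have cob p x : mxnorm (cociter alpha A p x) <= n0 * L ^+ p.
  apply: le_trans (mxnorm_mul_bound p alpha x HL) _.
  by rewrite mulrC ler_wpM2r ?exprn_ge0 ?(ltW Lp)// lerDl ler01.
have cosym p x := cociter_symplectic alpha p x AW.
have coinv p x : mxnorm (invmx (cociter alpha A p x)) <= kp * n0 * L ^+ p.
  apply: le_trans (symplectic_inv_bound Wu (cosym p x)) _; rewrite -[X in _ <= X]mulrA.
  apply: ler_pM; rewrite ?mxnorm_ge0//; first by rewrite lerDl ler01.
have Lb0 : 0 < L * b by rewrite mulr_gt0.
(* D is chosen for the decay to beat L b, and P after it for the accuracy to beat the amplification
   over the longer window. The successor of D ensures M <= n. *)
have [D HD] := exprn_eventually_lt (ltW r0) r1 (divr_gt0 (divr_gt0 ltr01 (ltr0n RR 4)) Lb0).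
have hD : L * b * rho ^+ D.+1 <= 1 / 4.
  by have := ltW (HD D.+1 (leqnSn _)); rewrite ler_pdivlMr// mulrC.
have Lp2 : 0 < L ^+ (2 * N * D.+1).+1 by rewrite exprn_gt0.
have [P HP] := exprn_eventually_lt (ltW r0) r1 (divr_gt0 (divr_gt0 ltr01 (ltr0n RR 4)) Lp2).
have hP : L ^+ (2 * N * D.+1).+1 * rho ^+ P <= 1 / 4.
  by have := ltW (HP P (leqnn _)); rewrite ler_pdivlMr// mulrC.
clearbody kp n0 L.
have kpp : 0 < kp := lt_le_trans ltr01 kp1.
have n0p : 0 < n0 := lt_le_trans ltr01 n01.
pose Gm := C * kp * n0.
have Gm0 : 0 < Gm by rewrite !mulr_gt0.
(* All constants are gathered here. What grows with M is one factor M + 1 from the mass and one from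
   the length n of the shadowed orbit, hence the square in [small]. *)
pose Q0 := 2 * Gm * C * (1 + kp * n0 * (N * D.+1)%:R).
have kn0 : 0 <= kp * n0 * (N * D.+1)%:R.
  by rewrite !mulr_ge0 ?ler0n ?(ltW kpp) ?(ltW n0p).
have Q00 : 0 < Q0 by rewrite !mulr_gt0// ltr_pwDl.
pose e' := Num.min e 1.
have e'0 : 0 < e' by rewrite lt_min e0 ltr01.
have [M1 HM1] := @exprn_eventually_lt RR (1 / 2) (e' / (4 * Q0)) ltac:(lra) ltac:(lra)
   (divr_gt0 e'0 (mulr_gt0 (ltr0n RR 4) Q00)).
have [M MM [Z [Zerr Zdec Zmass]]] := H P (maxn k0 (maxn M1 1)).
have [k0M M1M M0] : [/\ k0 <= M, M1 <= M & 0 < M]%N by move: MM; rewrite !geq_max => /and3P[].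
have small : Q0 * (M.+1%:R ^+ 2 * (1 / 4) ^+ M) <= e'.
  have := ltW (HM1 M M1M); rewrite (ler_pdivlMr _ _ (mulr_gt0 (ltr0n RR 4) Q00)) => h.
  apply: le_trans h.
  have s : M.+1%:R ^+ 2 <= 4 * 2 ^+ M :> RR by rewrite -!natrX -natrM ler_nat sqr_le_expn2.
  have -> : (1 / 2) ^+ M * (4 * Q0) = Q0 * (4 * 2 ^+ M * (1 / 4) ^+ M) :> RR.
    have -> : 1 / 2 = 2 * (1 / 4) :> RR by field.
    by rewrite [in LHS]exprMn; ring.
  by rewrite ler_wpM2l ?(ltW Q00)// ler_wpM2r// exprn_ge0// divr_ge0 ?ler01 ?ler0n.
pose k := (D.+1 * M)%N; pose n := (k * N)%N.
have [F1 F2] := @decay_numeric L b rho (1 / 4) N D.+1 P M L1 (ltW b0) (ltW r0) (ltW r1) N0 hD hP.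
rewrite -/k -/n in F1 F2.
set T := (1 / 4) ^+ M in small F1 F2.
have T0 : 0 <= T by rewrite exprn_ge0// divr_ge0 ?ler01 ?ler0n.
pose er := C * rho ^+ (P * M).
have er0 : 0 <= er by rewrite mulr_ge0 ?exprn_ge0 ?(ltW C0) ?(ltW r0).
have Mk : (M <= k)%N by rewrite /k leq_pmull.
have Mn : (M <= n)%N by apply: leq_trans Mk _; rewrite /n leq_pmulr.
have nE : n%:R = (N * D.+1)%:R * M%:R :> RR by rewrite -natrM; congr (_%:R); rewrite /n /k mulnC mulnA.
have Ler p : (p <= 2 * n + M)%N -> L ^+ p * er <= C * T.
  move=> pn; rewrite /er mulrCA ler_wpM2l ?(ltW C0)//; apply: le_trans F2.
  by rewrite ler_wpM2r ?exprn_ge0 ?(ltW r0)//; apply: ler_weXn2l.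
have cZ (m : int) (c : 'cV_2) : mxnorm (Z m *m c) <= mxnorm (Z m) * mxnorm c by exact: mxnormM.
have shf := orbit_shadowing L1 HL Zerr; rewrite -/er in shf; clearbody er T.
have LM0 : 0 < L ^+ M by rewrite exprn_gt0.
have kn1 : 1 <= kp * n0 by rewrite -[X in X <= _]mulr1; apply: ler_pM.
have LM1 : 1 <= L ^+ M by apply: exprn_ege1.
have Lp1 p : 0 <= L ^+ p by rewrite exprn_ge0 ?(ltW Lp).
(* For m >= 0 the site m is reached from 0 by a forward iterate, for m < 0 by the inverse of the
   iterate from m to 0. Either way it costs L^M, up to the shadowing error. *)
have E (c : 'cV_2) (m : int) : (`|m| <= M)%N ->
    mxnorm (Z m *m c) <= kp * n0 * (L ^+ M * (mxnorm (Z 0 *m c) + M%:R * L ^+ M * er * mxnorm c)).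
  move=> mM; have Lm : L ^+ `|m|%N <= L ^+ M by apply: ler_weXn2l.
  have mM' : `|m|%N%:R <= M%:R :> RR by rewrite ler_nat.
  have sb : `|m|%N%:R * L ^+ `|m|%N * er * mxnorm c <= M%:R * L ^+ M * er * mxnorm c.
    rewrite ler_wpM2r ?mxnorm_ge0// ler_wpM2r//; apply: ler_pM; rewrite ?ler0n//.
  have z0 := mxnorm_ge0 (Z 0 *m c).
  have r0' : 0 <= M%:R * L ^+ M * er * mxnorm c by rewrite !mulr_ge0 ?ler0n ?mxnorm_ge0.
  have [m0|m0] := leP 0 m.
    have mE : m = `|m|%N%:Z by rewrite gez0_abs.
    have S := shf `|m|%N 0; rewrite add0r -mE in S.
    have -> : Z m *m c = cociter alpha A `|m|%N ((0 : int)%:~R * alpha) *m (Z 0 *m c) -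
       (cociter alpha A `|m|%N ((0 : int)%:~R * alpha) *m Z 0 - Z m) *m c.
      by rewrite mulmxBl mulmxA opprB addrC subrK.
    apply: le_trans (mxnormB _ _) _.
    have a1 : mxnorm (cociter alpha A `|m|%N ((0 : int)%:~R * alpha) *m (Z 0 *m c)) <=
       kp * n0 * (L ^+ M * mxnorm (Z 0 *m c)).
      apply: le_trans (mxnormM _ _) _; rewrite mulrA ler_wpM2r//.
      apply: le_trans (cob _ _) _; apply: ler_pM => //; first exact: le_trans ler01 n01.
      by rewrite ler_peMl// (le_trans ler01).
    have a2 : mxnorm ((cociter alpha A `|m|%N ((0 : int)%:~R * alpha) *m Z 0 - Z m) *m c) <=
       kp * n0 * (L ^+ M * (M%:R * L ^+ M * er * mxnorm c)).
      apply: le_trans (mxnormM _ _) _; apply: le_trans (ler_wpM2r (mxnorm_ge0 c) S) _.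
      apply: le_trans sb _; rewrite [X in _ <= X]mulrA; apply: ler_peMl => //.
      by rewrite -[X in X <= _]mulr1; apply: ler_pM.
    by apply: le_trans (lerD a1 a2) _; rewrite -mulrDr -mulrDr.
  have S := shf `|m|%N m; have m0' : m + `|m|%N%:Z = 0 by rewrite ltz0_abs// subrr.
  rewrite m0' in S; set B := cociter _ _ _ _ in S.
  have Bu : B \in unitmx by exact: symplectic_unitmx Wu (cosym _ _).
  have -> : Z m *m c = invmx B *m (Z 0 *m c + (B *m Z m - Z 0) *m c).
    by rewrite -mulmxDl addrC subrK -mulmxA mulKmx.
  apply: le_trans (mxnormM _ _) _; rewrite mulrA; apply: ler_pM; rewrite ?mxnorm_ge0//.
    by apply: le_trans (coinv _ _) _; rewrite ler_wpM2l// (le_trans ler01).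
  apply: le_trans (mxnormD _ _) _; rewrite lerD2l.
  by apply: le_trans (mxnormM _ _) _; apply: le_trans (ler_wpM2r (mxnorm_ge0 c) S) _.
have Gq : Gm * M.+1%:R * (C * (M%:R * T)) <= 1 / 2.
  have h : Q0 * (M.+1%:R ^+ 2 * T) <= 1 by apply: le_trans small _; rewrite ge_min lexx orbT.
  have h2 : 2 * (Gm * M.+1%:R * (C * (M%:R * T))) <= Q0 * (M.+1%:R ^+ 2 * T).
    have -> : 2 * (Gm * M.+1%:R * (C * (M%:R * T))) = 2 * Gm * C * (M.+1%:R * M%:R) * T by ring.
    rewrite [X in _ <= X]mulrA ler_wpM2r// /Q0 -[X in _ <= X]mulrA ler_wpM2l//; first by rewrite !mulr_ge0// ltW.
    rewrite -[X in X <= _]mul1r; apply: ler_pM; rewrite ?mulr_ge0 ?ler0n//; first by rewrite lerDl.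
    by rewrite expr2 ler_wpM2l ?ler0n// ler_nat.
  by move: (le_trans h2 h); clear => h; rewrite ler_pdivlMr// mulrC.
(* By [Gq] the shadowing error is at most half of the norm of c, and it is absorbed by the left-hand
   side. *)
have low (c : 'cV_2) : mxnorm c <= 2 * Gm * M.+1%:R * (L ^+ M * mxnorm (Z 0 *m c)).
  have [m mM mc] := Zmass c.
  have c0 := mxnorm_ge0 c; have Ec := E c m mM.
  have h1 : mxnorm c <= Gm * M.+1%:R * (L ^+ M * mxnorm (Z 0 *m c) + M%:R * (L ^+ (M + M) * er) * mxnorm c).
    apply: le_trans mc _.
    have -> : Gm * M.+1%:R * (L ^+ M * mxnorm (Z 0 *m c) + M%:R * (L ^+ (M + M) * er) * mxnorm c) =
      C * M.+1%:R * (kp * n0 * (L ^+ M * (mxnorm (Z 0 *m c) + M%:R * L ^+ M * er * mxnorm c))).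
      by rewrite /Gm exprD; ring.
    by rewrite ler_wpM2l// mulr_ge0 ?ler0n// ltW.
  have h2 : L ^+ (M + M) * er <= C * T by apply: Ler; rewrite -[X in (_ <= X)%N]addnC leq_add2l; apply: leq_trans Mn _; rewrite leq_pmull.
  have h3 : Gm * M.+1%:R * (M%:R * (L ^+ (M + M) * er) * mxnorm c) <= 1 / 2 * mxnorm c.
    rewrite [X in X <= _](mulrA (Gm * M.+1%:R)); apply: ler_wpM2r => //; apply: le_trans Gq; apply: ler_wpM2l.
      by rewrite mulr_ge0 ?ler0n// ltW.
    by rewrite [X in _ <= X]mulrCA; apply: ler_wpM2l.
  have F (x a y t : RR) : x <= a * (y + t) -> a * t <= 1 / 2 * x -> x <= 2 * a * y.
    by clear => *; lra.
  by have := F _ _ _ _ h1 h3; rewrite mulrA.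
(* This form leaves a factor L^M on the right; each use below multiplies its quantity by L^M, and
   [LMs] cancels the two. *)
have key (t : RR) (c : 'cV_2) : t <= C * (1 + kp * n0 * n%:R) * T * mxnorm c ->
    t <= e' * (L ^+ M * mxnorm (Z 0 *m c)).
  move=> /le_trans; apply.
  have zc : 0 <= L ^+ M * mxnorm (Z 0 *m c) by rewrite mulr_ge0 ?mxnorm_ge0.
  apply: le_trans (ler_wpM2l _ (low c)) _.
    rewrite !mulr_ge0 ?(ltW C0)// addr_ge0 ?ler01// !mulr_ge0 ?ler0n//; exact: le_trans ler01 _.
  rewrite [X in X <= _](mulrA (C * (1 + kp * n0 * n%:R) * T)); apply: ler_wpM2r => //; apply: le_trans small.
  have -> : C * (1 + kp * n0 * n%:R) * T * (2 * Gm * M.+1%:R) =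
    2 * Gm * C * (1 + kp * n0 * n%:R) * M.+1%:R * T by ring.
  rewrite [X in _ <= X]mulrA ler_wpM2r// /Q0 expr2 [X in _ <= X]mulrA ler_wpM2r ?ler0n// -[X in _ <= X]mulrA ler_wpM2l//.
    by rewrite !mulr_ge0// ltW.
  rewrite nE -natr1; have := kn0; move: (kp * n0) (ler0n RR M) => t' M0' h.
  have -> : 1 + t' * ((N * D.+1)%:R * M%:R) = 1 + t' * (N * D.+1)%:R * M%:R by ring.
  by move: (t' * _) h M0'; clear => a; move: (M%:R) => b *; nra.
pose B := cociter alpha A n (- (n%:R * alpha)).
have Bu : B \in unitmx by exact: symplectic_unitmx Wu (cosym _ _).
have BE : - (n%:R * alpha) = ((- n%:Z)%:~R) * alpha :> RR by rewrite intrN mulNr.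
have LMs (t z f : RR) : L ^+ M * t <= f * (L ^+ M * z) -> t <= f * z.
  by rewrite [X in _ <= X]mulrCA ler_pM2l.
(* The initial plane is the exact backward orbit of [Z 0]; shadowing compares it with Z (- n), which
   is small by decay. *)
apply: (Hno k (invmx B *m Z 0) (Z 0)); first exact: leq_trans k0M Mk.
- by rewrite -/n -/B mulKVmx.
- move=> c c0; apply/negP => /eqP zc; have := low c; rewrite zc mxnorm0 !mulr0 leNgt.
  by rewrite mxnorm_gt0 c0.
- move=> c; apply: (@le_trans _ _ (e' * mxnorm (Z 0 *m c))); last first.
    by rewrite -[X in _ <= X]mul1r ler_wpM2r ?mxnorm_ge0// ge_min lexx orbT.
  apply: LMs; apply: key.
  have S := shf n (- n%:Z); rewrite -BE addNr -/B in S.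
  have -> : invmx B *m Z 0 *m c = Z (- n%:Z) *m c - invmx B *m ((B *m Z (- n%:Z) - Z 0) *m c).
    by rewrite mulmxBl mulmxBr -!mulmxA mulKmx// opprB addrC subrK.
  have a1 : mxnorm (Z (- n%:Z) *m c) <= C * b ^+ M * rho ^+ n * mxnorm c.
    apply: le_trans (cZ _ _) _; rewrite ler_wpM2r ?mxnorm_ge0//.
    by have := Zdec (- n%:Z); rewrite abszN absz_nat.
  have a2 : mxnorm (invmx B *m ((B *m Z (- n%:Z) - Z 0) *m c)) <= kp * n0 * L ^+ n * (n%:R * L ^+ n * er * mxnorm c).
    apply: le_trans (mxnormM _ _) _; apply: ler_pM; rewrite ?mxnorm_ge0//; first exact: coinv.
    by apply: le_trans (mxnormM _ _) _; rewrite ler_wpM2r ?mxnorm_ge0.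
  apply: le_trans (ler_wpM2l (Lp1 M) (le_trans (mxnormB _ _) (lerD a1 a2))) _.
  have -> : L ^+ M * (C * b ^+ M * rho ^+ n * mxnorm c + kp * n0 * L ^+ n * (n%:R * L ^+ n * er * mxnorm c)) =
    (C * (L ^+ M * (b ^+ M * rho ^+ n)) + kp * n0 * n%:R * (L ^+ (2 * n + M) * er)) * mxnorm c.
    by rewrite exprD mul2n -addnn exprD; ring.
  rewrite ler_wpM2r ?mxnorm_ge0//.
  have -> : C * (1 + kp * n0 * n%:R) * T = C * T + kp * n0 * n%:R * (C * T) by ring.
  apply: lerD; first by rewrite ler_wpM2l// ltW.
  by rewrite ler_wpM2l ?Ler// !mulr_ge0 ?ler0n// (le_trans ler01).
- move=> c; apply: (@le_trans _ _ (e' * mxnorm (Z 0 *m c))); last first.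
    by rewrite ler_wpM2r ?mxnorm_ge0// ge_min lexx.
  apply: LMs; apply: key.
  have S := shf n 0; rewrite mul0r add0r in S; rewrite -/n; set B' := cociter _ _ _ _ in S *.
  have -> : B' *m (Z 0 *m c) = Z n%:Z *m c + (B' *m Z 0 - Z n%:Z) *m c.
    by rewrite mulmxA -mulmxDl addrC subrK.
  have a1 : mxnorm (Z n%:Z *m c) <= C * b ^+ M * rho ^+ n * mxnorm c.
    by apply: le_trans (cZ _ _) _; rewrite ler_wpM2r ?mxnorm_ge0//; exact: Zdec.
  have a2 : mxnorm ((B' *m Z 0 - Z n%:Z) *m c) <= n%:R * L ^+ n * er * mxnorm c.
    by apply: le_trans (mxnormM _ _) _; rewrite ler_wpM2r ?mxnorm_ge0.
  apply: le_trans (ler_wpM2l (Lp1 M) (le_trans (mxnormD _ _) (lerD a1 a2))) _.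
  have -> : L ^+ M * (C * b ^+ M * rho ^+ n * mxnorm c + n%:R * L ^+ n * er * mxnorm c) =
    (C * (L ^+ M * (b ^+ M * rho ^+ n)) + n%:R * (L ^+ (n + M) * er)) * mxnorm c.
    by rewrite exprD; ring.
  rewrite ler_wpM2r ?mxnorm_ge0//.
  have -> : C * (1 + kp * n0 * n%:R) * T = C * T + kp * n0 * n%:R * (C * T) by ring.
  apply: lerD; first by rewrite ler_wpM2l// ltW.
  apply: (@le_trans _ _ (n%:R * (C * T))); first by rewrite ler_wpM2l ?ler0n// Ler// leq_add2r leq_pmull.
  by rewrite ler_wpM2r ?mulr_ge0 ?(ltW C0)// ler_peMl ?ler0n.
Qed.

(** * Scalar sections and the approximate cohomological equation *)

Lemma fourier_approx_family (I : finType) (g : I -> RR -> RR) :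
  (forall i, real_analytic (g i)) -> (forall i, periodic1 (g i)) ->
  exists2 C : RR, 0 <= C & exists2 q : RR, 0 < q < 1 & forall i (K : nat),
    exists2 a : int -> RR[i], (forall k : int, (`|k| <= K)%N -> cabs (a k) <= C * q ^+ `|k|%N) &
      forall x : RR, cabs (RtoC (g i x) - trig_poly a K x) <= C * q ^+ K.
Proof.
move=> ga gp.
have D i : exists Cq : RR * RR, [/\ 0 <= Cq.1, 0 < Cq.2 < 1 & forall K : nat,
    exists2 a : int -> RR[i], (forall k : int, (`|k| <= K)%N -> cabs (a k) <= Cq.1 * Cq.2 ^+ `|k|%N) &
      forall x : RR, cabs (RtoC (g i x) - trig_poly a K x) <= Cq.1 * Cq.2 ^+ K].
  by have [C C0 [q q0 H]] := fourier_approx (ga i) (gp i); exists (C, q).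
have [f Hf] := boolp.choice D.
(* The value 1 / 2 keeps q positive even for an empty family. *)
pose C := \sum_i (f i).1; pose q := \big[Order.max/(1 / 2)]_i (f i).2.
have fC i : (f i).1 <= C.
  rewrite /C (bigD1 i)//= lerDl; apply: sumr_ge0 => j _; by have [] := Hf j.
have fq i : (f i).2 <= q by exact: le_bigmax.
have pw i n : (f i).1 * (f i).2 ^+ n <= C * q ^+ n.
  have [c0 /andP[q0 _] _] := Hf i.
  apply: ler_pM => //; first by rewrite exprn_ge0// ltW.
  by apply: lerXn2r; rewrite ?nnegrE ?(ltW q0)// (le_trans (ltW q0)).
exists C; first by apply: sumr_ge0 => i _; have [] := Hf i.
exists q.
  apply/andP; split; first by apply: (@lt_le_trans _ _ (1 / 2)); [lra|exact: bigmax_ge_id].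
  by apply: bigmax_lt => [|i _]; [lra|have [_ /andP[]] := Hf i].
move=> i K; have [_ _ /(_ K)[a a1 a2]] := Hf i.
by exists a => [k kK|x]; [apply: le_trans (a1 k kK) _|apply: le_trans (a2 x) _].
Qed.

(** The entry j of F applied to the column (1, - i sg), extended by 0 so that indices can be plain
    natural numbers. *)
Definition rot_section (l : nat) (sg : RR) (F : 'M[RR]_(l + l, 2)) (j : nat) : RR[i] :=
  if insub j is Some i then F i 0 +i* (- (sg * F i 1)) else 0.

Lemma rot_sectionE l sg (F : 'M[RR]_(l + l, 2)) (i : 'I_(l + l)) :
  rot_section sg F i = F i 0 +i* (- (sg * F i 1)).
Proof. by rewrite /rot_section valK. Qed.

Lemma rot_section_conj l sg (F : 'M[RR]_(l + l, 2)) j :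
  rot_section (- sg) F j = ((rot_section sg F j)^*)%C.
Proof.
rewrite /rot_section; case: (insub j) => [i|]; last by rewrite conjc0.
by rewrite /= mulNr.
Qed.

(* (1, -i) and (1, i) are the eigenvectors of the rotations, which scalarizes the conjugacy. *)
Lemma rot_section_transfer (l : nat) (w : int -> RR[i]) V (E x t sg : RR)
    (F F' : 'M[RR]_(l + l, 2)) :
  sg = 1 \/ sg = -1 ->
  transfer_mx w l V E x *m map_mx RtoC F = map_mx RtoC (F' *m rotmx t) ->
  forall i, \sum_j transfer_mx w l V E x i j * rot_section sg F j =
    expi (sg * (2 * pi * t)) * rot_section sg F' i.
Proof.
move=> hs H i.
move/matrixP: H => H; have R0 := H i 0; have R1 := H i 1.
rewrite /= !mxE !big_ord_recl big_ord0 !mxE /= addr0 in R0.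
rewrite /= !mxE !big_ord_recl big_ord0 !mxE /= addr0 in R1.
have S : \sum_j transfer_mx w l V E x i j * rot_section sg F j =
  \sum_j transfer_mx w l V E x i j * (map_mx RtoC F) j 0 -
  (0 +i* sg) * \sum_j transfer_mx w l V E x i j * (map_mx RtoC F) j 1.
  rewrite mulr_sumr -sumrB; apply: eq_bigr => j _; rewrite rot_sectionE ![(map_mx _ _) _ _]mxE.
  have -> : F j 0 +i* (- (sg * F j 1)) = RtoC (F j 0) - (0 +i* sg) * RtoC (F j 1).
    by apply/eqP; rewrite eq_complex /=; apply/andP; split; apply/eqP; ring.
  ring.
rewrite S R0 R1 rot_sectionE.
have e1 : lift ord0 ord0 = 1 :> 'I_2 by apply/val_inj.
rewrite e1; case: hs => ->; rewrite ?mul1r ?mulN1r /expi ?cosN ?sinN;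
  apply/eqP; rewrite eq_complex /=; apply/andP; split; apply/eqP; ring.
Qed.

(** The scalarized relation is read row by row with the denominator of the first row cleared: lower
    rows shift the components, and the potential V - E is separated from the coefficients of w. *)
Lemma rot_section_rows (l : nat) (w : int -> RR[i]) V (E x t sg : RR)
    (F F' : 'M[RR]_(l + l, 2)) :
  (0 < l)%N -> w l%:Z != 0 -> sg = 1 \/ sg = -1 ->
  transfer_mx w l V E x *m map_mx RtoC F = map_mx RtoC (F' *m rotmx t) ->
  (forall j, (0 < j < l + l)%N ->
     expi (sg * (2 * pi * t)) * rot_section sg F' j = rot_section sg F j.-1) /\
  w l%:Z * (expi (sg * (2 * pi * t)) * rot_section sg F' 0%N) +
     \sum_(j < l + l) w (l%:Z - 1 - j%:Z) * rot_section sg F j +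
     (V x - RtoC E) * rot_section sg F l.-1 = 0.
Proof.
move=> l0 wl hs H; have R := rot_section_transfer hs H; split=> [j /andP[j0 jl]|].
  have hj : (j.-1 < l + l)%N by lia.
  rewrite -[j in LHS]/(val (Ordinal jl)) -R (bigD1 (Ordinal hj))//= !mxE /= gtn_eqF//.
  rewrite (ltn_predK j0) eqxx mul1r big1 ?addr0// => k kj; rewrite !mxE /= gtn_eqF//.
  case: eqP => [e|]; last by rewrite mul0r.
  by case/eqP: kj; apply/val_inj; rewrite /= -e.
have h0 : (0 < l + l)%N by lia.
have hl : (l.-1 < l + l)%N by lia.
rewrite -[0%N]/(val (Ordinal h0)) -R mulr_sumr -big_split /=.
have T (j : 'I_(l + l)) : w l%:Z * (transfer_mx w l V E x (Ordinal h0) j * rot_section sg F j) +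
    w (l%:Z - 1 - j%:Z) * rot_section sg F j =
    if j == Ordinal hl then (RtoC E - V x) * rot_section sg F l.-1 else 0.
  rewrite !mxE /= -[j == _]/((j : nat) == l.-1); case: eqP => [->|_].
    have -> : l%:Z - 1 - l.-1%:Z = 0 by lia.
    have A (a b c s : RR[i]) : a != 0 -> a * (b / a * s) + c * s = (b + c) * s by move=> a0; field.
    by rewrite A// subrK.
  have -> : l.-1%:Z - j%:Z = l%:Z - 1 - j%:Z by lia.
  have A (a b s : RR[i]) : a != 0 -> a * (- b / a * s) + b * s = 0 by move=> a0; field.
  by rewrite A.
rewrite (eq_bigr _ (fun j _ => T j)) -big_mkcond big_pred1_eq; ring.
Qed.

Lemma tnorm_tpoly_of (r q C : RR) (a : int -> RR[i]) (K : nat) :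
  0 <= C -> 0 < q -> 1 <= r -> q * r < 1 ->
  (forall k : int, (`|k| <= K)%N -> cabs (a k) <= C * q ^+ `|k|%N) ->
  tnorm r (tpoly_of a K) <= 2 * C / (1 - q * r).
Proof.
move=> C0 q0 r1 qr H; have r0 : 0 < r := lt_le_trans ltr01 r1.
have qr0 : 0 <= q * r by rewrite mulr_ge0// ltW.
rewrite /tnorm /tpoly_of big_map -[iota _ _]/(index_iota 0 (K + K).+1) big_mkord /=.
pose F (k : nat) := C * (q * r) ^+ k.
apply: (@le_trans _ _ (\sum_(i < (K + K).+1) F `|i%:Z - K%:Z|%N)).
  apply: ler_sum => i _; rewrite /F exprMn mulrA ler_wpM2r ?exprn_ge0 ?(ltW r0)//.
  by apply: H; have := ltn_ord i; lia.
rewrite sum_abs_sym -mulrA.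
apply: (@le_trans _ _ (2 * \sum_(0 <= k < K.+1) F k)).
  by rewrite [in X in _ <= X]big_nat_recl// big_add1 /= /F expr0 mulr1; lra.
rewrite ler_wpM2l// /F -mulr_sumr ler_wpM2l// big_mkord.
exact: geometric_sum_le.
Qed.

(* The corrector solves the cohomological equation of the truncation of psi; at a best
   denominator K its small divisors cost only a factor sublinear in K. *)
Lemma cohomological_approx (alpha : RR) (psi : RR -> RR) (C q r s : RR) (K0 : nat) :
  irrational alpha -> continuous psi ->
  (\int[@lebesgue_measure RR]_(x in `[0%R, 1%R]) (psi x)%:E = 0)%E ->
  0 <= C -> 0 < q -> 1 <= r -> q * r < 1 -> 0 < s ->
  (forall K : nat,
    exists2 a : int -> RR[i], (forall k : int, (`|k| <= K)%N -> cabs (a k) <= C * q ^+ `|k|%N) &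
      forall x : RR, cabs (RtoC (psi x) - trig_poly a K x) <= C * q ^+ K) ->
  exists2 K : nat, (K0 <= K)%N & exists2 Phi : tpoly, tnorm r Phi <= s * K%:R &
    forall x, `|complex.Re (tev Phi (x + alpha)) - complex.Re (tev Phi x) - 2 * pi * psi x| <=
      4 * pi * C * q ^+ K.-1.
Proof.
move=> ia cpsi ipsi C0 q0 r1 qr1 s0 H.
have r0 : 0 < r := lt_le_trans ltr01 r1.
have p0 : 0 < (pi : RR) := pi_gt0 _.
have pC0 : 0 < 4 * pi * C + 1 by rewrite ltr_wpDl// !mulr_ge0// ltW.
(* In 4 pi C one factor 2 counts the two signs of k and 2 pi C bounds the numerators; the summand 1
   keeps the denominator positive when C = 0. *)
have [K KK [bK sK]] := small_divisor_sum K0 ia (mulr_gt0 q0 r0) qr1 (divr_gt0 s0 pC0).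
(* The truncation stops at K - 1, because a best denominator controls the divisors of the
   frequencies below K only. *)
exists K => //; have [a a1 a2] := H K.-1.
have K1 : (0 < K)%N by case: bK.
have KE : K.-1.+1 = K by rewrite prednK.
pose phi (k : int) : RR[i] := if k == 0 then 0 else RtoC (2 * pi) * a k / (ee (k%:~R * alpha) - 1).
have nz (k : int) : k != 0 -> (`|k| <= K.-1)%N -> ee (k%:~R * alpha) - 1 != 0.
  move=> k0 kK; rewrite -cabs_gt0; apply: lt_le_trans (best_denominator_small_divisor bK _).
    by rewrite invr_gt0 ltr0n.
  by rewrite absz_gt0 k0 -KE ltnS.
exists (tpoly_of phi K.-1).
  pose F (k : nat) : RR := if k == 0%N then 0 else 2 * pi * C * ((q * r) ^+ k / cabs (ee (k%:R * alpha) - 1)).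
  apply: (@le_trans _ _ (\sum_(i < (K.-1 + K.-1).+1) F `|i%:Z - K.-1%:Z|%N)).
    rewrite /tnorm /tpoly_of big_map -[iota _ _]/(index_iota 0 (K.-1 + K.-1).+1) big_mkord /=.
    apply: ler_sum => i _; rewrite /F /phi absz_eq0; case: ifPn => i0; first by rewrite cabs0 mul0r.
    have kK : (`|i%:Z - K.-1%:Z| <= K.-1)%N by have := ltn_ord i; clear; lia.
    rewrite !cabsM cabsV cabs_ee_sub1_abs cabs_RtoC ger0_norm; last by rewrite mulr_ge0 ?ltW.
    rewrite exprMn; set y := (cabs _)^-1.
    have y0 : 0 <= y by rewrite invr_ge0 cabs_ge0.
    have -> : 2 * pi * C * (q ^+ `|i%:Z - K.-1%:Z| * r ^+ `|i%:Z - K.-1%:Z| * y) =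
      2 * pi * (C * q ^+ `|i%:Z - K.-1%:Z|) * y * r ^+ `|i%:Z - K.-1%:Z| by ring.
    rewrite ler_wpM2r ?exprn_ge0 ?(ltW r0)// ler_wpM2r// ler_wpM2l ?mulr_ge0 ?(ltW p0)//.
    exact: a1.
  rewrite sum_abs_sym KE /F /= add0r.
  have -> : \sum_(1 <= k < K) (if k == 0%N then 0 else 2 * pi * C * ((q * r) ^+ k / cabs (ee (k%:R * alpha) - 1))) =
     2 * pi * C * \sum_(1 <= k < K) (q * r) ^+ k / cabs (ee (k%:R * alpha) - 1).
    rewrite mulr_sumr; apply: eq_big_nat => k /andP[k1 _]; by rewrite gtn_eqF.
  apply: (@le_trans _ _ (4 * pi * C * (s / (4 * pi * C + 1) * K%:R))).
    have -> : 2 * (2 * pi * C * \sum_(1 <= k < K) (q * r) ^+ k / cabs (ee (k%:R * alpha) - 1)) =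
      4 * pi * C * \sum_(1 <= k < K) (q * r) ^+ k / cabs (ee (k%:R * alpha) - 1) by ring.
    by rewrite ler_wpM2l// !mulr_ge0 ?(ltW p0).
  have -> : 4 * pi * C * (s / (4 * pi * C + 1) * K%:R) = (4 * pi * C) / (4 * pi * C + 1) * (s * K%:R).
    by ring.
  apply: ler_piMl; first by rewrite mulr_ge0 ?ler0n// ltW.
  by rewrite ler_pdivrMr// mul1r lerDl ler01.
move=> x; rewrite !tev_of.
have D : trig_poly phi K.-1 (x + alpha) - trig_poly phi K.-1 x = RtoC (2 * pi) * (trig_poly a K.-1 x - a 0).
  have i0lt : (K.-1 < (K.-1 + K.-1).+1)%N by rewrite ltnS leq_addr.
  pose i0 := Ordinal i0lt.
  rewrite !trig_polyE -sumrB [in RHS](bigD1 i0)//= (bigD1 i0)//= !subrr /phi eqxx !mul0r subrr add0r.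
  rewrite ee0 mulr1 addrAC subrr add0r mulr_sumr; apply: eq_bigr => i ii.
  have k0 : i%:Z - K.-1%:Z != 0.
    by apply: contra ii => /eqP e; apply/eqP/val_inj => /=; move: e; clear; lia.
  have kK : (`|i%:Z - K.-1%:Z| <= K.-1)%N by have := ltn_ord i; clear; lia.
  rewrite (negbTE k0) (mulrDr _ x) eeD; have := nz _ k0 kK; set z := ee (_ * alpha); set y := ee _ => zn.
  by field.
have R : complex.Re (trig_poly phi K.-1 (x + alpha)) - complex.Re (trig_poly phi K.-1 x) =
    2 * pi * (complex.Re (trig_poly a K.-1 x) - complex.Re (a 0)).
  have := congr1 (@complex.Re RR) D; rewrite raddfB /= => ->.
  by case: (trig_poly a _ x) (a 0) => u1 u2 [v1 v2] /=; rewrite mul0r subr0.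
(* The constant term cannot be corrected; as psi has zero mean, it is as small as the truncation
   error. *)
have m0 := mean_zero_coef cpsi ipsi a2.
have m1 : `|psi x - complex.Re (trig_poly a K.-1 x)| <= C * q ^+ K.-1.
  apply: le_trans (a2 x); apply: le_trans (Re_le_cabs _).
  by rewrite raddfB.
have -> : 4 * pi * C * q ^+ K.-1 = 2 * pi * (C * q ^+ K.-1 + C * q ^+ K.-1) by ring.
have -> : complex.Re (trig_poly phi K.-1 (x + alpha)) - complex.Re (trig_poly phi K.-1 x) - 2 * pi * psi x =
   - (2 * pi * ((psi x - complex.Re (trig_poly a K.-1 x)) + complex.Re (a 0))) by rewrite R; ring.
rewrite normrN normrM ger0_norm ?mulr_ge0 ?(ltW p0)// ler_wpM2l ?mulr_ge0 ?(ltW p0)//.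
exact: le_trans (ler_normD _ _) (lerD m1 m0).
Qed.

(** * The plane of approximate dual solutions *)

Lemma mxnorm_row_mx n p q (A : 'M[RR[i]]_(n, p)) (B : 'M[RR[i]]_(n, q)) :
  mxnorm (row_mx A B) = mxnorm A + mxnorm B.
Proof.
rewrite /mxnorm -big_split; apply: eq_bigr => i _ /=; rewrite big_split_ord /=.
by congr (_ + _); apply: eq_bigr => j _; rewrite ?row_mxEl ?row_mxEr.
Qed.

Lemma mxnorm_cV2 (c : 'cV[RR[i]]_2) : mxnorm c = cabs (c 0 0) + cabs (c 1 0).
Proof.
rewrite /mxnorm big_ord_recl big_ord1 !big_ord1.
by congr (_ + cabs (c _ _)); apply/val_inj.
Qed.

(** The duality estimates are gathered into one constant that depends on the operators and on the
    bound [Ch], not on the approximants or their accuracy. *)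
Lemma dual_column_error (d l : nat) (alpha E Ch : RR) (v w : int -> RR[i]) :
  (0 < d)%N -> (0 < l)%N -> v d%:Z != 0 -> real_valued v d -> real_valued w l -> 0 <= Ch ->
  exists2 C1 : RR, 0 <= C1 &
  forall (h : nat -> RR -> RR[i]) (phi th : RR -> RR) (e : RR) (G : nat -> tpoly),
  (forall j x, (0 < j < l + l)%N -> expi (th x) * h j (x + alpha) = h j.-1 x) ->
  (forall x, w l%:Z * (expi (th x) * h 0%N (x + alpha)) +
     \sum_(j < l + l) w (l%:Z - 1 - j%:Z) * h j x + (trig_poly v d x - RtoC E) * h l.-1 x = 0) ->
  (forall x, `|phi (x + alpha) - phi x - th x| <= e) ->
  (forall j x, (j < l + l)%N -> cabs (h j x) <= Ch) ->
  (forall j x, (j < l + l)%N -> cabs (tev (G j) x - expi (phi x) * h j x) <= e) ->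
  (forall j m, (j < l + l)%N ->
     cabs (tcoef (G j) m - ee (((l%:Z - 1 - j%:Z)%:~R * (m%:~R * alpha))) * tcoef (G l.-1) m) <= C1 * e) /\
  (forall m, mxnorm (site_vec d (tcoef (G l.-1)) (m + 1) -
     transfer_mx v d (trig_poly w l) E (m%:~R * alpha) *m site_vec d (tcoef (G l.-1)) m) <= C1 * e).
Proof.
move=> d0 l0 vd rv rw Ch0.
pose S := \sum_(j < l + l) cabs (w (l%:Z - 1 - j%:Z)).
pose Vb := \sum_(k < (d + d).+1) cabs (v (k%:Z - d%:Z)).
have S0 : 0 <= S by apply: sumr_ge0 => j _; exact: cabs_ge0.
have Vb0 : 0 <= Vb by apply: sumr_ge0 => j _; exact: cabs_ge0.
pose c2 := cabs (w l%:Z) * (1 + Ch) + S + (Vb + `|E|).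
have c20 : 0 <= c2.
  by rewrite !addr_ge0// mulr_ge0 ?cabs_ge0// addr_ge0 ?ler01.
pose c := 2 + Ch + c2.
have Ch2 : 0 <= 2 + Ch by rewrite addr_ge0.
have c0 : 0 <= c := addr_ge0 Ch2 c20.
pose D := 1 + (cabs (w l%:Z) + S) * (l + l)%:R.
have D0 : 0 <= D by rewrite addr_ge0 ?ler01// mulr_ge0 ?ler0n// addr_ge0 ?cabs_ge0.
have Dv : 0 <= D * c / cabs (v d%:Z) by rewrite !mulr_ge0 ?invr_ge0 ?cabs_ge0.
exists ((l + l)%:R * c + D * c / cabs (v d%:Z)); first by rewrite addr_ge0// mulr_ge0 ?ler0n.
move=> h phi th e G h1 h2 hphi hb hG.
have e0 : 0 <= e := le_trans (normr_ge0 _) (hphi 0).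
have [r1 r2] := conjugated_approx l0 h1 h2 hphi hb (trig_poly_bound v d) hG.
have q1 j x : (0 < j < l + l)%N -> cabs (tev (G j) (x + alpha) - tev (G j.-1) x) <= c * e.
  by move=> jl; apply: le_trans (r1 j x jl) _; rewrite ler_wpM2r// /c lerDl.
have q2 x : cabs (w l%:Z * tev (G 0%N) (x + alpha) +
     \sum_(j < l + l) w (l%:Z - 1 - j%:Z) * tev (G j) x +
     (trig_poly v d x - RtoC E) * tev (G l.-1) x) <= c * e.
  by apply: le_trans (r2 x) _; rewrite -/S -/Vb -/c2 ler_wpM2r// /c lerDr.
split=> [j m jl|m].
  apply: le_trans (coef_telescope m l0 q1 jl) _; rewrite mulrA ler_wpM2r//.
  by rewrite lerDl.
have := dual_transfer d0 vd rv rw (dual_recursion m l0 q1 q2) => /le_trans; apply.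
rewrite [X in _ <= X]mulrDl -/S -/D.
have -> : D * (c * e) / cabs (v d%:Z) = D * c / cabs (v d%:Z) * e by ring.
by rewrite lerDr !mulr_ge0 ?ler0n.
Qed.

(** The second column belongs to the conjugate section, whose multiplier is the inverse one. The
    width 1 + 1 is convertible to 2. *)
Definition dual_plane (d : nat) (P : tpoly) (m : int) : 'M[RR[i]]_(d + d, 1 + 1) :=
  row_mx (site_vec d (tcoef P) m) (site_vec d (tcoef (tconj P)) m).

Lemma dual_plane_mulE d P m (c : 'cV[RR[i]]_2) i :
  (dual_plane d P m *m c) i 0 =
  site_vec d (tcoef P) m i 0 * c 0 0 + site_vec d (tcoef (tconj P)) m i 0 * c 1 0.
Proof.
have -> : dual_plane d P m *m c =
    site_vec d (tcoef P) m *m (\matrix_(a, b) c 0 0) + site_vec d (tcoef (tconj P)) m *m (\matrix_(a, b) c 1 0).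
  rewrite -mul_row_col; congr (_ *m _); apply/matrixP => a b; rewrite ord1.
  case: (split_ordP a) => j ->; rewrite ord1 ?col_mxEu ?col_mxEd mxE; congr (c _ _); exact/val_inj.
by rewrite mxE; congr (_ + _); rewrite mxE big_ord1 [X in _ * X]mxE.
Qed.

(** Conjugation changes the signs of phi and th, so the estimate for one column applies to both. *)
Lemma dual_plane_error (d l : nat) (alpha E Ch : RR) (v w : int -> RR[i]) :
  (0 < d)%N -> (0 < l)%N -> v d%:Z != 0 -> real_valued v d -> real_valued w l -> 0 <= Ch ->
  exists2 C1 : RR, 0 <= C1 &
  forall (h : nat -> RR -> RR[i]) (phi th : RR -> RR) (e : RR) (G : nat -> tpoly),
  (forall j x, (0 < j < l + l)%N -> expi (th x) * h j (x + alpha) = h j.-1 x) ->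
  (forall x, w l%:Z * (expi (th x) * h 0%N (x + alpha)) +
     \sum_(j < l + l) w (l%:Z - 1 - j%:Z) * h j x + (trig_poly v d x - RtoC E) * h l.-1 x = 0) ->
  (forall j x, (0 < j < l + l)%N -> expi (- th x) * ((h j (x + alpha))^*)%C = ((h j.-1 x)^*)%C) ->
  (forall x, w l%:Z * (expi (- th x) * ((h 0%N (x + alpha))^*)%C) +
     \sum_(j < l + l) w (l%:Z - 1 - j%:Z) * ((h j x)^*)%C +
     (trig_poly v d x - RtoC E) * ((h l.-1 x)^*)%C = 0) ->
  (forall x, `|phi (x + alpha) - phi x - th x| <= e) ->
  (forall j x, (j < l + l)%N -> cabs (h j x) <= Ch) ->
  (forall j x, (j < l + l)%N -> cabs (tev (G j) x - expi (phi x) * h j x) <= e) ->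
  [/\ forall j m, (j < l + l)%N ->
     cabs (tcoef (G j) m - ee (((l%:Z - 1 - j%:Z)%:~R * (m%:~R * alpha))) * tcoef (G l.-1) m) <= C1 * e,
  forall j m, (j < l + l)%N ->
     cabs (tcoef (tconj (G j)) m -
       ee (((l%:Z - 1 - j%:Z)%:~R * (m%:~R * alpha))) * tcoef (tconj (G l.-1)) m) <= C1 * e &
  forall m, mxnorm (dual_plane d (G l.-1) (m + 1) -
     transfer_mx v d (trig_poly w l) E (m%:~R * alpha) *m dual_plane d (G l.-1) m) <= C1 * e].
Proof.
move=> d0 l0 vd rv rw Ch0.
have [C1 C10 H] := dual_column_error alpha E d0 l0 vd rv rw Ch0.
exists (2 * C1); first by rewrite mulr_ge0 ?ler0n.
move=> h phi th e G h1 h2 k1 k2 hphi hb hG.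
have e0 : 0 <= e := le_trans (normr_ge0 _) (hphi 0).
have [A1 A2] := H h phi th e G h1 h2 hphi hb hG.
have [|j x jl|j x jl|B1 B2] := H (fun j x => ((h j x)^*)%C) (fun x => - phi x) (fun x => - th x) e
  (fun j => tconj (G j)) k1 k2.
- move=> x; have -> : - phi (x + alpha) - - phi x - - th x = - (phi (x + alpha) - phi x - th x) by ring.
  by rewrite normrN.
- by rewrite cabs_conj; exact: hb.
- by rewrite tev_conj -conj_expi -conjM -conjB cabs_conj; exact: hG.
have C12 : C1 * e <= 2 * C1 * e by rewrite -mulrA mulrDl mul1r lerDl mulr_ge0.
split=> [j m jl|j m jl|m].
- exact: le_trans (A1 j m jl) C12.
- exact: le_trans (B1 j m jl) C12.
rewrite /dual_plane mul_mx_row opp_row_mx add_row_mx mxnorm_row_mx.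
by apply: le_trans (lerD (A2 m) (B2 m)) _; rewrite -mulrA mulrDl mul1r.
Qed.

(* If every Fourier coefficient with |m| <= M were small, the solution evaluated at 0 would be,
   contradicting the symplectic normalization of F. *)
Lemma dual_plane_mass (d l M : nat) (alpha r e e2 B phi0 : RR) (w : int -> RR[i])
    (F : 'M[RR]_(l + l, 2)) (G : nat -> tpoly) :
  (0 < d)%N -> 1 <= r -> in_Sp w l F ->
  (forall j, (j < l + l)%N -> cabs (tev (G j) 0 - expi phi0 * rot_section 1 F j) <= e) ->
  (forall j m, (j < l + l)%N ->
     cabs (tcoef (G j) m - ee (((l%:Z - 1 - j%:Z)%:~R * (m%:~R * alpha))) * tcoef (G l.-1) m) <= e2) ->
  (forall j m, (j < l + l)%N ->
     cabs (tcoef (tconj (G j)) m -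
       ee (((l%:Z - 1 - j%:Z)%:~R * (m%:~R * alpha))) * tcoef (tconj (G l.-1)) m) <= e2) ->
  (forall j, (j < l + l)%N -> tnorm r (G j) <= B) ->
  mxnorm (map_mx RtoC F) * mxnorm (S_mx w l) * (l + l)%:R * ((M + M).+1%:R * e2 + B / r ^+ M + e) <= 1 / 2 ->
  forall c : 'cV_2, exists2 m : int, (`|m| <= M)%N &
    mxnorm c <= 4 * (mxnorm (map_mx RtoC F) * mxnorm (S_mx w l) * (l + l)%:R) * M.+1%:R *
      mxnorm (dual_plane d (G l.-1) m *m c).
Proof.
move=> d0 r1 FS hG T1 T2 tG small c.
set kap := mxnorm _ * mxnorm _ in small *.
have kap0 : 0 <= kap by rewrite mulr_ge0 ?mxnorm_ge0.
pose a := c 0 0; pose b := c 1 0; pose im : RR[i] := 0 +i* 1.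
have cE : mxnorm c = cabs a + cabs b by exact: mxnorm_cV2.
(* The conjugates match the one in [site_vec]. The vector y below satisfies F y = A f + A' f', with
   f the section and f' its conjugate, and the values at 0 of the polynomials Y approximate its
   entries. *)
pose A := (a^*)%C * expi phi0; pose A' := (b^*)%C * expi (- phi0).
pose Y j : tpoly := tscale (a^*)%C (G j) ++ tscale (b^*)%C (tconj (G j)).
pose y : 'cV[RR[i]]_2 := \col_k (if k == 0 then A + A' else - im * (A - A')).
have imE : cabs im = 1 by rewrite /im /Normc.normc /= expr0n expr1n add0r sqrtr1.
have cA : cabs A = cabs a by rewrite cabsM cabs_expi cabs_conj mulr1.
have cA' : cabs A' = cabs b by rewrite cabsM cabs_expi cabs_conj mulr1.
have rsE (i : 'I_(l + l)) : rot_section 1 F i = RtoC (F i 0) - im * RtoC (F i 1).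
  by rewrite rot_sectionE mul1r; apply/eqP; rewrite eq_complex /=; apply/andP; split; apply/eqP; ring.
have rsE' (i : 'I_(l + l)) : ((rot_section 1 F i)^*)%C = RtoC (F i 0) + im * RtoC (F i 1).
  by rewrite rot_sectionE mul1r; apply/eqP; rewrite eq_complex /=; apply/andP; split; apply/eqP; ring.
have Fy (i : 'I_(l + l)) : (map_mx RtoC F *m y) i 0 =
    A * rot_section 1 F i + A' * ((rot_section 1 F i)^*)%C.
  rewrite mxE !big_ord_recl big_ord0 addr0 !mxE rsE' rsE /=.
  have -> : lift ord0 ord0 = 1 :> 'I_2 by apply/val_inj.
  ring.
(* The normalization writes J y as the adjoint of F times S F y, and the norm of J y is |A + A'| +
   |A - A'| >= |A| + |A'|, the norm of c. *)
have c_le_y : mxnorm c <= kap * mxnorm (map_mx RtoC F *m y).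
  apply: (@le_trans _ _ (mxnorm (map_mx RtoC Jmx *m y))).
    rewrite cE mxnorm_cV2 !mxE !big_ord_recl !big_ord0 !mxE /= !addr0.
    have -> : RtoC 0 = 0 by []. have -> : RtoC 1 = 1 by [].
    have -> : RtoC (-1) = -1 by apply/eqP; rewrite eq_complex /= oppr0 !eqxx.
    rewrite !mul0r add0r addr0 mul1r mulN1r !mulNr !cabsN cabsM imE mul1r -cA -cA'.
    have p1 : cabs (A + A') + cabs (A - A') >= 2 * cabs A.
      apply: le_trans (cabsD _ _); have -> : A + A' + (A - A') = RtoC 2 * A.
        have -> : RtoC 2 = 2 :> RR[i] by apply/eqP; rewrite eq_complex /= addr0 !eqxx.
        ring.
      by rewrite cabsM cabs_RtoC ger0_norm.
    have p2 : cabs (A + A') + cabs (A - A') >= 2 * cabs A'.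
      apply: le_trans (cabsB _ _); have -> : A + A' - (A - A') = RtoC 2 * A'.
        have -> : RtoC 2 = 2 :> RR[i] by apply/eqP; rewrite eq_complex /= addr0 !eqxx.
        ring.
      by rewrite cabsM cabs_RtoC ger0_norm.
    by move: p1 p2; move: (cabs A) (cabs A') (cabs _) (cabs _) => u1 u2 u3 u4; clear; lra.
  rewrite -FS -!mulmxA; apply: le_trans (mxnormM _ _) _; rewrite mxnorm_adj -mulrA.
  by rewrite ler_wpM2l ?mxnorm_ge0//; exact: mxnormM.
clearbody kap.
have e0 : 0 <= mxnorm c := mxnorm_ge0 c.
have Y0 (i : 'I_(l + l)) : cabs ((map_mx RtoC F *m y) i 0) <= cabs (tev (Y i) 0) + e * mxnorm c.
  have -> : (map_mx RtoC F *m y) i 0 = tev (Y i) 0 - (tev (Y i) 0 - (map_mx RtoC F *m y) i 0) by ring.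
  apply: le_trans (cabsB _ _) _; rewrite lerD2l.
  have -> : tev (Y i) 0 - (map_mx RtoC F *m y) i 0 =
     (a^*)%C * (tev (G i) 0 - expi phi0 * rot_section 1 F i) +
     (b^*)%C * ((tev (G i) 0 - expi phi0 * rot_section 1 F i)^*)%C.
    by rewrite /Y tev_cat !tev_scale tev_conj Fy /A /A' conjB conjM conj_expi; ring.
  apply: le_trans (cabsD _ _) _; rewrite !cabsM !cabs_conj -mulrDl -cE mulrC ler_wpM2r//.
  by apply: hG.
pose ym m := cabs (tcoef (Y l.-1) m).
have Ym (i : 'I_(l + l)) m : cabs (tcoef (Y i) m) <= ym m + e2 * mxnorm c.
  set ph := ee ((l%:Z - 1 - i%:Z)%:~R * (m%:~R * alpha)).
  have -> : tcoef (Y i) m = ph * tcoef (Y l.-1) m + ((a^*)%C * (tcoef (G i) m - ph * tcoef (G l.-1) m) +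
     (b^*)%C * (tcoef (tconj (G i)) m - ph * tcoef (tconj (G l.-1)) m)).
    by rewrite /Y !tcoef_cat !tcoef_scale; ring.
  apply: le_trans (cabsD _ _) _; rewrite cabsM cabs_ee mul1r lerD2l.
  apply: le_trans (cabsD _ _) _; rewrite !cabsM !cabs_conj cE mulrDr [e2 * cabs a]mulrC [e2 * cabs b]mulrC.
  by apply: lerD; rewrite ler_wpM2l ?cabs_ge0//; [apply: T1|apply: T2].
have tY (i : 'I_(l + l)) : tnorm r (Y i) <= B * mxnorm c.
  rewrite /Y tnorm_cat !tnorm_scale tnorm_conj !cabs_conj -mulrDl -cE mulrC.
  by rewrite ler_wpM2r//; exact: tG.
have r0 : 0 < r := lt_le_trans ltr01 r1.
pose Sy := \sum_(k < (M + M).+1) ym (k%:Z - M%:Z).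
have per (i : 'I_(l + l)) : cabs ((map_mx RtoC F *m y) i 0) <=
    Sy + ((M + M).+1%:R * e2 + B / r ^+ M + e) * mxnorm c.
  apply: le_trans (Y0 i) _; rewrite !mulrDl !addrA lerD2r.
  apply: le_trans (tev_le_tcoef (Y i) 0 M r1) _; apply: lerD; last first.
    by rewrite mulrAC ler_wpM2r ?invr_ge0 ?exprn_ge0 ?(ltW r0).
  apply: (@le_trans _ _ (\sum_(k < (M + M).+1) (ym (k%:Z - M%:Z) + e2 * mxnorm c))).
    by apply: ler_sum => k _; exact: Ym.
  by rewrite big_split /= sumr_const card_ord -[X in _ <= _ + X]mulrA mulr_natl.
have tot : mxnorm c <= kap * (l + l)%:R * Sy + kap * (l + l)%:R * ((M + M).+1%:R * e2 + B / r ^+ M + e) * mxnorm c.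
  apply: le_trans c_le_y _; rewrite -!mulrA -mulrDr ler_wpM2l//.
  rewrite {1}/mxnorm; apply: (@le_trans _ _ (\sum_(i < l + l) (Sy + ((M + M).+1%:R * e2 + B / r ^+ M + e) * mxnorm c))).
    by apply: ler_sum => i _; rewrite big_ord1; exact: per.
  by rewrite sumr_const card_ord -mulrDr [X in _ <= X]mulr_natl.
have half : mxnorm c <= 2 * (kap * (l + l)%:R) * Sy.
  have X (x s t k : RR) : x <= k * s + t -> t <= 1 / 2 * x -> x <= 2 * k * s by clear => *; lra.
  exact: X tot (ler_wpM2r e0 small).
(* The entry d - 1 of the site vector at m is the conjugate of the coefficient at m itself. *)
have yZ m : ym m <= mxnorm (dual_plane d (G l.-1) m *m c).
  have hd : (d.-1 < d + d)%N by rewrite (leq_trans _ (leq_addr d d))// prednK.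
  suff zE : (dual_plane d (G l.-1) m *m c) (Ordinal hd) 0 = ((tcoef (Y l.-1) m)^*)%C.
    by rewrite /ym -cabs_conj -zE; exact: mxnorm_entry.
  rewrite /Y tcoef_cat !tcoef_scale conjD !conjM !conjcK.
  rewrite dual_plane_mulE !mxE /=.
  have -> : m + d%:Z - 1 - d.-1%:Z = m by move: d0; clear; lia.
  by rewrite mulrC [X in _ + X]mulrC.
have [c0|c0] := eqVneq c 0; first by exists 0%Z => //; rewrite c0 mulmx0 !mxnorm0 mulr0.
apply: contrapT => N.
(* Summing over 2 M + 1 < 2 (M + 1) sites contradicts [half]; this fixes the constant 4 and the
   factor M + 1. *)
have lt m : (`|m| <= M)%N -> 4 * (kap * (l + l)%:R) * M.+1%:R * ym m < mxnorm c.
  move=> mM; rewrite ltNge; apply/negP => h; apply: N; exists m => //; apply: le_trans h _.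
  by rewrite ler_wpM2l ?yZ// !mulr_ge0 ?ler0n.
have K0 : 0 <= kap * (l + l)%:R by rewrite mulr_ge0 ?ler0n.
have : M.+1%:R * mxnorm c < M.+1%:R * mxnorm c; last by rewrite ltxx.
have := ler_wpM2l (ler0n _ M.+1) half => /le_lt_trans; apply.
have -> : M.+1%:R * (2 * (kap * (l + l)%:R) * Sy) =
   1 / 2 * \sum_(k < (M + M).+1) 4 * (kap * (l + l)%:R) * M.+1%:R * ym (k%:Z - M%:Z).
  by rewrite -mulr_sumr -/Sy; field.
have cp : 0 < mxnorm c by rewrite mxnorm_gt0.
apply: (@le_lt_trans _ _ (1 / 2 * ((M + M).+1%:R * mxnorm c))).
  apply: (@le_trans _ _ (1 / 2 * \sum_(k < (M + M).+1) mxnorm c)); last first.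
    by rewrite sumr_const card_ord [X in _ <= _ * X]mulr_natl.
  rewrite ler_wpM2l//; apply: ler_sum => k _; apply: ltW.
  by apply: lt; have := ltn_ord k; clear; lia.
rewrite [X in X < _](mulrA (1 / 2)) ltr_pM2r//.
have -> : (M + M).+1%:R = M%:R + M%:R + 1 :> RR by rewrite -natr1 natrD.
rewrite -[M.+1%:R]natr1.
by have := ler0n RR M; clear; move: (M%:R) => z; lra.
Qed.

(** * Choice of the parameters and conclusion *)

(** For l = 0 the product would vanish, whereas J does not. *)
Lemma in_Sp_pos (w : int -> RR[i]) (l : nat) (F : 'M[RR]_(l + l, 2)) : in_Sp w l F -> (0 < l)%N.
Proof.
case: l F => // F /matrixP/(_ 0 1); rewrite !mxE /= big1 => [|[]//].
by move=> /(congr1 (@complex.Re RR))/eqP; rewrite /= eq_sym oner_eq0.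
Qed.

(** With k = d + 1 and n = 2 d this excludes d = 0. *)
Lemma dominated_dim (n : nat) (alpha : RR) (A : RR -> 'M[RR[i]]_n) (k : nat) :
  dominated alpha A k -> (k <= n)%N.
Proof.
move=> [Pp [Pm [_ [_ [_ [_ [_ [rk _]]]]]]]].
by have [<- _] := rk 0; exact: rank_leq_col.
Qed.

(** As q r < 1, the weighted norms of the approximants stay bounded when the degree grows; growth
    will come from the exponential of the corrector only. *)
Lemma rot_section_approx (l : nat) (H : RR -> 'M[RR]_(l + l, 2)) (C q r : RR) :
  0 <= C -> 0 < q -> 1 <= r -> q * r < 1 ->
  (forall i k (K : nat), exists2 a : int -> RR[i],
     (forall k : int, (`|k| <= K)%N -> cabs (a k) <= C * q ^+ `|k|%N) &
     forall x : RR, cabs (RtoC (H x i k) - trig_poly a K x) <= C * q ^+ K) ->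
  exists2 Ch : RR, 0 <= Ch & (forall j x, cabs (rot_section 1 (H x) j) <= Ch) /\
    forall K : nat, exists2 B : nat -> tpoly, (forall j, tnorm r (B j) <= Ch) &
      forall j x, cabs (rot_section 1 (H x) j - tev (B j) x) <= Ch * q ^+ K.
Proof.
move=> C0 q0 r1 qr1 HF.
pose Cf := 2 * C / (1 - q * r).
have Cf0 : 0 <= Cf by rewrite !mulr_ge0// invr_ge0 subr_ge0 ltW.
pose Ch := 2 * (C + Cf).
have Ch0 : 0 <= Ch by rewrite mulr_ge0// addr_ge0.
have app K : exists2 B : nat -> tpoly, (forall j, tnorm r (B j) <= 2 * Cf) &
      forall j x, cabs (rot_section 1 (H x) j - tev (B j) x) <= 2 * C * q ^+ K.
  have X (j : nat) : exists P : tpoly, tnorm r P <= 2 * Cf /\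
      forall x, cabs (rot_section 1 (H x) j - tev P x) <= 2 * C * q ^+ K.
    case: (ltnP j (l + l)) => jl; last first.
      exists [::]; split; first by rewrite /tnorm big_nil mulr_ge0.
      move=> x; rewrite /rot_section insubF ?ltnNge ?jl// /tev big_nil subrr cabs0.
      by rewrite !mulr_ge0// exprn_ge0// ltW.
    have [a a1 a2] := HF (Ordinal jl) 0 K; have [a' a1' a2'] := HF (Ordinal jl) 1 K.
    exists (tpoly_of a K ++ tscale (0 +i* (-1)) (tpoly_of a' K)); split.
      rewrite tnorm_cat tnorm_scale.
      have -> : cabs (0 +i* (-1) : RR[i]) = 1 by rewrite /Normc.normc /= expr0n sqrrN expr1n add0r sqrtr1.
      rewrite mul1r mulr_natl mulr2n; apply: lerD; exact: tnorm_tpoly_of.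
    move=> x; rewrite tev_cat tev_scale !tev_of -[j]/(val (Ordinal jl)) rot_sectionE mul1r.
    have -> : (H x (Ordinal jl) 0 +i* (- H x (Ordinal jl) 1)) -
       (trig_poly a K x + (0 +i* (-1)) * trig_poly a' K x) =
      (RtoC (H x (Ordinal jl) 0) - trig_poly a K x) + (0 +i* (-1)) * (RtoC (H x (Ordinal jl) 1) - trig_poly a' K x).
      rewrite mulrBr.
      have -> : H x (Ordinal jl) 0 +i* (- H x (Ordinal jl) 1) =
         RtoC (H x (Ordinal jl) 0) + (0 +i* (-1)) * RtoC (H x (Ordinal jl) 1).
        by apply/eqP; rewrite eq_complex /=; apply/andP; split; apply/eqP; ring.
      ring.
    apply: le_trans (cabsD _ _) _; rewrite cabsM.
    have -> : cabs (0 +i* (-1) : RR[i]) = 1 by rewrite /Normc.normc /= expr0n sqrrN expr1n add0r sqrtr1.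
    rewrite mul1r -mulrA mulr_natl mulr2n; exact: lerD.
  have [B HB] := boolp.choice X.
  by exists B => [j|j x]; [case: (HB j)|case: (HB j)].
exists Ch => //; split=> [j x|K].
  have [B B1 B2] := app 0%N.
  have := B2 j x; rewrite expr0 mulr1 => h.
  have -> : rot_section 1 (H x) j = (rot_section 1 (H x) j - tev (B j) x) + tev (B j) x by rewrite subrK.
  apply: le_trans (cabsD _ _) _; rewrite /Ch mulrDr; apply: lerD => //.
  exact: le_trans (tev_le_tnorm _ _ r1) (B1 j).
have [B B1 B2] := app K; exists B => [j|j x].
  by apply: le_trans (B1 j) _; rewrite /Ch mulrDr lerDr mulr_ge0.
apply: le_trans (B2 j x) _; rewrite ler_wpM2r ?exprn_ge0 ?(ltW q0)//.
by rewrite /Ch mulrDr lerDl mulr_ge0.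
Qed.

(** The window of [site_vec] displaces the frequency by at most d, which costs the factor r^d. *)
Lemma dual_plane_decay (d : nat) (P : tpoly) (r T : RR) (m : int) : 1 <= r -> tnorm r P <= T ->
  mxnorm (dual_plane d P m) <= 2 * (d + d)%:R * r ^+ d * T * r^-1 ^+ `|m|%N.
Proof.
move=> r1 PT; have r0 : 0 < r := lt_le_trans ltr01 r1.
have T0 : 0 <= T := le_trans (tnorm_ge0 _ (ltW r0)) PT.
have col (Q : tpoly) : tnorm r Q <= T ->
    mxnorm (site_vec d (tcoef Q) m) <= (d + d)%:R * (r ^+ d * T * r^-1 ^+ `|m|%N).
  move=> QT; rewrite /mxnorm.
  apply: (@le_trans _ _ (\sum_(i < d + d) r ^+ d * T * r^-1 ^+ `|m|%N)); last first.
    by rewrite sumr_const card_ord [X in _ <= X]mulr_natl.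
  apply: ler_sum => i _; rewrite big_ord1 mxE cabs_conj.
  set k := m + _ - _ - _.
  have km : (`|m| <= `|k| + d)%N by rewrite /k; have := ltn_ord i; clear; lia.
  have := le_trans (tcoef_le_tnorm Q k r1) QT; rewrite -ler_pdivlMr ?exprn_gt0// => h.
  apply: le_trans h _; rewrite exprVn ler_pdivlMr ?exprn_gt0//.
  rewrite mulrAC ler_pdivrMr ?exprn_gt0// [X in _ <= X]mulrAC mulrC -exprD addnC.
  by rewrite ler_wpM2r// ler_weXn2l.
rewrite /dual_plane mxnorm_row_mx.
apply: le_trans (lerD (col P PT) (col (tconj P) _)) _; first by rewrite tnorm_conj.
rewrite -mulr2n -mulr_natl le_eqVlt; apply/orP; left; apply/eqP; ring.
Qed.

(** An accuracy (1 / 4)^M leaves (1 / 2)^M once the 2 M + 1 coefficients are paid, and the tail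
    beyond M is of order (b / r)^M; both are below t^M. *)
Lemma mass_numeric (kap e c3 C1 Ch b r t : RR) (M : nat) :
  0 <= kap -> 0 <= c3 -> 0 <= C1 -> 0 <= Ch -> 0 <= b -> 0 < r -> 1 / 2 <= t -> b / r <= t ->
  e <= c3 * (1 / 4) ^+ M ->
  kap * (8 * C1 * c3 + Ch * b + c3) * t ^+ M <= 1 / 2 ->
  kap * ((M + M).+1%:R * (C1 * e) + Ch * b ^+ M.+1 / r ^+ M + e) <= 1 / 2.
Proof.
move=> k0 c30 C10 Ch0 b0 r0 ht hbr he hs; apply: le_trans hs; rewrite -[X in _ <= X]mulrA; apply: ler_wpM2l => //.
have h1 : (1 / 2) ^+ M <= t ^+ M.
  by apply: lerXn2r => //; rewrite nnegrE ?divr_ge0// (le_trans _ ht)// divr_ge0.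
have h2 : (b / r) ^+ M <= t ^+ M.
  apply: lerXn2r => //; rewrite nnegrE; first by rewrite divr_ge0// ltW.
  by apply: le_trans ht; rewrite divr_ge0.
have e2 : (1 / 4) ^+ M = (1 / 2) ^+ M * (1 / 2) ^+ M :> RR.
  by rewrite -exprMn; congr (_ ^+ _); field.
have p0 : 0 <= (1 / 2) ^+ M :> RR by rewrite exprn_ge0// divr_ge0.
have p1 : (1 / 2) ^+ M <= 1 :> RR by apply: exprn_ile1; lra.
have s : (M + M).+1%:R * (1 / 2) ^+ M <= 8 :> RR.
  apply: (@le_trans _ _ ((8 * 2 ^ M)%:R * (1 / 2) ^+ M)).
    rewrite ler_wpM2r// ler_nat; have := sqr_le_expn2 M; clear; move: (2 ^ M)%N => z; nia.
  rewrite natrM natrX -mulrA -exprMn.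
  have -> : 2 * (1 / 2) = 1 :> RR by field.
  by rewrite expr1n mulr1.
have a1 : (M + M).+1%:R * (C1 * e) <= 8 * C1 * c3 * t ^+ M.
  apply: (@le_trans _ _ ((M + M).+1%:R * (C1 * (c3 * ((1 / 2) ^+ M * (1 / 2) ^+ M))))).
    by rewrite ler_wpM2l// ler_wpM2l// -e2.
  have -> : (M + M).+1%:R * (C1 * (c3 * ((1 / 2) ^+ M * (1 / 2) ^+ M))) =
    ((M + M).+1%:R * (1 / 2) ^+ M) * (C1 * c3 * (1 / 2) ^+ M) :> RR by ring.
  have -> : 8 * C1 * c3 * t ^+ M = 8 * (C1 * c3 * t ^+ M) by ring.
  by apply: ler_pM => //; rewrite ?mulr_ge0// ler_wpM2l// mulr_ge0.
have a2 : Ch * b ^+ M.+1 / r ^+ M <= Ch * b * t ^+ M.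
  have -> : Ch * b ^+ M.+1 / r ^+ M = Ch * b * (b / r) ^+ M by rewrite exprS exprMn exprVn; ring.
  by rewrite ler_wpM2l// mulr_ge0.
have a3 : e <= c3 * t ^+ M.
  apply: le_trans he _; rewrite ler_wpM2l//; apply: le_trans h1; rewrite e2.
  by rewrite -[X in _ <= X]mulr1 ler_wpM2l.
rewrite [X in _ <= X]mulrDl [X in _ <= X + _]mulrDl; exact: lerD (lerD a1 a2) a3.
Qed.

Theorem theorem6p1 (alpha E : RR) (d l : nat) (vhat what : int -> RR[i]) :
  irrational alpha ->
  vhat d%:Z != 0 -> what l%:Z != 0 ->
  real_valued vhat d -> real_valued what l ->
  (exists (H : RR -> 'M[RR]_(l + l, 2)) (psi : RR -> RR),
     (forall i j, real_analytic (fun x => H x i j)) /\ periodic1 H /\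
     (forall x, in_Sp what l (H x)) /\
     real_analytic psi /\ periodic1 psi /\
     (\int[@lebesgue_measure RR]_(x in `[0%R, 1%R]) (psi x)%:E = 0)%E /\
     (forall x, transfer_mx what l (trig_poly vhat d) E x *m map_mx RtoC (H x)
                = map_mx RtoC (H (x + alpha) *m rotmx (psi x)))) ->
  ~ PH2 d alpha (transfer_mx vhat d (trig_poly what l) E).
Proof.
move=> ia vd wl rv rw [H [psi [Ha [Hp [HS [psa [psp [ipsi Heq]]]]]]]] [_ dom].
have l0 := in_Sp_pos (HS 0).
have d0 : (0 < d)%N by have := dominated_dim dom; clear; lia.
pose g (i : option ('I_(l + l) * 'I_2)) : RR -> RR := if i is Some (a, b) then fun x => H x a b else psi.
have ga i : real_analytic (g i) by case: i => [[a b]|]; [exact: Ha|].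
have gp i : periodic1 (g i) by case: i => [[a b] x|]; [rewrite /= Hp|].
have [C C0 [q /andP[q0 q1] HF]] := fourier_approx_family ga gp.
have q1' : 0 < 1 + q by rewrite addr_gt0.
(* A weight strictly between 1 and 1 / q, summable against the Fourier decay q. *)
pose r := 2 / (1 + q).
have r1 : 1 < r by rewrite ltr_pdivlMr// mul1r; lra.
have qr1 : q * r < 1 by rewrite mulrA ltr_pdivrMr// mul1r; lra.
have r0 : 0 < r := lt_trans ltr01 r1.
have r1' := ltW r1.
clearbody r.
(* b exceeds 1, which leaves room for the exponential of the corrector, and stays below r, which
   keeps the tail (b / r)^M small. *)
pose b := (1 + r) / 2.
have b1 : 1 < b by rewrite /b; lra.
have br : b < r by rewrite /b; lra.
clearbody b.
have b0 : 0 < b := lt_trans ltr01 b1.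
pose rho := r^-1.
have rho0 : 0 < rho by rewrite invr_gt0.
have rho1 : rho < 1 by rewrite invf_lt1.
have qrho : q <= rho by rewrite -[rho]mul1r ler_pdivlMr// ltW.
have [Ch Ch0 [Hb Happ]] := rot_section_approx C0 q0 r1' qr1 (fun i k => HF (Some (i, k))).
have [C1 C10 Hdual] := dual_plane_error alpha E d0 l0 vd rv rw Ch0.
have cpsi := analytic_continuous psa psp.
have p0 : 0 < (pi : RR) := pi_gt0 _.
pose Ce := 4 * pi * C + 2 * Ch.
have pC : 0 <= 4 * pi * C by rewrite !mulr_ge0// ltW.
have Ce0 : 0 <= Ce by rewrite addr_ge0// mulr_ge0.
(* The division by q compensates the exponent K - 1 of the errors. *)
pose c3 := Ce / q.
have c30 : 0 <= c3 by rewrite divr_ge0// ltW.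
pose kap := mxnorm (map_mx RtoC (H 0)) * mxnorm (S_mx what l) * (l + l)%:R.
have kap0 : 0 <= kap by rewrite !mulr_ge0 ?mxnorm_ge0.
pose Dc := 2 * (d + d)%:R * r ^+ d * (Ch * b).
have Dc0 : 0 <= Dc by rewrite !mulr_ge0 ?exprn_ge0// ltW.
pose Ct := C1 * c3 + Dc + 4 * kap + 1.
have Ct1 : C1 * c3 <= Ct.
  by rewrite /Ct -!addrA lerDl !addr_ge0// mulr_ge0.
have Ct2 : Dc <= Ct.
  rewrite /Ct -[X in X + _ + _]addrC -!addrA lerDl !addr_ge0// mulr_ge0//.
have Ct3 : 4 * kap <= Ct.
  by rewrite /Ct [X in _ <= X]addrAC [X in _ <= X]addrC lerDl !addr_ge0// mulr_ge0.
have Ct0 : 0 < Ct by rewrite /Ct ltr_wpDl// !addr_ge0// mulr_ge0.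
have wC (x : RR) : ((trig_poly what l x)^*)%C = trig_poly what l x by exact: real_trig_poly_fix.
have [L HL] := transfer_bound vhat what d l E.
have sym x := transfer_symplectic E vd d0 rv (wC x).
have cA : mcont (transfer_mx vhat d (trig_poly what l) E) by exact: mcont_transfer.
have pA : periodic1 (transfer_mx vhat d (trig_poly what l) E) by exact: transfer_periodic.
move: dom; apply: (no_localized_planes cA pA HL (S_mx_unit vd) sym Ct0 b0 rho0 rho1).
move=> P M0.
have [P0 HP0] := @exprn_eventually_lt RR rho (1 / 4) (ltW rho0) rho1 ltac:(lra).
(* P0 provides the accuracy (1 / 4)^M needed for the mass, and the successor keeps the divisor of K
   positive. *)
pose P1 := (P + P0).+1.
have rP1 : rho ^+ P1 <= 1 / 4 by apply: ltW; apply: HP0; rewrite /P1; clear; lia.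
pose t := Num.max (1 / 2) (b / r).
have t1 : t < 1 by rewrite gt_max; apply/andP; split; [lra|rewrite ltr_pdivrMr// mul1r].
have th : 1 / 2 <= t by rewrite le_max lexx.
have tbr : b / r <= t by rewrite le_max lexx orbT.
have t0 : 0 <= t by apply: le_trans th; rewrite divr_ge0.
clearbody t.
pose D := kap * (8 * C1 * c3 + Ch * b + c3).
have D0 : 0 <= D.
  exact: mulr_ge0 kap0 (addr_ge0 (addr_ge0 (mulr_ge0 (mulr_ge0 (ler0n _ 8) C10) c30) (mulr_ge0 Ch0 (ltW b0))) c30).
have D1 : 0 < D + 1 by rewrite ltr_wpDl.
have [M2 HM2] := exprn_eventually_lt t0 t1 (divr_gt0 (divr_gt0 ltr01 (ltr0n RR 2)) D1).
pose M3 := maxn M0 M2.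
have P1p : 0 < P1%:R :> RR by rewrite ltr0n.
(* As K <= P1 (M + 1), this yields exp (s K) <= b^(M + 1): the growth rate b of the norms does not
   depend on P. *)
pose s := ln b / P1%:R.
have s0 : 0 < s by rewrite divr_gt0// ln_gt0.
have [K KK [Phi Phi1 Phi2]] := @cohomological_approx alpha psi C q r s (P1 * M3)%N
  ia cpsi ipsi C0 q0 r1' qr1 s0 (HF None).
pose M := (K %/ P1)%N.
have MM3 : (M3 <= M)%N by rewrite leq_divRL// mulnC.
have KM : (P1 * M <= K)%N by rewrite mulnC leq_trunc_div.
have KM1 : (K <= P1 * M.+1)%N by rewrite ltnW// mulnC ltn_ceil.
exists M; first by apply: leq_trans MM3; rewrite leq_maxl.
have [Ex Ex1 Ex2] := @expi_tpoly_approx r Phi (q ^+ K.-1) r1' (exprn_gt0 _ q0).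
have [B B1 B2] := Happ K.-1.
pose G j := tmul Ex (B j).
pose T := Ch * b ^+ M.+1.
have expPhi : expR (tnorm r Phi) <= b ^+ M.+1.
  rewrite -[b]lnK ?posrE// -expRM_natl ler_expR; apply: le_trans Phi1 _.
  rewrite [X in _ <= X]mulrC /s -mulrA ler_wpM2l ?ln_ge0 ?(ltW b1)//.
  by rewrite ler_pdivrMl// -natrM ler_nat.
have GT j : tnorm r (G j) <= T.
  rewrite /G /T; apply: le_trans (tnorm_mul _ _ r1') _; rewrite mulrC.
  by apply: ler_pM; rewrite ?tnorm_ge0 ?(ltW r0)//; apply: le_trans Ex1 _.
pose e := Ce * q ^+ K.-1.
have qK0 : 0 <= q ^+ K.-1 by rewrite exprn_ge0// ltW.
pose phi x := complex.Re (tev Phi x).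
have Ge j x : (j < l + l)%N -> cabs (tev (G j) x - expi (phi x) * rot_section 1 (H x) j) <= e.
  move=> _; rewrite /G (tev_mul Ex).
  have -> : tev Ex x * tev (B j) x - expi (phi x) * rot_section 1 (H x) j =
     (tev Ex x - expi (phi x)) * tev (B j) x - expi (phi x) * (rot_section 1 (H x) j - tev (B j) x) by ring.
  apply: le_trans (cabsB _ _) _; rewrite !cabsM cabs_expi mul1r.
  have a1 : cabs (tev Ex x - expi (phi x)) * cabs (tev (B j) x) <= q ^+ K.-1 * Ch.
    by apply: ler_pM; rewrite ?cabs_ge0//; apply: le_trans (tev_le_tnorm _ _ r1') _.
  apply: le_trans (lerD a1 (B2 j x)) _.
  have -> : q ^+ K.-1 * Ch + Ch * q ^+ K.-1 = 2 * Ch * q ^+ K.-1 by ring.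
  by rewrite /e ler_wpM2r// /Ce lerDr.
have phie x : `|phi (x + alpha) - phi x - 2 * pi * psi x| <= e.
  by apply: le_trans (Phi2 x) _; rewrite /e ler_wpM2r// /Ce lerDl mulr_ge0.
have e3 : e <= c3 * rho ^+ (P1 * M).
  rewrite /e /c3 -mulrA ler_wpM2l//.
  have [K1|K1] := posnP K.
    have -> : (P1 * M = 0)%N by move: KM; rewrite K1 leqn0 => /eqP.
    by rewrite K1 expr0 mulr1 invf_ge1// ltW.
  apply: (@le_trans _ _ (q^-1 * rho ^+ K)); last first.
    rewrite ler_wpM2l ?invr_ge0 ?(ltW q0)//; apply: ler_wiXn2l => //; exact: ltW.
  rewrite ler_pdivlMl// -exprS prednK//; apply: lerXn2r; rewrite ?nnegrE ?(ltW q0) ?(ltW rho0)//.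
have s1 : (1 : RR) = 1 \/ (1 : RR) = -1 by left.
have s2 : (-1 : RR) = 1 \/ (-1 : RR) = -1 by right.
have R1 x := rot_section_rows l0 wl s1 (Heq x).
have R2 x := rot_section_rows l0 wl s2 (Heq x).
have h1 j x : (0 < j < l + l)%N ->
    expi (2 * pi * psi x) * rot_section 1 (H (x + alpha)) j = rot_section 1 (H x) j.-1.
  by move=> jl; have [/(_ j jl) + _] := R1 x; rewrite mul1r.
have h2 x := (R1 x).2.
have h3 j x : (0 < j < l + l)%N ->
    expi (- (2 * pi * psi x)) * ((rot_section 1 (H (x + alpha)) j)^*)%C = ((rot_section 1 (H x) j.-1)^*)%C.
  by move=> jl; have [/(_ j jl) + _] := R2 x; rewrite mulN1r !rot_section_conj.
have h4 x : what l%:Z * (expi (- (2 * pi * psi x)) * ((rot_section 1 (H (x + alpha)) 0%N)^*)%C) +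
     \sum_(j < l + l) what (l%:Z - 1 - j%:Z) * ((rot_section 1 (H x) j)^*)%C +
     (trig_poly vhat d x - RtoC E) * ((rot_section 1 (H x) l.-1)^*)%C = 0.
  have [_ R] := R2 x; rewrite -[RHS]R mulN1r !rot_section_conj; congr (_ + _ + _).
  by apply: eq_bigr => j _; rewrite rot_section_conj.
have h2' x : what l%:Z * (expi (2 * pi * psi x) * rot_section 1 (H (x + alpha)) 0%N) +
     \sum_(j < l + l) what (l%:Z - 1 - j%:Z) * rot_section 1 (H x) j +
     (trig_poly vhat d x - RtoC E) * rot_section 1 (H x) l.-1 = 0.
  by have := h2 x; rewrite mul1r.
have [T1 T2 err] := Hdual (fun j x => rot_section 1 (H x) j) phi (fun x => 2 * pi * psi x) e G
   h1 h2' h3 h4 phie (fun j x _ => Hb j x) Ge.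
exists (dual_plane d (G l.-1)); split=> [m|m|c].
- apply: le_trans (err m) _; apply: (@le_trans _ _ (C1 * c3 * rho ^+ (P * M))).
    rewrite -mulrA ler_wpM2l//; apply: le_trans e3 _; rewrite ler_wpM2l//.
    apply: ler_wiXn2l; rewrite ?(ltW rho0) ?(ltW rho1)//.
    by rewrite leq_mul2r /P1 leqW ?leq_addr ?orbT.
  by rewrite ler_wpM2r ?exprn_ge0 ?(ltW rho0).
- apply: le_trans (dual_plane_decay d m r1' (GT l.-1)) _.
  rewrite ler_wpM2r ?exprn_ge0 ?(ltW rho0)//.
  have -> : 2 * (d + d)%:R * r ^+ d * T = Dc * b ^+ M by rewrite /T /Dc exprS; ring.
  by rewrite ler_wpM2r ?exprn_ge0 ?(ltW b0).
have small : kap * ((M + M).+1%:R * (C1 * e) + T / r ^+ M + e) <= 1 / 2.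
  apply: (mass_numeric kap0 c30 C10 Ch0 (ltW b0) r0 th tbr).
    apply: le_trans e3 _; rewrite ler_wpM2l// exprM; apply: lerXn2r => //.
      by rewrite nnegrE exprn_ge0// ltW.
    by rewrite nnegrE divr_ge0.
  have := ltW (HM2 M (leq_trans (leq_maxr _ _) MM3)); rewrite ler_pdivlMr// => h.
  by apply: le_trans h; rewrite -/D mulrC ler_wpM2l ?exprn_ge0// lerDl ler01.
have [m mM mc] := @dual_plane_mass d l M alpha r e (C1 * e) T (phi 0) what (H 0) G d0 r1' (HS 0)
   (fun j jl => Ge j 0 jl) T1 T2 (fun j _ => GT j) small c.
exists m => //; apply: le_trans mc _; rewrite -/kap.
by rewrite ler_wpM2r ?mxnorm_ge0// ler_wpM2r.
Qed.
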